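(* Let $1<r\le\infty$, $\mathfrak{D}:=\{z\in\mathbb{C}:|z|<r\}$, let $A,B\in\mathrm{M}_2(\mathbb{C})$, and let $G:\mathfrak{D}\to\mathrm{M}_2(\mathbb{C})$ be holomorphic. Assume: (a) $a_0$ is an eigenvector of $A$ for the eigenvalue $\alpha_0$, and $A-\alpha_0-k$ is invertible for all positive integers $k$; (b) $B$ has distinct eigenvalues $\beta_1\neq\beta_2$ such that $\delta:=\beta_2-\beta_1$ satisfies $\operatorname{Re}(\delta)>-1$, and $b_j$ is an eigenvector of $B$ for $\beta_j$, $j=1,2$; (c) $G(z)=\sum_{k\ge0}z^kG_k$ on $|z|<1$ and $G(z)=\sum_{k\ge0}(1-z)^k\tilde G_k$ on $|z-1|<\min\{1,r-1\}$. Consider the system $y'(z)=\big(\frac1zA+\frac{1}{z-1}B+G(z)\big)y(z)$. Let $y_0(z)=z^{\alpha_0}h_0(z)$ be its solution on $\mathfrak{G}_0:=\mathfrak{D}\setminus[1,r[$ with $h_0$ holomorphic and $h_0(0)=a_0$, and let $$Y(z)=H(z)\begin{pmatrix}(1-z)^{\beta_1}&0\\0&(1-z)^{\beta_2}\end{pmatrix}\begin{pmatrix}1&0\\ q\log(1-z)&1\end{pmatrix}$$ be a fundamental matrix on $\mathfrak{G}_1:=\mathfrak{D}\setminus\,]-r,0]$, where $H$ is holomorphic on $\mathfrak{G}_1$ with $H(1)e_1=b_1$, $H(1)e_2=b_2$, and $q\in\mathbb{C}$ with $q=0$ if $\delta\notin\mathbb{Z}$. Define the connection coefficients $\Theta,\Omega$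 by $y_0(z)=Y(z)\binom{\Theta}{\Omega}$ on $\mathfrak{G}_0\cap\mathfrak{G}_1$. Let $d_k$ be defined by $(1-z)^{-\beta_1-1}h_0(z)=\sum_{k\ge0}z^kd_k$ for $|z|<1$, and let $\tilde d_k$ be defined by $(1-z)^{-\beta_1-1}z^{-\alpha_0}Y(z)e_2=(1-z)^{\delta-1}\sum_{k\ge0}(1-z)^k\tilde d_k$ near $z=1$ (so $\tilde d_0=b_2$). Then for any fixed integer $n\ge0$, $$d_k=\Theta b_1+\frac{\omega}{\Gamma(k+1)}\sum_{\ell=0}^n(-1)^\ell\,\Gamma(\ell+\delta)\,\Gamma(k-\ell+1-\delta)\,\tilde d_\ell+O\big(k^{-\operatorname{Re}(\delta)-n-1}\big)\quad\text{as }k\to\infty,$$ with some constant $\omega$ which is independent of $k$ and $n$.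
   Context: $e_1,e_2$ denote the standard basis of $\mathbb{C}^2$. Powers and logarithms are principal branches: $z^{\alpha}$ with $-\pi<\arg z<\pi$, $(1-z)^{\beta}$ and $\log(1-z)$ with $-\pi<\arg(1-z)<\pi$. $\Gamma$ is the Gamma function. *)

(* Defs.v *)
From Stdlib Require Import Reals ZArith.
From Stdlib Require Import ClassicalEpsilon ClassicalDescription.
From Coquelicot Require Import Coquelicot.
Open Scope R_scope.

Definition cexp (z : C) : C := (exp (Re z) * cos (Im z), exp (Re z) * sin (Im z)).

(* principal argument in ]-PI, PI] (atan2) *)
Definition carg (z : C) : R :=
  if Rlt_dec 0 (Re z) then atan (Im z / Re z)
  else if Rlt_dec (Re z) 0 then
    (if Rle_dec 0 (Im z) then atan (Im z / Re z) + PI else atan (Im z / Re z) - PI)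
  else if Rlt_dec 0 (Im z) then PI / 2
  else if Rlt_dec (Im z) 0 then - (PI / 2) else 0.

Definition clog (z : C) : C := (ln (Cmod z), carg z).

Definition cpow (z a : C) : C :=
  if Ceq_dec z 0 then 0%C else cexp (a * clog z)%C.

Definition Clim (u : nat -> C) : C :=
  match excluded_middle_informative
          (exists l : C, filterlim u eventually (locally (l : C_NormedModule))) with
  | left H => proj1_sig (constructive_indefinite_description _ H)
  | right _ => 0%C
  end.

Fixpoint cpoch (z : C) (n : nat) : C :=  (* z (z+1) ... (z+n) *)
  match n with
  | O => z
  | S m => (cpoch z m * (z + RtoC (INR (S m))))%C
  end.

(* Gamma function (Gauss' product / limit definition, valid for all
   z not a non-positive integer):
   Gamma z = lim_n  n! n^z / (z (z+1) ... (z+n)) *)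
Definition CGamma (z : C) : C :=
  Clim (fun n => (RtoC (INR (fact n)) * cpow (RtoC (INR n)) z / cpoch z n)%C).

Definition vec := (C * C)%type.
Record mat := Mat { m11 : C; m12 : C; m21 : C; m22 : C }.

Definition vzero : vec := (RtoC 0, RtoC 0).
Definition e1 : vec := (RtoC 1, RtoC 0).
Definition e2 : vec := (RtoC 0, RtoC 1).
Definition vadd (u v : vec) : vec := (fst u + fst v, snd u + snd v)%C.
Definition vsub (u v : vec) : vec := (fst u - fst v, snd u - snd v)%C.
Definition vscal (c : C) (v : vec) : vec := (c * fst v, c * snd v)%C.
Definition vnorm (v : vec) : R := Cmod (fst v) + Cmod (snd v).

Definition mv (M : mat) (v : vec) : vec :=
  (m11 M * fst v + m12 M * snd v, m21 M * fst v + m22 M * snd v)%C.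
Definition mm (M N : mat) : mat :=
  Mat (m11 M * m11 N + m12 M * m21 N)%C (m11 M * m12 N + m12 M * m22 N)%C
      (m21 M * m11 N + m22 M * m21 N)%C (m21 M * m12 N + m22 M * m22 N)%C.
Definition madd (M N : mat) : mat :=
  Mat (m11 M + m11 N)%C (m12 M + m12 N)%C (m21 M + m21 N)%C (m22 M + m22 N)%C.
Definition mscal (c : C) (M : mat) : mat :=
  Mat (c * m11 M)%C (c * m12 M)%C (c * m21 M)%C (c * m22 M)%C.
Definition mid : mat := Mat 1%C 0%C 0%C 1%C.
Definition mdet (M : mat) : C := (m11 M * m22 M - m12 M * m21 M)%C.
Definition col1 (M : mat) : vec := (m11 M, m21 M).
Definition col2 (M : mat) : vec := (m12 M, m22 M).

Definition holo_on (U : C -> Prop) (f : C -> C) : Prop :=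
  forall z : C, U z -> ex_derive (f : C_AbsRing -> C_NormedModule) z.
Definition mholo_on (U : C -> Prop) (F : C -> mat) : Prop :=
  holo_on U (fun z => m11 (F z)) /\ holo_on U (fun z => m12 (F z)) /\
  holo_on U (fun z => m21 (F z)) /\ holo_on U (fun z => m22 (F z)).
Definition vholo_on (U : C -> Prop) (f : C -> vec) : Prop :=
  holo_on U (fun z => fst (f z)) /\ holo_on U (fun z => snd (f z)).

Definition vis_derive (f : C -> vec) (z : C) (l : vec) : Prop :=
  is_derive ((fun w => fst (f w)) : C_AbsRing -> C_NormedModule) z (fst l) /\
  is_derive ((fun w => snd (f w)) : C_AbsRing -> C_NormedModule) z (snd l).

Definition cseries (a : nat -> C) (s : C) : Prop :=
  is_series (a : nat -> C_NormedModule) s.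
Definition vseries (a : nat -> vec) (s : vec) : Prop :=
  cseries (fun k => fst (a k)) (fst s) /\ cseries (fun k => snd (a k)) (snd s).
Definition mseries (a : nat -> mat) (s : mat) : Prop :=
  cseries (fun k => m11 (a k)) (m11 s) /\ cseries (fun k => m12 (a k)) (m12 s) /\
  cseries (fun k => m21 (a k)) (m21 s) /\ cseries (fun k => m22 (a k)) (m22 s).

Definition diskD (r : Rbar) (z : C) : Prop := Rbar_lt (Cmod z) r.
Definition dom0 (r : Rbar) (z : C) : Prop := diskD r z /\ ~ (Im z = 0 /\ 1 <= Re z).
Definition dom1 (r : Rbar) (z : C) : Prop := diskD r z /\ ~ (Im z = 0 /\ Re z <= 0).

Definition sysM (A B : mat) (G : C -> mat) (z : C) : mat :=
  madd (madd (mscal (/ z)%C A) (mscal (/ (z - 1))%C B)) (G z).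

Definition is_integer (c : C) : Prop := exists m : Z, c = RtoC (IZR m).

Definition fundY (H : C -> mat) (b1 b2 q : C) (z : C) : mat :=
  mm (mm (H z) (Mat (cpow (1 - z) b1) 0%C 0%C (cpow (1 - z) b2)))
     (Mat 1%C 0%C (q * clog (1 - z))%C 1%C).

(* Main.v *)
Require Import Defs.
From Stdlib Require Import Reals ZArith List.
From Stdlib Require Import Lra Lia Psatz Classical ClassicalEpsilon ClassicalDescription.
From Coquelicot Require Import Coquelicot.
Open Scope R_scope.
Set Bullet Behavior "Strict Subproofs".

(** The function f(z) = (1-z)^(-beta1-1) h0(z) is holomorphic on a disc of radius larger than 1, cut
    along [1, r[.  The connection relation shows that near z = 1 it equals
    Theta b1 / (1-z), plus a function with a removable singularity, plus lambda X(z) psi(z), where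
    psi(z) is the sum of the series with coefficients [dt l] and the model singularity X is
    (1-z)^(delta-1), lambda = Omega if delta is not an integer, and (1-z)^(delta-1) log(1-z),
    lambda = Theta q otherwise.  The Taylor coefficients of (1-z)^l X(z) are explicit Gamma quotients.
    After finitely many of these terms are subtracted, the rest F satisfies F - P = O(|1-z|^M) with P
    regular at 1.  Deforming the Cauchy integral of its k-th coefficient to a larger circle and a
    contour of width 1/k around the cut gives O(k^-M), since the contour integral of P is
    exponentially small.  Holomorphy is used only through Goursat's theorem on rectangles, in the
    variable log z. *)

(** In the variable w = log z a circle becomes a vertical segment of length 2 pi, the cut disc is
    met in rectangles, and z^(-k-1) dz becomes exp (-k w) dw; periodicity in Im w replaces closed
    contours. The regular part P extends across the cut because z^(-alpha0) and H are holomorphic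
    around 1; this lets its contour be closed although F lives only off the cut. Two model
    singularities are needed because the factor between the Taylor coefficients of (1-z)^(l+delta-1)
    and the Gamma quotients is sin (pi delta) / pi, which vanishes for integer delta: the power is
    then a polynomial and the logarithm takes over, with factor (-1)^delta. In both cases the factor
    depends neither on l nor on k, so that a single omega serves every n. The transfer step is
    lossy, since it only uses that the model singularity is O(|1-z|^-2). More terms than requested
    are therefore subtracted, and the surplus ones are discarded afterwards by their own size k^(-Re
    delta - l). *)

(** * Complex differentiability *)

Definition ccont (f : C -> C) (z : C) : Prop :=
  forall eps, 0 < eps -> exists del, 0 < del /\
    forall w, Cmod (w - z) < del -> Cmod (f w - f z) < eps.

Definition cder (f : C -> C) (z l : C) : Prop :=
  forall eps, 0 < eps -> exists del, 0 < del /\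
    forall w, Cmod (w - z) < del ->
      Cmod (f w - f z - l * (w - z)) <= eps * Cmod (w - z).

Lemma Cmod_sub_sym (a b : C) : Cmod (a - b) = Cmod (b - a).
Proof. rewrite <- Cmod_opp. f_equal. ring. Qed.

Lemma Cmod_sub_le (a b : C) : Cmod (a - b) <= Cmod a + Cmod b.
Proof. unfold Cminus. rewrite <- (Cmod_opp b). apply Cmod_triangle. Qed.

Lemma Cmod_sub_self (z : C) : Cmod (z - z) = 0.
Proof. replace (z - z)%C with (RtoC 0) by ring. apply Cmod_0. Qed.

Lemma Cmod_le_abs (x y : R) : Cmod (x, y) <= Rabs x + Rabs y.
Proof.
  replace ((x, y) : C) with (RtoC x + Ci * RtoC y)%C.
  - eapply Rle_trans; [apply Cmod_triangle|].
    rewrite Cmod_mult, Cmod_Ci, !Cmod_R. lra.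
  - unfold Ci, RtoC, Cplus, Cmult. simpl. f_equal; ring.
Qed.

Lemma Cminus_eq_0 (a b : C) : (a - b)%C = 0%C -> a = b.
Proof. intros E. replace a with ((a - b) + b)%C by ring. rewrite E. ring. Qed.

Lemma RtoC_neq_0 (x : R) : x <> 0 -> RtoC x <> 0%C.
Proof. intros H E. now apply H, RtoC_inj. Qed.

Lemma is_derive_cder (f : C -> C) (z l : C) :
  is_derive (f : C_AbsRing -> C_NormedModule) z l -> cder f z l.
Proof.
  intros [_ Hd] eps Heps.
  specialize (Hd z (fun P H => H) (mkposreal eps Heps)).
  destruct Hd as [del Hdel].
  exists del. split; [apply cond_pos|].
  intros w Hw. specialize (Hdel w Hw). simpl in Hdel.
  unfold minus, plus, opp, scal in Hdel; simpl in Hdel.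
  change (norm ?x) with (Cmod x) in Hdel.
  unfold mult in Hdel; simpl in Hdel.
  replace (f w - f z - l * (w - z))%C with (f w + - f z + - ((w + - z) * l))%C by ring.
  exact Hdel.
Qed.

Lemma ex_derive_cder (f : C -> C) (z : C) :
  ex_derive (f : C_AbsRing -> C_NormedModule) z -> exists l, cder f z l.
Proof. intros [l Hl]. exists l. now apply is_derive_cder. Qed.

Lemma ccont_ext_loc (f g : C -> C) (z : C) (r : R) : 0 < r ->
  (forall w, Cmod (w - z) < r -> f w = g w) -> ccont f z -> ccont g z.
Proof.
  intros Hr He Hf eps Heps. destruct (Hf eps Heps) as [d [Hd H]].
  exists (Rmin d r). split; [now apply Rmin_glb_lt|].
  intros w Hw.
  rewrite <- (He w), <- (He z) by (first [rewrite Cmod_sub_self; lra | eapply Rlt_le_trans; [apply Hw|apply Rmin_r]]).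
  apply H. eapply Rlt_le_trans; [apply Hw|apply Rmin_l].
Qed.

Lemma cder_ext_loc (f g : C -> C) (z l : C) (r : R) : 0 < r ->
  (forall w, Cmod (w - z) < r -> f w = g w) -> cder f z l -> cder g z l.
Proof.
  intros Hr He Hf eps Heps. destruct (Hf eps Heps) as [d [Hd H]].
  exists (Rmin d r). split; [now apply Rmin_glb_lt|].
  intros w Hw.
  rewrite <- (He w), <- (He z) by (first [rewrite Cmod_sub_self; lra | eapply Rlt_le_trans; [apply Hw|apply Rmin_r]]).
  apply H. eapply Rlt_le_trans; [apply Hw|apply Rmin_l].
Qed.

Lemma ccont_const (c z : C) : ccont (fun _ => c) z.
Proof. intros eps He. exists 1. split; [lra|]. intros w _. rewrite Cmod_sub_self; lra. Qed.

Lemma ccont_id (z : C) : ccont (fun w => w) z.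
Proof. intros eps He. exists eps. auto. Qed.

Lemma ccont_plus (f g : C -> C) (z : C) :
  ccont f z -> ccont g z -> ccont (fun w => f w + g w)%C z.
Proof.
  intros Hf Hg eps He.
  destruct (Hf (eps/2) ltac:(lra)) as [d1 [Hd1 H1]].
  destruct (Hg (eps/2) ltac:(lra)) as [d2 [Hd2 H2]].
  exists (Rmin d1 d2). split; [now apply Rmin_glb_lt|]. intros w Hw.
  replace (f w + g w - (f z + g z))%C with ((f w - f z) + (g w - g z))%C by ring.
  eapply Rle_lt_trans; [apply Cmod_triangle|].
  assert (Cmod (w - z) < d1) by (eapply Rlt_le_trans; [apply Hw|apply Rmin_l]).
  assert (Cmod (w - z) < d2) by (eapply Rlt_le_trans; [apply Hw|apply Rmin_r]).
  specialize (H1 w). specialize (H2 w). lra.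
Qed.

Lemma ccont_mult (f g : C -> C) (z : C) :
  ccont f z -> ccont g z -> ccont (fun w => f w * g w)%C z.
Proof.
  intros Hf Hg eps He.
  set (A := Cmod (f z)). set (B := Cmod (g z)).
  assert (HA : 0 <= A) by apply Cmod_ge_0. assert (HB : 0 <= B) by apply Cmod_ge_0.
  assert (HK : 0 < A + B + 1) by lra.
  (* With both errors below e <= 1 the product rule costs e e + (A + B) e <= (A + B + 1) e. *)
  assert (He' : 0 < Rmin 1 (eps / (A + B + 1))).
  { apply Rmin_glb_lt; [lra|]. now apply Rdiv_lt_0_compat. }
  set (e := Rmin 1 (eps / (A + B + 1))) in *.
  destruct (Hf e He') as [d1 [Hd1 H1]].
  destruct (Hg e He') as [d2 [Hd2 H2]].
  exists (Rmin d1 d2). split; [now apply Rmin_glb_lt|]. intros w Hw.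
  assert (Hw1 : Cmod (w - z) < d1) by (eapply Rlt_le_trans; [apply Hw|apply Rmin_l]).
  assert (Hw2 : Cmod (w - z) < d2) by (eapply Rlt_le_trans; [apply Hw|apply Rmin_r]).
  specialize (H1 w Hw1). specialize (H2 w Hw2).
  replace (f w * g w - f z * g z)%C with
    ((f w - f z) * (g w - g z) + (f z * (g w - g z) + g z * (f w - f z)))%C by ring.
  eapply Rle_lt_trans; [apply Cmod_triangle|].
  eapply Rle_lt_trans; [apply Rplus_le_compat_l, Cmod_triangle|].
  rewrite !Cmod_mult. fold A B.
  pose proof (Cmod_ge_0 (f w - f z)). pose proof (Cmod_ge_0 (g w - g z)).
  assert (He1 : e <= 1) by apply Rmin_l.
  assert (He2 : e * (A + B + 1) <= eps).
  { replace eps with (eps / (A + B + 1) * (A + B + 1)) by (field; lra).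
    apply Rmult_le_compat_r; [lra|apply Rmin_r]. }
  set (x := Cmod (f w - f z)) in *. set (y := Cmod (g w - g z)) in *.
  nra.
Qed.

Lemma ccont_opp (f : C -> C) (z : C) : ccont f z -> ccont (fun w => - f w)%C z.
Proof.
  intros Hf. apply (ccont_ext_loc (fun w => (-1) * f w)%C _ z 1); [lra|intros; ring|].
  apply ccont_mult; [apply ccont_const|exact Hf].
Qed.

Lemma ccont_minus (f g : C -> C) (z : C) :
  ccont f z -> ccont g z -> ccont (fun w => f w - g w)%C z.
Proof. intros Hf Hg. apply ccont_plus; [exact Hf|now apply ccont_opp]. Qed.

Lemma ccont_comp (f g : C -> C) (z : C) :
  ccont f (g z) -> ccont g z -> ccont (fun w => f (g w)) z.
Proof.
  intros Hf Hg eps He. destruct (Hf eps He) as [d [Hd H]].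
  destruct (Hg d Hd) as [d' [Hd' H']]. exists d'. split; [exact Hd'|].
  intros w Hw. apply H, H', Hw.
Qed.

Lemma ccont_inv (z : C) : z <> 0%C -> ccont Cinv z.
Proof.
  intros Hz eps He.
  assert (Hm : 0 < Cmod z) by now apply Cmod_gt_0.
  exists (Rmin (Cmod z / 2) (eps * (Cmod z * Cmod z) / 2)).
  split. { apply Rmin_glb_lt; [lra|]. apply Rdiv_lt_0_compat; [|lra]. repeat apply Rmult_lt_0_compat; lra. }
  intros w Hw.
  assert (Hw1 : Cmod (w - z) < Cmod z / 2) by (eapply Rlt_le_trans; [apply Hw|apply Rmin_l]).
  assert (Hw2 : Cmod (w - z) < eps * (Cmod z * Cmod z) / 2)
    by (eapply Rlt_le_trans; [apply Hw|apply Rmin_r]).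
  assert (Hwm : Cmod z / 2 < Cmod w).
  { pose proof (Cmod_sub_le w (w - z)) as Ht.
    replace (w - (w - z))%C with z in Ht by ring. lra. }
  assert (Hw0 : w <> 0%C) by (apply Cmod_gt_0; lra).
  replace (/ w - / z)%C with ((z - w) / (w * z))%C by (field; auto).
  rewrite Cmod_div by (apply Cmult_neq_0; auto).
  rewrite Cmod_mult, Cmod_sub_sym.
  apply (Rmult_lt_reg_r (Cmod w * Cmod z)); [nra|].
  unfold Rdiv. rewrite Rmult_assoc, Rinv_l by nra.
  assert (Cmod z / 2 * Cmod z < Cmod w * Cmod z) by (apply Rmult_lt_compat_r; lra).
  assert (eps * (Cmod z / 2 * Cmod z) < eps * (Cmod w * Cmod z))
    by (apply Rmult_lt_compat_l; lra).
  lra.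
Qed.

Lemma ccont_div (f g : C -> C) (z : C) : g z <> 0%C ->
  ccont f z -> ccont g z -> ccont (fun w => f w / g w)%C z.
Proof.
  intros H Hf Hg. apply ccont_mult; [exact Hf|].
  apply (ccont_comp Cinv g); [now apply ccont_inv|exact Hg].
Qed.

(* Caratheodory's form of differentiability turns the rules of calculus into ring identities. *)
Lemma cder_caratheodory (f : C -> C) (z l : C) :
  cder f z l <-> exists s, ccont s z /\ s z = l /\ forall w, (f w = f z + s w * (w - z))%C.
Proof.
  split.
  - intros H.
    exists (fun w => if Ceq_dec w z then l else ((f w - f z) / (w - z))%C).
    assert (Hzz : (if Ceq_dec z z then l else ((f z - f z) / (z - z))%C) = l).
    { destruct (Ceq_dec z z); congruence. }
    split; [|split; [exact Hzz|]].
    + intros eps He. destruct (H (eps/2) ltac:(lra)) as [d [Hd Hw]].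
      exists d. split; [exact Hd|]. intros w Hwd.
      rewrite Hzz.
      destruct (Ceq_dec w z) as [E|E]; [rewrite Cmod_sub_self; lra|].
      specialize (Hw w Hwd).
      assert (Hn : (w - z)%C <> 0%C) by (intros E'; apply E; apply Cminus_eq_0; exact E').
      replace ((f w - f z) / (w - z) - l)%C with ((f w - f z - l * (w - z)) / (w - z))%C
        by (field; auto).
      rewrite Cmod_div by auto.
      assert (0 < Cmod (w - z)) by now apply Cmod_gt_0.
      apply (Rmult_lt_reg_r (Cmod (w - z))); [lra|].
      unfold Rdiv. rewrite Rmult_assoc, Rinv_l by lra. nra.
    + intros w. destruct (Ceq_dec w z) as [E|E]; [subst; ring|].
      field. intros E'; apply E; apply Cminus_eq_0; exact E'.
  - intros [s [Hc [Hl Hw]]] eps He.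
    destruct (Hc eps He) as [d [Hd H]]. exists d. split; [exact Hd|].
    intros w Hwd. rewrite (Hw w), <- Hl.
    replace (f z + s w * (w - z) - f z - s z * (w - z))%C with ((s w - s z) * (w - z))%C by ring.
    rewrite Cmod_mult. apply Rmult_le_compat_r; [apply Cmod_ge_0|].
    left. now apply H.
Qed.

Lemma cder_ccont (f : C -> C) (z l : C) : cder f z l -> ccont f z.
Proof.
  intros H. apply cder_caratheodory in H. destruct H as [s [Hc [_ Hw]]].
  apply (ccont_ext_loc (fun w => f z + s w * (w - z))%C _ z 1); [lra| |].
  - intros w _. symmetry. apply Hw.
  - apply ccont_plus; [apply ccont_const|]. apply ccont_mult; [exact Hc|].
    apply ccont_minus; [apply ccont_id|apply ccont_const].
Qed.

Lemma cder_const (c z : C) : cder (fun _ => c) z 0.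
Proof.
  apply cder_caratheodory. exists (fun _ => 0%C).
  split; [apply ccont_const|]. split; [reflexivity|]. intros; ring.
Qed.

Lemma cder_id (z : C) : cder (fun w => w) z 1.
Proof.
  apply cder_caratheodory. exists (fun _ => 1%C).
  split; [apply ccont_const|]. split; [reflexivity|]. intros; ring.
Qed.

Lemma cder_plus (f g : C -> C) (z l m : C) :
  cder f z l -> cder g z m -> cder (fun w => f w + g w)%C z (l + m).
Proof.
  intros Hf Hg. apply cder_caratheodory in Hf, Hg. apply cder_caratheodory.
  destruct Hf as [s [Hs [Hl Hsw]]]. destruct Hg as [t [Ht [Hm Htw]]].
  exists (fun w => s w + t w)%C. split; [now apply ccont_plus|].
  split; [now rewrite Hl, Hm|]. intros w. rewrite (Hsw w), (Htw w). ring.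
Qed.

Lemma cder_mult (f g : C -> C) (z l m : C) :
  cder f z l -> cder g z m -> cder (fun w => f w * g w)%C z (l * g z + f z * m).
Proof.
  intros Hf Hg. pose proof (cder_ccont _ _ _ Hg) as Hgc.
  apply cder_caratheodory in Hf, Hg. apply cder_caratheodory.
  destruct Hf as [s [Hs [Hl Hsw]]]. destruct Hg as [t [Ht [Hm Htw]]].
  exists (fun w => s w * g w + f z * t w)%C. split.
  - apply ccont_plus; apply ccont_mult; auto. apply ccont_const.
  - split; [now rewrite Hl, Hm|]. intros w. rewrite (Hsw w), (Htw w). ring.
Qed.

Lemma cder_comp (f g : C -> C) (z l m : C) :
  cder f (g z) l -> cder g z m -> cder (fun w => f (g w)) z (l * m).
Proof.
  intros Hf Hg. pose proof (cder_ccont _ _ _ Hg) as Hgc.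
  apply cder_caratheodory in Hf, Hg. apply cder_caratheodory.
  destruct Hf as [s [Hs [Hl Hsw]]]. destruct Hg as [t [Ht [Hm Htw]]].
  exists (fun w => s (g w) * t w)%C. split.
  - apply ccont_mult; auto. now apply (ccont_comp s g).
  - split; [now rewrite Hl, Hm|]. intros w. rewrite (Hsw (g w)), (Htw w). ring.
Qed.

Lemma cder_scal (c : C) (f : C -> C) (z l : C) :
  cder f z l -> cder (fun w => c * f w)%C z (c * l).
Proof.
  intros H. pose proof (cder_mult _ _ _ _ _ (cder_const c z) H) as H'.
  cbv beta in H'. replace (0 * f z + c * l)%C with (c * l)%C in H' by ring. exact H'.
Qed.

Lemma cder_minus (f g : C -> C) (z l m : C) :
  cder f z l -> cder g z m -> cder (fun w => f w - g w)%C z (l - m).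
Proof.
  intros Hf Hg. replace (l - m)%C with (l + (-1) * m)%C by ring.
  apply (cder_ext_loc (fun w => f w + (-1) * g w)%C _ z _ 1); [lra|intros; ring|].
  apply cder_plus; [exact Hf|now apply cder_scal].
Qed.

Lemma cder_inv (z : C) : z <> 0%C -> cder Cinv z (- / (z * z)).
Proof.
  intros Hz. assert (Hm : 0 < Cmod z) by now apply Cmod_gt_0.
  (* The slope comes from 1/w = 1/z - (w - z)/(z w). Its value at w = 0 is arbitrary, because the
     functions are compared only for |w - z| < |z|. *)
  apply (cder_ext_loc (fun w => / z + (- / (z * (if Ceq_dec w 0 then z else w))) * (w - z))%C
           _ z _ (Cmod z)); [exact Hm| |].
  - intros w Hw. destruct (Ceq_dec w 0) as [E|E].
    + subst w. exfalso. rewrite Cmod_sub_sym in Hw.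
      replace (z - 0)%C with z in Hw by ring. lra.
    + field. auto.
  - apply cder_caratheodory.
    exists (fun w => - / (z * (if Ceq_dec w 0 then z else w)))%C. split; [|split].
    + apply (ccont_ext_loc (fun w => - / (z * w))%C _ z (Cmod z)); [exact Hm| |].
      * intros w Hw. destruct (Ceq_dec w 0) as [E|E]; [|reflexivity].
        subst w. exfalso. rewrite Cmod_sub_sym in Hw.
        replace (z - 0)%C with z in Hw by ring. lra.
      * apply ccont_opp. apply (ccont_comp Cinv (fun w => z * w)%C).
        -- apply ccont_inv. now apply Cmult_neq_0.
        -- apply ccont_mult; [apply ccont_const|apply ccont_id].
    + destruct (Ceq_dec z 0); [contradiction|reflexivity].
    + intros w. ring.
Qed.

Lemma cder_pow (z : C) (n : nat) : cder (fun w => w ^ n)%C z (RtoC (INR n) * z ^ (pred n)).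
Proof.
  induction n as [|n IH].
  - simpl. replace (RtoC 0 * 1)%C with (RtoC 0) by ring. apply cder_const.
  - pose proof (cder_mult _ _ _ _ _ (cder_id z) IH) as H.
    replace (RtoC (INR (S n)) * z ^ pred (S n))%C
      with (1 * z ^ n + z * (RtoC (INR n) * z ^ pred n))%C; [exact H|].
    rewrite S_INR, RtoC_plus. destruct n as [|n]; simpl; ring.
Qed.

(** * Integrals over rectangles and Goursat's theorem *)

Definition CI (f : R -> C) (a b : R) : C := RInt (V := C_R_CompleteNormedModule) f a b.

Definition rcont (f : R -> C) (t : R) : Prop :=
  forall eps, 0 < eps -> exists del, 0 < del /\
    forall s, Rabs (s - t) < del -> Cmod (f s - f t) < eps.

Lemma rcont_continuous (f : R -> C) (t : R) : rcont f t ->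
  continuous (f : R_UniformSpace -> C_R_CompleteNormedModule) t.
Proof.
  intros H P [eps HP]. destruct (H eps (cond_pos eps)) as [d [Hd Hs]].
  exists (mkposreal d Hd). intros s Hb. apply HP.
  apply C_NormedModule_mixin_compat1. apply Hs. exact Hb.
Qed.

Lemma Cmod_norm_R (z : C) : norm (z : C_R_NormedModule) = Cmod z.
Proof.
  destruct z as [x y]. unfold norm; simpl. unfold prod_norm, Cmod; simpl.
  f_equal. unfold norm; simpl. unfold abs; simpl.
  pose proof (Rsqr_abs x). pose proof (Rsqr_abs y). unfold Rsqr in *. lra.
Qed.

Lemma rcont_is_RInt (f : R -> C) (a b : R) : a <= b ->
  (forall t, a <= t <= b -> rcont f t) ->
  is_RInt (f : R -> C_R_CompleteNormedModule) a b (CI f a b).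
Proof.
  intros Hab H. apply (RInt_correct (V := C_R_CompleteNormedModule)).
  apply (ex_RInt_continuous (V := C_R_CompleteNormedModule)).
  intros t Ht. rewrite Rmin_left, Rmax_right in Ht by lra. now apply rcont_continuous, H.
Qed.

Lemma CI_unique (f : R -> C) (a b : R) (l : C) :
  is_RInt (f : R -> C_R_CompleteNormedModule) a b l -> CI f a b = l.
Proof. apply (is_RInt_unique (V := C_R_CompleteNormedModule)). Qed.

Lemma CI_ext (f g : R -> C) (a b : R) : a <= b ->
  (forall t, a <= t <= b -> f t = g t) -> CI f a b = CI g a b.
Proof.
  intros Hab H. apply (RInt_ext (V := C_R_CompleteNormedModule)).
  intros t Ht. rewrite Rmin_left, Rmax_right in Ht by lra. apply H; lra.
Qed.

Lemma CI_bound (f : R -> C) (a b M : R) : a <= b ->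
  (forall t, a <= t <= b -> rcont f t) ->
  (forall t, a <= t <= b -> Cmod (f t) <= M) -> Cmod (CI f a b) <= (b - a) * M.
Proof.
  intros Hab Hc HM. rewrite <- Cmod_norm_R.
  apply (norm_RInt_le_const (V := C_R_NormedModule) f a b); [exact Hab| |now apply rcont_is_RInt].
  intros t Ht. rewrite Cmod_norm_R. now apply HM.
Qed.

Lemma CI_plus (f g : R -> C) (a b : R) : a <= b ->
  (forall t, a <= t <= b -> rcont f t) -> (forall t, a <= t <= b -> rcont g t) ->
  CI (fun t => f t + g t)%C a b = (CI f a b + CI g a b)%C.
Proof.
  intros Hab Hf Hg. apply CI_unique.
  apply (is_RInt_plus (V := C_R_NormedModule) f g); now apply rcont_is_RInt.
Qed.

Lemma CI_minus (f g : R -> C) (a b : R) : a <= b ->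
  (forall t, a <= t <= b -> rcont f t) -> (forall t, a <= t <= b -> rcont g t) ->
  CI (fun t => f t - g t)%C a b = (CI f a b - CI g a b)%C.
Proof.
  intros Hab Hf Hg. apply CI_unique.
  apply (is_RInt_minus (V := C_R_NormedModule) f g); now apply rcont_is_RInt.
Qed.

(** A complex factor is not a scalar of the real module in which the integral is taken, so linearity
    is checked on real and imaginary parts. *)
Lemma CI_scal (c : C) (f : R -> C) (a b : R) : a <= b ->
  (forall t, a <= t <= b -> rcont f t) ->
  CI (fun t => c * f t)%C a b = (c * CI f a b)%C.
Proof.
  intros Hab Hf. apply CI_unique.
  pose proof (rcont_is_RInt f a b Hab Hf) as H.
  pose proof (is_RInt_fct_extend_fst (U := R_NormedModule) (V := R_NormedModule) _ _ _ _ H) as H1.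
  pose proof (is_RInt_fct_extend_snd (U := R_NormedModule) (V := R_NormedModule) _ _ _ _ H) as H2.
  apply (is_RInt_fct_extend_pair (U := R_NormedModule) (V := R_NormedModule)
           (fun t => c * f t)%C a b).
  - apply (is_RInt_minus (V := R_NormedModule) (fun t => fst c * fst (f t)) (fun t => snd c * snd (f t)));
      apply (is_RInt_scal (V := R_NormedModule)); assumption.
  - apply (is_RInt_plus (V := R_NormedModule) (fun t => fst c * snd (f t)) (fun t => snd c * fst (f t)));
      apply (is_RInt_scal (V := R_NormedModule)); assumption.
Qed.

Lemma CI_Chasles (f : R -> C) (a b c : R) : a <= b -> b <= c ->
  (forall t, a <= t <= c -> rcont f t) -> CI f a c = (CI f a b + CI f b c)%C.
Proof.
  intros Hab Hbc Hf. apply CI_unique.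
  apply (is_RInt_Chasles (V := C_R_NormedModule) f a b c);
    apply rcont_is_RInt; auto; intros t Ht; apply Hf; lra.
Qed.

Lemma CI_const (c : C) (a b : R) : CI (fun _ => c) a b = (RtoC (b - a) * c)%C.
Proof.
  unfold CI. rewrite (RInt_const (V := C_R_CompleteNormedModule)).
  unfold scal; simpl. unfold prod_scal; simpl. unfold scal; simpl. unfold mult; simpl.
  destruct c as [x y]. unfold Cmult, RtoC; simpl. f_equal; ring.
Qed.

Definition rder (f : R -> C) (t : R) (l : C) : Prop :=
  forall eps, 0 < eps -> exists del, 0 < del /\
    forall s, Rabs (s - t) < del ->
      Cmod (f s - f t - RtoC (s - t) * l) <= eps * Rabs (s - t).

Lemma rder_is_derive (f : R -> C) (t : R) (l : C) : rder f t l ->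
  is_derive (f : R_AbsRing -> C_R_CompleteNormedModule) t l.
Proof.
  intros H. split; [apply is_linear_scal_l|].
  intros x Hx eps.
  rewrite <- (is_filter_lim_locally_unique _ _ Hx).
  destruct (H eps (cond_pos eps)) as [d [Hd Hs]].
  exists (mkposreal d Hd). intros s Hb. specialize (Hs s Hb).
  rewrite (Cmod_norm_R _).
  match goal with |- Cmod ?x <= _ => replace x with (f s - f t - RtoC (s - t) * l)%C end.
  - exact Hs.
  - unfold minus, plus, opp, scal; simpl. unfold prod_scal, prod_plus, prod_opp; simpl.
    unfold scal, plus, opp, mult; simpl. unfold mult; simpl.
    destruct (f s), (f t), l. unfold Cminus, Cplus, Copp, Cmult, RtoC; simpl. f_equal; ring.
Qed.

Lemma CI_FTC (G g : R -> C) (a b : R) : a <= b ->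
  (forall t, a <= t <= b -> rder G t (g t)) ->
  (forall t, a <= t <= b -> rcont g t) -> CI g a b = (G b - G a)%C.
Proof.
  intros Hab HG Hg. apply CI_unique.
  apply (is_RInt_derive (V := C_R_CompleteNormedModule) G g a b);
    intros t Ht; rewrite Rmin_left, Rmax_right in Ht by lra.
  - now apply rder_is_derive, HG.
  - now apply rcont_continuous, Hg.
Qed.

Lemma Cmod_horizontal (x x' y : R) : Cmod ((x, y) - (x', y)) = Rabs (x - x').
Proof.
  replace ((x, y) - (x', y))%C with (RtoC (x - x')); [apply Cmod_R|].
  unfold Cminus, Cplus, Copp, RtoC; simpl. f_equal; ring.
Qed.

Lemma Cmod_vertical (x y y' : R) : Cmod ((x, y) - (x, y')) = Rabs (y - y').
Proof.
  replace ((x, y) - (x, y'))%C with (Ci * RtoC (y - y'))%C.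
  - rewrite Cmod_mult, Cmod_Ci, Cmod_R. ring.
  - unfold Ci, Cminus, Cplus, Copp, Cmult, RtoC; simpl. f_equal; ring.
Qed.

Lemma ccont_horizontal (g : C -> C) (x y : R) : ccont g (x, y) -> rcont (fun t => g (t, y)) x.
Proof.
  intros H eps He. destruct (H eps He) as [d [Hd Hw]]. exists d. split; [exact Hd|].
  intros s Hs. apply Hw. now rewrite Cmod_horizontal.
Qed.

Lemma ccont_vertical (g : C -> C) (x y : R) : ccont g (x, y) -> rcont (fun t => g (x, t)) y.
Proof.
  intros H eps He. destruct (H eps He) as [d [Hd Hw]]. exists d. split; [exact Hd|].
  intros s Hs. apply Hw. now rewrite Cmod_vertical.
Qed.

Lemma cder_horizontal (G : C -> C) (x y : R) (l : C) :
  cder G (x, y) l -> rder (fun t => G (t, y)) x l.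
Proof.
  intros H eps He. destruct (H eps He) as [d [Hd Hw]]. exists d. split; [exact Hd|].
  intros s Hs. specialize (Hw (s, y)). rewrite Cmod_horizontal in Hw. specialize (Hw Hs).
  replace (RtoC (s - x) * l)%C with (l * ((s, y) - (x, y)))%C; [exact Hw|].
  destruct l. unfold Cminus, Cplus, Copp, Cmult, RtoC; simpl. f_equal; ring.
Qed.

Lemma cder_vertical (G : C -> C) (x y : R) (l : C) :
  cder G (x, y) l -> rder (fun t => G (x, t)) y (Ci * l)%C.
Proof.
  intros H eps He. destruct (H eps He) as [d [Hd Hw]]. exists d. split; [exact Hd|].
  intros s Hs. specialize (Hw (x, s)). rewrite Cmod_vertical in Hw. specialize (Hw Hs).
  replace (RtoC (s - y) * (Ci * l))%C with (l * ((x, s) - (x, y)))%C; [exact Hw|].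
  destruct l. unfold Ci, Cminus, Cplus, Copp, Cmult, RtoC; simpl. f_equal; ring.
Qed.

(* Both integrals are with respect to the real parameter: the integral of [g dz] over a vertical
   segment is [Ci * VI]. *)
Definition HI (g : C -> C) (y a b : R) : C := CI (fun t => g (t, y)) a b.
Definition VI (g : C -> C) (x c d : R) : C := CI (fun t => g (x, t)) c d.

Definition rect_int (g : C -> C) (a b c d : R) : C :=
  (HI g c a b + Ci * VI g b c d - HI g d a b - Ci * VI g a c d)%C.

Definition on_bdry (a b c d : R) (P : C -> Prop) : Prop :=
  (forall x, a <= x <= b -> P (x, c) /\ P (x, d)) /\
  (forall y, c <= y <= d -> P (a, y) /\ P (b, y)).

Lemma pair_neq_0 (x y : R) : x <> 0 \/ y <> 0 -> (x, y) <> (0, 0).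
Proof. intros H E. injection E; intros; lra. Qed.

Lemma rect_int_bound (g : C -> C) (a b c d M : R) : a <= b -> c <= d ->
  on_bdry a b c d (ccont g) -> on_bdry a b c d (fun z => Cmod (g z) <= M) ->
  Cmod (rect_int g a b c d) <= 2 * ((b - a) + (d - c)) * M.
Proof.
  intros Hab Hcd [Hc1 Hc2] [HM1 HM2]. unfold rect_int, HI, VI.
  assert (B1 : Cmod (CI (fun t => g (t, c)) a b) <= (b - a) * M).
  { apply CI_bound; auto; intros t Ht; [apply ccont_horizontal|]; now apply Hc1 || now apply HM1. }
  assert (B2 : Cmod (CI (fun t => g (t, d)) a b) <= (b - a) * M).
  { apply CI_bound; auto; intros t Ht; [apply ccont_horizontal|]; now apply Hc1 || now apply HM1. }
  assert (B3 : Cmod (CI (fun t => g (a, t)) c d) <= (d - c) * M).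
  { apply CI_bound; auto; intros t Ht; [apply ccont_vertical|]; now apply Hc2 || now apply HM2. }
  assert (B4 : Cmod (CI (fun t => g (b, t)) c d) <= (d - c) * M).
  { apply CI_bound; auto; intros t Ht; [apply ccont_vertical|]; now apply Hc2 || now apply HM2. }
  eapply Rle_trans; [apply Cmod_sub_le|].
  eapply Rle_trans; [apply Rplus_le_compat_r, Cmod_sub_le|].
  eapply Rle_trans; [apply Rplus_le_compat_r, Rplus_le_compat_r, Cmod_triangle|].
  rewrite !Cmod_mult, Cmod_Ci. lra.
Qed.

Lemma rect_int_minus (g h : C -> C) (a b c d : R) : a <= b -> c <= d ->
  on_bdry a b c d (ccont g) -> on_bdry a b c d (ccont h) ->
  rect_int (fun z => g z - h z)%C a b c d = (rect_int g a b c d - rect_int h a b c d)%C.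
Proof.
  intros Hab Hcd [G1 G2] [H1 H2]. unfold rect_int, HI, VI.
  rewrite (CI_minus (fun t => g (t, c)) (fun t => h (t, c))),
    (CI_minus (fun t => g (t, d)) (fun t => h (t, d))),
    (CI_minus (fun t => g (a, t)) (fun t => h (a, t))),
    (CI_minus (fun t => g (b, t)) (fun t => h (b, t))); auto;
    try (intros t Ht; first [apply ccont_horizontal | apply ccont_vertical];
      solve [now apply G1 | now apply G2 | now apply H1 | now apply H2]).
  ring.
Qed.

Lemma rect_int_hsplit (g : C -> C) (a m b c d : R) : a <= m <= b ->
  (forall x, a <= x <= b -> ccont g (x, c) /\ ccont g (x, d)) ->
  rect_int g a b c d = (rect_int g a m c d + rect_int g m b c d)%C.
Proof.
  intros Hm H. unfold rect_int, HI, VI.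
  rewrite (CI_Chasles (fun t => g (t, c)) a m b), (CI_Chasles (fun t => g (t, d)) a m b);
    try lra; try (intros t Ht; now apply ccont_horizontal, H).
  ring.
Qed.

Lemma rect_int_vsplit (g : C -> C) (a b c m d : R) : c <= m <= d ->
  (forall y, c <= y <= d -> ccont g (a, y) /\ ccont g (b, y)) ->
  rect_int g a b c d = (rect_int g a b c m + rect_int g a b m d)%C.
Proof.
  intros Hm H. unfold rect_int, HI, VI.
  rewrite (CI_Chasles (fun t => g (a, t)) c m d), (CI_Chasles (fun t => g (b, t)) c m d);
    try lra; try (intros t Ht; now apply ccont_vertical, H).
  ring.
Qed.

Lemma rcont_scal (c : C) (f : R -> C) (t : R) : rcont f t -> rcont (fun s => c * f s)%C t.
Proof.
  intros H eps He. pose proof (Cmod_ge_0 c).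
  destruct (H (eps / (Cmod c + 1))) as [d [Hd Hs]]; [apply Rdiv_lt_0_compat; lra|].
  exists d. split; [exact Hd|]. intros s Hst. specialize (Hs s Hst).
  replace (c * f s - c * f t)%C with (c * (f s - f t))%C by ring. rewrite Cmod_mult.
  apply (Rmult_lt_compat_r (Cmod c + 1)) in Hs; [|lra].
  unfold Rdiv in Hs. rewrite Rmult_assoc, Rinv_l in Hs by lra.
  pose proof (Cmod_ge_0 (f s - f t)). nra.
Qed.

Lemma rect_int_primitive (G g : C -> C) (a b c d : R) : a <= b -> c <= d ->
  (forall z, cder G z (g z)) -> (forall z, ccont g z) -> rect_int g a b c d = 0%C.
Proof.
  intros Hab Hcd HG Hg. unfold rect_int, HI, VI.
  assert (Hh : forall y, CI (fun t => g (t, y)) a b = (G (b, y) - G (a, y))%C).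
  { intros y. apply (CI_FTC (fun t => G (t, y))); auto; intros t _.
    - now apply cder_horizontal. - now apply ccont_horizontal. }
  assert (Hv : forall x, (Ci * CI (fun t => g (x, t)) c d)%C = (G (x, d) - G (x, c))%C).
  { intros x. rewrite <- CI_scal; auto; [|intros; now apply ccont_vertical].
    apply (CI_FTC (fun t => G (x, t)) (fun t => Ci * g (x, t))%C); auto; intros t _.
    - now apply cder_vertical. - now apply rcont_scal, ccont_vertical. }
  rewrite !Hh, !Hv. ring.
Qed.

(** The first-order Taylor polynomial at the limit point of the bisection drops out of Goursat's
    estimate, having a primitive. *)
Lemma rect_int_affine (p q z : C) (a b c d : R) : a <= b -> c <= d ->
  rect_int (fun w => p + q * (w - z))%C a b c d = 0%C.
Proof.
  intros Hab Hcd.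
  apply (rect_int_primitive (fun w => p * w + (q / 2) * ((w - z) * (w - z)))%C); auto; intros w.
  - replace (p + q * (w - z))%C
      with (p * 1 + (q / 2) * ((1 - 0) * (w - z) + (w - z) * (1 - 0)))%C.
    + apply cder_plus; [apply cder_scal, cder_id|]. apply cder_scal.
      assert (cder (fun w => w - z)%C w (1 - 0)) by (apply cder_minus; [apply cder_id|apply cder_const]).
      now apply (cder_mult (fun w => w - z)%C (fun w => w - z)%C).
    + field.
  - apply ccont_plus; [apply ccont_const|]. apply ccont_mult; [apply ccont_const|].
    apply ccont_minus; [apply ccont_id|apply ccont_const].
Qed.

Definition rect : Type := (R * R * R * R)%type.

Definition bisect (g : C -> C) (q : rect) : rect :=
  let '(a, b, c, d) := q in
  let m := (a + b) / 2 in let n := (c + d) / 2 in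
  let I0 := Cmod (rect_int g a b c d) / 4 in
  if Rle_dec I0 (Cmod (rect_int g a m c n)) then (a, m, c, n)
  else if Rle_dec I0 (Cmod (rect_int g m b c n)) then (m, b, c, n)
  else if Rle_dec I0 (Cmod (rect_int g a m n d)) then (a, m, n, d)
  else (m, b, n, d).

Definition subrect (q q' : rect) : Prop :=
  let '(a, b, c, d) := q in let '(a', b', c', d') := q' in
  a <= a' /\ a' <= b' /\ b' <= b /\ c <= c' /\ c' <= d' /\ d' <= d.

Lemma bisect_spec (g : C -> C) (a b c d : R) : a <= b -> c <= d ->
  (forall x y, a <= x <= b -> c <= y <= d -> ccont g (x, y)) ->
  let '(a', b', c', d') := bisect g (a, b, c, d) in
  subrect (a, b, c, d) (a', b', c', d') /\
  b' - a' = (b - a) / 2 /\ d' - c' = (d - c) / 2 /\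
  Cmod (rect_int g a b c d) / 4 <= Cmod (rect_int g a' b' c' d').
Proof.
  intros Hab Hcd Hc. unfold bisect.
  set (m := (a + b) / 2). set (n := (c + d) / 2).
  assert (Hm : a <= m <= b) by (unfold m; lra).
  assert (Hn : c <= n <= d) by (unfold n; lra).
  assert (E : rect_int g a b c d = (rect_int g a m c n + rect_int g a m n d
                                    + (rect_int g m b c n + rect_int g m b n d))%C).
  { rewrite (rect_int_hsplit g a m b) by (auto; intros; split; apply Hc; lra).
    rewrite (rect_int_vsplit g a m c n d) by (auto; intros; split; apply Hc; lra).
    rewrite (rect_int_vsplit g m b c n d) by (auto; intros; split; apply Hc; lra).
    reflexivity. }
  repeat destruct Rle_dec; simpl; repeat split; unfold m, n in *; try lra.
  (* The last quarter is chosen without a test: if the three others fall short of a quarter of the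
     modulus, the triangle inequality forces the fourth to reach it. *)
  assert (T := Cmod_triangle (rect_int g a m c n + rect_int g a m n d)
                 (rect_int g m b c n + rect_int g m b n d)).
  unfold m, n in *. rewrite <- E in T.
  pose proof (Cmod_triangle (rect_int g a ((a + b) / 2) c ((c + d) / 2))
                (rect_int g a ((a + b) / 2) ((c + d) / 2) d)).
  pose proof (Cmod_triangle (rect_int g ((a + b) / 2) b c ((c + d) / 2))
                (rect_int g ((a + b) / 2) b ((c + d) / 2) d)).
  lra.
Qed.

Fixpoint bisect_seq (g : C -> C) (q : rect) (n : nat) : rect :=
  match n with O => q | S n => bisect g (bisect_seq g q n) end.

Lemma bisect_seq_spec (g : C -> C) (a b c d : R) (n : nat) : a <= b -> c <= d ->
  (forall x y, a <= x <= b -> c <= y <= d -> ccont g (x, y)) ->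
  let '(a', b', c', d') := bisect_seq g (a, b, c, d) n in
  subrect (a, b, c, d) (a', b', c', d') /\
  b' - a' = (b - a) / 2 ^ n /\ d' - c' = (d - c) / 2 ^ n /\
  Cmod (rect_int g a b c d) / 4 ^ n <= Cmod (rect_int g a' b' c' d') /\
  subrect (a', b', c', d') (bisect_seq g (a, b, c, d) (S n)).
Proof.
  intros Hab Hcd Hc. induction n as [|n IH].
  - pose proof (bisect_spec g a b c d Hab Hcd Hc) as H. cbn [bisect_seq].
    destruct (bisect g (a, b, c, d)) as [[[a' b'] c'] d'].
    unfold subrect in *. simpl. repeat split; try lra.
  - cbn [bisect_seq] in IH |- *.
    destruct (bisect_seq g (a, b, c, d) n) as [[[a' b'] c'] d'].
    destruct IH as [S1 [L1 [L2 [I1 S2]]]]. unfold subrect in S1.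
    pose proof (bisect_spec g a' b' c' d') as H.
    destruct (bisect g (a', b', c', d')) as [[[a1 b1] c1] d1].
    destruct H as [S3 [L3 [L4 I2]]]; [lra|lra|intros; apply Hc; lra|].
    pose proof (bisect_spec g a1 b1 c1 d1) as H. unfold subrect in *.
    destruct (bisect g (a1, b1, c1, d1)) as [[[a2 b2] c2] d2].
    destruct H as [S4 _]; [lra|lra|intros; apply Hc; lra|].
    assert (0 < 2 ^ n) by (apply pow_lt; lra). assert (0 < 4 ^ n) by (apply pow_lt; lra).
    repeat split; try lra.
    + rewrite L3, L1. simpl. field. lra.
    + rewrite L4, L2. simpl. field. lra.
    + replace (Cmod (rect_int g a b c d) / 4 ^ S n) with (Cmod (rect_int g a b c d) / 4 ^ n / 4).
      * lra.
      * simpl. field. lra.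
Qed.

Lemma nested_intervals (u v : nat -> R) :
  (forall n, u n <= u (S n)) -> (forall n, v (S n) <= v n) -> (forall n, u n <= v n) ->
  exists x, forall n, u n <= x <= v n.
Proof.
  intros Hu Hv Huv.
  assert (Mu : forall n p, u n <= u (n + p)%nat).
  { intros n p. induction p; [rewrite Nat.add_0_r; lra|].
    rewrite Nat.add_succ_r. specialize (Hu (n + p)%nat). lra. }
  assert (Mv : forall n p, v (n + p)%nat <= v n).
  { intros n p. induction p; [rewrite Nat.add_0_r; lra|].
    rewrite Nat.add_succ_r. specialize (Hv (n + p)%nat). lra. }
  assert (Hall : forall n m, u n <= v m).
  { intros n m. specialize (Mu n m). specialize (Mv m n). specialize (Huv (n + m)%nat).
    rewrite Nat.add_comm in Mv. lra. }
  destruct (completeness (fun x => exists n, x = u n)) as [x [H1 H2]].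
  - exists (v O). intros y [n ->]. apply Hall.
  - exists (u O). now exists O.
  - exists x. intros n. split.
    + apply H1. now exists n.
    + apply H2. intros y [m ->]. apply Hall.
Qed.

(** Halving the sides divides the integral by at most 4 and the square of the perimeter by exactly
    4. At the common point of the nested rectangles the error of the affine approximation is
    o(diameter), so its integral is o(perimeter squared), and the original integral is smaller than
    any eps. *)
Theorem goursat (g : C -> C) (a b c d : R) : a <= b -> c <= d ->
  (forall x y, a <= x <= b -> c <= y <= d -> exists l, cder g (x, y) l) ->
  rect_int g a b c d = 0%C.
Proof.
  intros Hab Hcd Hd.
  assert (Hc : forall x y, a <= x <= b -> c <= y <= d -> ccont g (x, y)).
  { intros x y Hx Hy. destruct (Hd x y Hx Hy) as [l Hl]. eapply cder_ccont, Hl. }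
  set (Q := bisect_seq g (a, b, c, d)).
  pose proof (fun n => bisect_seq_spec g a b c d n Hab Hcd Hc) as HQ. fold Q in HQ.
  destruct (nested_intervals (fun n => fst (fst (fst (Q n)))) (fun n => snd (fst (fst (Q n)))))
    as [x Hx].
  1-3: intros n; specialize (HQ n); destruct (Q n) as [[[a1 b1] c1] d1];
    destruct HQ as [S1 [_ [_ [_ S2]]]];
    destruct (Q (S n)) as [[[a2 b2] c2] d2]; unfold subrect in *; simpl; lra.
  destruct (nested_intervals (fun n => snd (fst (Q n))) (fun n => snd (Q n))) as [y Hy].
  1-3: intros n; specialize (HQ n); destruct (Q n) as [[[a1 b1] c1] d1];
    destruct HQ as [S1 [_ [_ [_ S2]]]];
    destruct (Q (S n)) as [[[a2 b2] c2] d2]; unfold subrect in *; simpl; lra.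
  destruct (Hd x y) as [l Hl].
  { specialize (Hx O). simpl in Hx. lra. } { specialize (Hy O). simpl in Hy. lra. }
  set (L := (b - a) + (d - c)).
  apply Cmod_eq_0. apply Rle_antisym; [|apply Cmod_ge_0].
  apply le_epsilon. intros eps Heps. rewrite Rplus_0_l.
  assert (HL : 0 <= L) by (unfold L; lra).
  assert (HLL : 0 < 2 * L * L + 1) by nra.
  (* The final bound is 4^n (2 D) (e D) with D = L / 2^n, that is 2 L^2 e. The added 1 keeps the
     divisor positive when the rectangle degenerates. *)
  destruct (Hl (eps / (2 * L * L + 1))) as [del [Hdel Hw]]; [apply Rdiv_lt_0_compat; lra|].
  set (e := eps / (2 * L * L + 1)) in *.
  assert (He : e * (2 * L * L + 1) = eps) by (unfold e; field; lra).
  assert (He0 : 0 < e) by (unfold e; apply Rdiv_lt_0_compat; lra).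
  destruct (pow_lt_1_zero (/ 2) ltac:(rewrite Rabs_pos_eq; lra) (del / (L + 1))
              ltac:(apply Rdiv_lt_0_compat; lra)) as [n Hn].
  specialize (Hn n (Nat.le_refl n)).
  specialize (HQ n). specialize (Hx n). specialize (Hy n).
  destruct (Q n) as [[[a1 b1] c1] d1]. simpl in Hx, Hy.
  destruct HQ as [S1 [L1 [L2 [I1 _]]]]. unfold subrect in S1.
  assert (P2 : 0 < 2 ^ n) by (apply pow_lt; lra).
  assert (P4 : 4 ^ n = 2 ^ n * 2 ^ n) by (rewrite <- Rpow_mult_distr; f_equal; lra).
  set (D := L / 2 ^ n).
  assert (HD : (b1 - a1) + (d1 - c1) = D) by (unfold D, L; rewrite L1, L2; field; lra).
  assert (HD0 : 0 <= D) by lra.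
  assert (HDd : D < del).
  { rewrite Rabs_pos_eq in Hn by (apply pow_le; lra). rewrite pow_inv in Hn.
    unfold D, Rdiv. apply Rle_lt_trans with ((L + 1) * / 2 ^ n).
    - apply Rmult_le_compat_r; [left; now apply Rinv_0_lt_compat|lra].
    - apply (Rmult_lt_compat_l (L + 1)) in Hn; [|lra].
      replace ((L + 1) * (del / (L + 1))) with del in Hn by (field; lra). exact Hn. }
  set (h := fun w => (g (x, y) + l * (w - (x, y)))%C).
  assert (Hh : forall z, ccont h z).
  { intros z. unfold h. apply ccont_plus; [apply ccont_const|].
    apply ccont_mult; [apply ccont_const|]. apply ccont_minus; [apply ccont_id|apply ccont_const]. }
  assert (Hdist : forall u v, a1 <= u <= b1 -> c1 <= v <= d1 ->
            Cmod ((u, v) - (x, y)) <= D).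
  { intros u v Hu Hv.
    replace ((u, v) - (x, y))%C with ((u - x, v - y) : C)
      by (unfold Cminus, Cplus, Copp; simpl; f_equal; ring).
    eapply Rle_trans; [apply Cmod_le_abs|].
    assert (Rabs (u - x) <= b1 - a1) by (apply Rabs_le; lra).
    assert (Rabs (v - y) <= d1 - c1) by (apply Rabs_le; lra). lra. }
  assert (HB : Cmod (rect_int (fun z => g z - h z)%C a1 b1 c1 d1)
               <= 2 * ((b1 - a1) + (d1 - c1)) * (e * D)).
  { apply rect_int_bound; try lra.
    - split; intros t Ht; split; apply ccont_minus; auto; apply Hc; lra.
    - assert (HH : forall u v, a1 <= u <= b1 -> c1 <= v <= d1 ->
                Cmod (g (u, v) - h (u, v)) <= e * D).
      { intros u v Hu Hv. specialize (Hdist u v Hu Hv).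
        assert (W := Hw (u, v) ltac:(lra)). unfold h.
        replace (g (u, v) - (g (x, y) + l * ((u, v) - (x, y))))%C
          with (g (u, v) - g (x, y) - l * ((u, v) - (x, y)))%C by ring.
        eapply Rle_trans; [apply W|]. apply Rmult_le_compat_l; lra. }
      split; intros t Ht; split; apply HH; lra. }
  rewrite rect_int_minus in HB; try lra.
  2: split; intros t Ht; split; apply Hc; lra.
  2: split; intros t Ht; split; apply Hh.
  unfold h in HB. rewrite rect_int_affine in HB by lra.
  replace (rect_int g a1 b1 c1 d1 - 0)%C with (rect_int g a1 b1 c1 d1) in HB by ring.
  rewrite HD in HB.
  assert (HF : Cmod (rect_int g a b c d) / 4 ^ n <= 2 * D * (e * D)) by lra.
  assert (P4' : 0 < 4 ^ n) by (apply pow_lt; lra).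
  apply (Rmult_le_compat_r (4 ^ n)) in HF; [|lra].
  replace (Cmod (rect_int g a b c d) / 4 ^ n * 4 ^ n) with (Cmod (rect_int g a b c d)) in HF
    by (field; lra).
  rewrite P4 in HF. unfold D in HF.
  replace (2 * (L / 2 ^ n) * (e * (L / 2 ^ n)) * (2 ^ n * 2 ^ n)) with (2 * L * L * e) in HF
    by (field; lra).
  nra.
Qed.

Theorem goursat_bounded_singularity (g : C -> C) (a b c d B rho : R) :
  a < 0 < b -> c < 0 < d -> 0 < rho ->
  (forall x y, a <= x <= b -> c <= y <= d -> (x, y) <> (0, 0) -> exists l, cder g (x, y) l) ->
  (forall z : C, z <> 0%C -> Cmod z < rho -> Cmod (g z) <= B) ->
  rect_int g a b c d = 0%C.
Proof.
  intros Hab Hcd Hrho Hd HB.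
  assert (Hc : forall x y, a <= x <= b -> c <= y <= d -> (x, y) <> (0, 0) -> ccont g (x, y)).
  { intros x y Hx Hy H0. destruct (Hd x y Hx Hy H0) as [l Hl]. eapply cder_ccont, Hl. }
  apply Cmod_eq_0. apply Rle_antisym; [|apply Cmod_ge_0].
  apply le_epsilon. intros eps Heps. rewrite Rplus_0_l.
  assert (HB0 : 0 <= B).
  { eapply Rle_trans; [apply Cmod_ge_0|]. apply (HB (RtoC (rho / 2))).
    - intros E. apply RtoC_inj in E. lra.
    - rewrite Cmod_R, Rabs_pos_eq; lra. }
  (* Half-side of a square around 0. The first four bounds keep it inside the rectangle, [rho / 3]
     keeps it in the disc where g is bounded (its points have modulus at most 2 h), and
     [eps / (8 * B + 1)] makes perimeter times bound, 8 h B, at most eps. *)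
  set (h := Rmin (Rmin (- a) b) (Rmin (Rmin (- c) d) (Rmin (rho / 3) (eps / (8 * B + 1))))).
  assert (Hh : 0 < h).
  { unfold h. repeat apply Rmin_glb_lt; try lra. apply Rdiv_lt_0_compat; lra. }
  assert (Hh1 : h <= - a /\ h <= b /\ h <= - c /\ h <= d /\ h <= rho / 3 /\ h <= eps / (8 * B + 1)).
  { unfold h. repeat split;
    repeat first [apply Rle_refl | eapply Rle_trans; [apply Rmin_l|]; apply Rle_refl
      | eapply Rle_trans; [apply Rmin_l|]; first [apply Rmin_l | apply Rmin_r]
      | eapply Rle_trans; [apply Rmin_r|] | apply Rmin_l | apply Rmin_r ]. }
  destruct Hh1 as [h1 [h2 [h3 [h4 [h5 h6]]]]].
  rewrite (rect_int_hsplit g a (- h) b); [|lra|].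
  2: { intros x Hx. split; apply Hc; try lra; apply pair_neq_0; lra. }
  rewrite (goursat g a (- h)); try lra.
  2: { intros x y Hx Hy. apply Hd; try lra. apply pair_neq_0; lra. }
  rewrite (rect_int_hsplit g (- h) h b); [|lra|].
  2: { intros x Hx. split; apply Hc; try lra; apply pair_neq_0; lra. }
  rewrite (goursat g h b); try lra.
  2: { intros x y Hx Hy. apply Hd; try lra. apply pair_neq_0; lra. }
  rewrite (rect_int_vsplit g (- h) h c (- h) d); [|lra|].
  2: { intros y Hy. split; apply Hc; try lra; apply pair_neq_0; lra. }
  rewrite (goursat g (- h) h c); try lra.
  2: { intros x y Hx Hy. apply Hd; try lra. apply pair_neq_0; lra. }
  rewrite (rect_int_vsplit g (- h) h (- h) h d); [|lra|].
  2: { intros y Hy. split; apply Hc; try lra; apply pair_neq_0; lra. }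
  rewrite (goursat g (- h) h h d); try lra.
  2: { intros x y Hx Hy. apply Hd; try lra. apply pair_neq_0; lra. }
  match goal with |- Cmod ?x <= _ => replace x with (rect_int g (- h) h (- h) h) by ring end.
  eapply Rle_trans.
  - apply (rect_int_bound g _ _ _ _ B); try lra.
    + split; intros t Ht; split; apply Hc; try lra; apply pair_neq_0; lra.
    + assert (HH : forall u v : R, u <> 0 \/ v <> 0 -> Rabs u <= h -> Rabs v <= h -> Cmod (g (u, v)) <= B).
      { intros u v H0 Hu Hv. apply HB; [now apply pair_neq_0|].
        eapply Rle_lt_trans; [apply Cmod_le_abs|]. lra. }
      split; intros t Ht; split; apply HH; try lra; apply Rabs_le; lra.
  - apply (Rmult_le_compat_r (8 * B + 1)) in h6; [|lra].
    replace (eps / (8 * B + 1) * (8 * B + 1)) with eps in h6 by (field; lra). nra.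
Qed.

(** * Exponential, logarithm and powers *)

Lemma Cpair_eq (a b c d : R) : a = c -> b = d -> ((a, b) : C) = (c, d).
Proof. now intros -> ->. Qed.

Lemma cexp_plus (a b : C) : cexp (a + b) = (cexp a * cexp b)%C.
Proof.
  destruct a as [a1 a2], b as [b1 b2]. unfold cexp, Cplus, Cmult; simpl.
  rewrite exp_plus, cos_plus, sin_plus. apply Cpair_eq; ring.
Qed.

Lemma cexp_0 : cexp 0 = 1%C.
Proof. unfold cexp, RtoC; simpl. rewrite exp_0, cos_0, sin_0. apply Cpair_eq; ring. Qed.

Lemma Cmod_cexp (z : C) : Cmod (cexp z) = exp (Re z).
Proof.
  destruct z as [x y]. unfold cexp, Cmod; simpl.
  match goal with |- sqrt ?e = _ => replace e with (Rsqr (exp x)) end.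
  - apply sqrt_Rsqr. left; apply exp_pos.
  - pose proof (sin2_cos2 y) as H. unfold Rsqr in *.
    replace (exp x * exp x) with (exp x * exp x * (sin y * sin y + cos y * cos y)) by (rewrite H; ring).
    ring.
Qed.

Lemma cexp_neq_0 (z : C) : cexp z <> 0%C.
Proof. apply Cmod_gt_0. rewrite Cmod_cexp. apply exp_pos. Qed.

Lemma cexp_opp (z : C) : cexp (- z) = (/ cexp z)%C.
Proof.
  pose proof (cexp_neq_0 z).
  assert (cexp (- z) * cexp z = 1)%C as E.
  { rewrite <- cexp_plus. replace (- z + z)%C with (RtoC 0) by ring. apply cexp_0. }
  replace (cexp (- z)) with (cexp (- z) * cexp z * / cexp z)%C by (field; auto).
  rewrite E. ring.
Qed.

Lemma cexp_period (x y : R) : cexp (x, y + 2 * PI) = cexp (x, y).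
Proof.
  unfold cexp; simpl. rewrite cos_plus, sin_plus, cos_2PI, sin_2PI.
  apply Cpair_eq; ring.
Qed.

Lemma cexp_nat_mult (n : nat) (z : C) : cexp (RtoC (INR n) * z) = (cexp z ^ n)%C.
Proof.
  induction n as [|n IH].
  - simpl. replace (RtoC 0 * z)%C with (RtoC 0) by ring. apply cexp_0.
  - rewrite S_INR, RtoC_plus.
    replace ((RtoC (INR n) + 1) * z)%C with (z + RtoC (INR n) * z)%C by ring.
    rewrite cexp_plus, IH. reflexivity.
Qed.

Lemma cexp_ln (x : R) : 0 < x -> cexp (RtoC (ln x)) = RtoC x.
Proof.
  intros Hx. unfold cexp, RtoC; simpl. rewrite exp_ln, cos_0, sin_0 by exact Hx. apply Cpair_eq; ring.
Qed.

Lemma Rabs_sin_le (x : R) : Rabs (sin x) <= Rabs x.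
Proof.
  assert (H : forall y, 0 <= y -> Rabs (sin y) <= y).
  { intros y Hy. apply Rabs_le. destruct (Req_dec y 0) as [->|Hn]; [rewrite sin_0; lra|].
    pose proof (sin_lt_x y ltac:(lra)). split; [|lra].
    destruct (Rle_dec y PI).
    - pose proof (sin_ge_0 y Hy r). lra.
    - pose proof (SIN_bound y). pose proof PI2_1. pose proof PI_4.
      pose proof PI2_3_2. lra. }
  destruct (Rle_dec 0 x).
  - rewrite (Rabs_pos_eq x) by lra. now apply H.
  - rewrite <- (Ropp_involutive x), sin_neg, Rabs_Ropp, Rabs_Ropp, (Rabs_pos_eq (- x)) by lra.
    apply H. lra.
Qed.

Lemma Rabs_cos_sub1_le (x : R) : Rabs (cos x - 1) <= Rabs x.
Proof.
  replace x with (2 * (x / 2)) at 1 by field. rewrite cos_2a_sin.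
  replace (1 - 2 * sin (x / 2) * sin (x / 2) - 1) with (- (2 * sin (x / 2)) * sin (x / 2)) by ring.
  rewrite Rabs_mult, Rabs_Ropp, Rabs_mult, (Rabs_pos_eq 2) by lra.
  pose proof (Rabs_sin_le (x / 2)) as H.
  assert (Rabs (x / 2) = Rabs x / 2) as E
    by (unfold Rdiv; rewrite Rabs_mult, (Rabs_pos_eq (/ 2)) by lra; ring).
  rewrite E in H.
  assert (Rabs (sin (x / 2)) <= 1) by (apply Rabs_le; apply SIN_bound).
  pose proof (Rabs_pos (sin (x / 2))). nra.
Qed.

Lemma exp_le_exp (x y : R) : x <= y -> exp x <= exp y.
Proof.
  intros [H| ->]; [left; now apply exp_increasing|lra].
Qed.

Lemma Rabs_exp_sub1_le (a : R) : Rabs a <= 1 -> exp a <= 3 /\ Rabs (exp a - 1) <= 3 * Rabs a.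
Proof.
  intros H. apply Rabs_le_between in H.
  assert (H3 : exp a <= 3).
  { eapply Rle_trans; [apply exp_le_exp|apply exp_le_3]. lra. }
  split; [exact H3|].
  pose proof (exp_ineq1_le a) as Hl. pose proof (exp_ineq1_le (- a)) as Hr.
  rewrite exp_Ropp in Hr. pose proof (exp_pos a) as Hp.
  assert (exp a - 1 <= a * exp a).
  { apply (Rmult_le_compat_r (exp a)) in Hr; [|lra]. rewrite Rinv_l in Hr by lra. lra. }
  destruct (Rle_dec 0 a).
  - rewrite (Rabs_pos_eq a) by lra. apply Rabs_le. nra.
  - rewrite (Rabs_left a) by lra. apply Rabs_le. nra.
Qed.

(** Converts distances in the log plane to distances from z = 1. The 6 comes from exp a <= 3 and
    from |sin b| and |cos b - 1| both being at most |b|. *)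
Lemma Cmod_cexp_sub1 (a b : R) : Rabs a <= 1 -> Cmod (cexp (a, b) - 1) <= 6 * (Rabs a + Rabs b).
Proof.
  intros Ha. destruct (Rabs_exp_sub1_le a Ha) as [H1 H2].
  pose proof (exp_pos a). pose proof (Rabs_sin_le b). pose proof (Rabs_cos_sub1_le b).
  replace (cexp (a, b) - 1)%C with ((exp a * (cos b - 1) + (exp a - 1), exp a * sin b) : C)
    by (unfold cexp, Cminus, Cplus, Copp, RtoC; simpl; apply Cpair_eq; ring).
  eapply Rle_trans; [apply Cmod_le_abs|].
  pose proof (Rabs_triang (exp a * (cos b - 1)) (exp a - 1)) as T.
  rewrite Rabs_mult, (Rabs_pos_eq (exp a)) in T by lra.
  rewrite (Rabs_mult _ (sin b)), (Rabs_pos_eq (exp a)) by lra.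
  pose proof (Rabs_pos (cos b - 1)). pose proof (Rabs_pos (sin b)). pose proof (Rabs_pos a).
  nra.
Qed.

Lemma derivable_pt_lim_0_bound (f : R -> R) (l eps : R) : derivable_pt_lim f 0 l -> 0 < eps ->
  exists del, 0 < del /\ forall h, Rabs h < del -> Rabs (f h - f 0 - l * h) <= eps * Rabs h.
Proof.
  intros H He. destruct (H eps He) as [d Hd]. exists d. split; [apply cond_pos|].
  intros h Hh. destruct (Req_dec h 0) as [->|Hn].
  - replace (f 0 - f 0 - l * 0) with 0 by ring. rewrite Rabs_R0. lra.
  - specialize (Hd h Hn Hh). rewrite Rplus_0_l in Hd.
    replace (f h - f 0 - l * h) with (((f h - f 0) / h - l) * h) by (field; auto).
    rewrite Rabs_mult. apply Rmult_le_compat_r; [apply Rabs_pos|lra].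
Qed.

Lemma Rabs_Re_Im_le (x y : R) : Rabs x <= Cmod (x, y) /\ Rabs y <= Cmod (x, y).
Proof.
  pose proof (Rmax_Cmod (x, y)) as H. simpl in H.
  pose proof (Rmax_l (Rabs x) (Rabs y)). pose proof (Rmax_r (Rabs x) (Rabs y)). lra.
Qed.

Lemma cder_cexp_0 : cder cexp 0 1.
Proof.
  (* The errors add up to e |a| + 7 e |b|, hence the 8. The radius e / 3 gives |exp a - 1| <= 3 |a|
     <= e for the cross term (exp a - 1) b. *)
  intros eps He. set (e := Rmin 1 (eps / 8)).
  assert (He1 : 0 < e) by (unfold e; apply Rmin_glb_lt; lra).
  assert (He2 : 8 * e <= eps) by (unfold e; pose proof (Rmin_r 1 (eps / 8)); lra).
  destruct (derivable_pt_lim_0_bound exp 1 e) as [d1 [D1 H1]]; [|lra|].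
  { replace 1 with (exp 0) by apply exp_0. apply derivable_pt_lim_exp. }
  destruct (derivable_pt_lim_0_bound cos 0 e) as [d2 [D2 H2]]; [|lra|].
  { replace 0 with (- sin 0) at 2 by (rewrite sin_0; ring). apply derivable_pt_lim_cos. }
  destruct (derivable_pt_lim_0_bound sin 1 e) as [d3 [D3 H3]]; [|lra|].
  { replace 1 with (cos 0) by apply cos_0. apply derivable_pt_lim_sin. }
  exists (Rmin (Rmin d1 d2) (Rmin d3 (e / 3))).
  split; [repeat apply Rmin_glb_lt; lra|].
  intros w Hw. rewrite cexp_0.
  replace (w - 0)%C with w in * by ring. destruct w as [a b].
  destruct (Rabs_Re_Im_le a b) as [Ba Bb].
  pose proof (Rmin_l (Rmin d1 d2) (Rmin d3 (e / 3))). pose proof (Rmin_r (Rmin d1 d2) (Rmin d3 (e / 3))).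
  pose proof (Rmin_l d1 d2). pose proof (Rmin_r d1 d2).
  pose proof (Rmin_l d3 (e / 3)). pose proof (Rmin_r d3 (e / 3)).
  specialize (H1 a ltac:(lra)). specialize (H2 b ltac:(lra)). specialize (H3 b ltac:(lra)).
  rewrite exp_0 in H1. rewrite cos_0 in H2. rewrite sin_0 in H3.
  assert (He3 : e <= 1) by apply Rmin_l.
  destruct (Rabs_exp_sub1_le a ltac:(lra)) as [E1 E2]. pose proof (exp_pos a).
  replace (cexp (a, b) - 1 - 1 * (a, b))%C
    with (((exp a - 1 - 1 * a) + exp a * (cos b - 1 - 0 * b),
           exp a * (sin b - 0 - 1 * b) + (exp a - 1) * b) : C)
    by (unfold cexp, Cminus, Cplus, Copp, Cmult, RtoC; simpl; apply Cpair_eq; ring).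
  eapply Rle_trans; [apply Cmod_le_abs|].
  pose proof (Rabs_triang (exp a - 1 - 1 * a) (exp a * (cos b - 1 - 0 * b))) as T1.
  pose proof (Rabs_triang (exp a * (sin b - 0 - 1 * b)) ((exp a - 1) * b)) as T2.
  rewrite !Rabs_mult, (Rabs_pos_eq (exp a)) in T1 by lra.
  rewrite !Rabs_mult, (Rabs_pos_eq (exp a)) in T2 by lra.
  pose proof (Rabs_pos (cos b - 1 - 0 * b)). pose proof (Rabs_pos (sin b - 0 - 1 * b)).
  pose proof (Rabs_pos a). pose proof (Rabs_pos b).
  assert (exp a * Rabs (cos b - 1 - 0 * b) <= 3 * (e * Rabs b)) by nra.
  assert (exp a * Rabs (sin b - 0 - 1 * b) <= 3 * (e * Rabs b)) by nra.
  assert (Rabs (exp a - 1) * Rabs b <= e * Rabs b) by nra.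
  assert (e * Rabs a <= e * Cmod (a, b)) by nra.
  assert (e * Rabs b <= e * Cmod (a, b)) by nra.
  assert (8 * e * Cmod (a, b) <= eps * Cmod (a, b)) by (apply Rmult_le_compat_r; lra).
  lra.
Qed.

Lemma cder_cexp (z : C) : cder cexp z (cexp z).
Proof.
  apply (cder_ext_loc (fun w => cexp z * cexp (w - z))%C _ z _ 1); [lra| |].
  - intros w _. rewrite <- cexp_plus. f_equal. ring.
  - enough (H : cder (fun w => cexp z * cexp (w - z))%C z (cexp z * (1 * (1 - 0))))
      by (replace (cexp z * (1 * (1 - 0)))%C with (cexp z) in H by ring; exact H).
    apply cder_scal. apply (cder_comp cexp (fun w => w - z)%C).
    + replace (z - z)%C with (RtoC 0) by ring. apply cder_cexp_0.
    + apply cder_minus; [apply cder_id|apply cder_const].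
Qed.

(** * The principal logarithm and powers on the slit plane *)

Definition slit (z : C) : Prop := ~ (Im z = 0 /\ Re z <= 0).

Lemma slit_neq_0 (z : C) : slit z -> z <> 0%C.
Proof. intros H ->. apply H. simpl. lra. Qed.

Lemma Cmod_atan (x y : R) : 0 < x ->
  Cmod (x, y) * cos (atan (y / x)) = x /\ Cmod (x, y) * sin (atan (y / x)) = y.
Proof.
  intros Hx. rewrite cos_atan, sin_atan.
  assert (Hp : 0 < 1 + (y / x) ^ 2) by (pose proof (pow2_ge_0 (y / x)); lra).
  assert (E : Cmod (x, y) = x * sqrt (1 + (y / x) ^ 2)).
  { unfold Cmod; simpl fst; simpl snd.
    replace (x ^ 2 + y ^ 2) with (Rsqr x * (1 + (y / x) ^ 2)) by (unfold Rsqr; field; lra).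
    rewrite sqrt_mult by (try apply Rle_0_sqr; lra). now rewrite sqrt_Rsqr by lra. }
  rewrite E. unfold Rsqr. replace (y / x * (y / x)) with ((y / x) ^ 2) by ring.
  assert (0 < sqrt (1 + (y / x) ^ 2)) by now apply sqrt_lt_R0.
  split; field; lra.
Qed.

(* Rotation by a right angle reduces the other two half-planes to the right one. *)
Lemma carg_upper (x y : R) : 0 < y -> carg (x, y) = PI / 2 + atan (- x / y).
Proof.
  intros Hy. unfold carg; simpl.
  destruct (Rlt_dec 0 x); [|destruct (Rlt_dec x 0)].
  - replace (- x / y) with (- (x / y)) by (field; lra). rewrite atan_opp.
    replace (y / x) with (/ (x / y)) by (field; lra).
    rewrite atan_inv; [ring|]. now apply Rdiv_lt_0_compat.
  - destruct (Rle_dec 0 y); [|lra].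
    replace (y / x) with (- / (- x / y)) by (field; lra).
    rewrite atan_opp, atan_inv; [field|]. apply Rdiv_lt_0_compat; lra.
  - destruct (Rlt_dec 0 y); [|lra]. replace x with 0 by lra.
    replace (- 0 / y) with 0 by (field; lra). rewrite atan_0. ring.
Qed.

Lemma carg_lower (x y : R) : y < 0 -> carg (x, y) = - (PI / 2) + atan (x / - y).
Proof.
  intros Hy. unfold carg; simpl.
  destruct (Rlt_dec 0 x); [|destruct (Rlt_dec x 0)].
  - replace (y / x) with (- / (x / - y)) by (field; lra).
    rewrite atan_opp, atan_inv; [ring|]. apply Rdiv_lt_0_compat; lra.
  - destruct (Rle_dec 0 y); [lra|].
    replace (y / x) with (/ (- x / - y)) by (field; lra).
    rewrite atan_inv by (apply Rdiv_lt_0_compat; lra).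
    replace (- x / - y) with (- (x / - y)) by (field; lra). rewrite atan_opp. field.
  - destruct (Rlt_dec 0 y); [lra|]. destruct (Rlt_dec y 0); [|lra]. replace x with 0 by lra.
    replace (0 / - y) with 0 by (field; lra). rewrite atan_0. ring.
Qed.

Lemma carg_right (x y : R) : 0 < x -> carg (x, y) = atan (y / x).
Proof. intros Hx. unfold carg; simpl. destruct (Rlt_dec 0 x); [reflexivity|lra]. Qed.

Lemma Cmod_carg (z : C) : slit z ->
  Cmod z * cos (carg z) = Re z /\ Cmod z * sin (carg z) = Im z.
Proof.
  destruct z as [x y]. intros Hs. unfold slit in Hs; simpl in *.
  destruct (Rtotal_order y 0) as [Hy|[Hy|Hy]].
  - rewrite carg_lower by lra.
    rewrite cos_plus, sin_plus, cos_neg, sin_neg, cos_PI2, sin_PI2.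
    replace (Cmod (x, y)) with (Cmod (- y, x)) by (unfold Cmod; simpl; f_equal; ring).
    destruct (Cmod_atan (- y) x ltac:(lra)). lra.
  - rewrite carg_right by (destruct (Rle_dec x 0); [exfalso; auto|lra]).
    apply Cmod_atan. destruct (Rle_dec x 0); [exfalso; auto|lra].
  - rewrite carg_upper by lra. rewrite cos_plus, sin_plus, cos_PI2, sin_PI2.
    replace (Cmod (x, y)) with (Cmod (y, - x)) by (unfold Cmod; simpl; f_equal; ring).
    destruct (Cmod_atan y (- x) ltac:(lra)). lra.
Qed.

Lemma cexp_clog (z : C) : slit z -> cexp (clog z) = z.
Proof.
  intros Hs. assert (0 < Cmod z) by now apply Cmod_gt_0, slit_neq_0.
  unfold cexp, clog; simpl. rewrite exp_ln by auto.
  destruct (Cmod_carg z Hs) as [-> ->]. now destruct z.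
Qed.

Lemma carg_bound (z : C) : slit z -> Rabs (carg z) <= PI.
Proof.
  destruct z as [x y]. intros Hs. unfold slit in Hs; simpl in *. pose proof PI_RGT_0.
  apply Rabs_le. destruct (Rtotal_order y 0) as [Hy|[Hy|Hy]].
  - rewrite carg_lower by lra. pose proof (atan_bound (x / - y)). lra.
  - rewrite carg_right by (destruct (Rle_dec x 0); [exfalso; auto|lra]).
    pose proof (atan_bound (y / x)). lra.
  - rewrite carg_upper by lra. pose proof (atan_bound (- x / y)). lra.
Qed.

Lemma ccont_real (h : R -> R) (f : C -> C) (z : C) :
  continuity_pt h (Re (f z)) -> ccont f z -> ccont (fun w => RtoC (h (Re (f w)))) z.
Proof.
  intros Hh Hf eps He. destruct (Hh eps He) as [d [Hd H]].
  destruct (Hf d Hd) as [d' [Hd' H']]. exists d'. split; [exact Hd'|]. intros w Hw.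
  rewrite <- RtoC_minus, Cmod_R.
  (* [continuity_pt] only speaks of arguments different from the base point, so equal values are
     treated apart. *)
  destruct (Req_dec (Re (f w)) (Re (f z))) as [E|E].
  - rewrite E. replace (h (Re (f z)) - h (Re (f z))) with 0 by ring. rewrite Rabs_R0; lra.
  - apply (H (Re (f w))). split; [split; [exact I|congruence]|].
    simpl. unfold Rdist. eapply Rle_lt_trans; [|apply (H' w Hw)].
    apply (re_le_Cmod (f w - f z)).
Qed.

Lemma ccont_Re (z : C) : ccont (fun w => RtoC (Re w)) z.
Proof.
  apply (ccont_real (fun x => x) (fun w => w)); [|apply ccont_id].
  apply derivable_continuous_pt, derivable_pt_id.
Qed.

Lemma ccont_Im (z : C) : ccont (fun w => RtoC (Im w)) z.
Proof.
  apply (ccont_ext_loc (fun w => RtoC (Re (- Ci * w))) _ z 1); [lra| |].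
  - intros [x y] _. f_equal. simpl. ring.
  - apply (ccont_real (fun x => x) (fun w => - Ci * w)%C).
    + apply derivable_continuous_pt, derivable_pt_id.
    + apply ccont_mult; [apply ccont_const|apply ccont_id].
Qed.

Lemma ccont_Cmod (z : C) : ccont (fun w => RtoC (Cmod w)) z.
Proof.
  intros eps He. exists eps. split; [exact He|]. intros w Hw.
  rewrite <- RtoC_minus, Cmod_R. apply Rabs_def1.
  - pose proof (Cmod_triangle (w - z) z). replace (w - z + z)%C with w in H by ring. lra.
  - pose proof (Cmod_sub_le w (w - z)). replace (w - (w - z))%C with z in H by ring. lra.
Qed.

Lemma ccont_clog_right (z : C) : 0 < Re z -> ccont clog z.
Proof.
  intros Hz.
  assert (Hz0 : z <> 0%C) by (intros ->; simpl in Hz; lra).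
  apply (ccont_ext_loc
    (fun w => RtoC (ln (Re (RtoC (Cmod w)))) + Ci * RtoC (atan (Re (RtoC (Im w) / RtoC (Re w)))))%C
    _ z (Re z)); [exact Hz| |].
  - intros w Hw.
    assert (0 < Re w).
    { pose proof (re_le_Cmod (w - z)) as H. apply Rle_lt_trans with (r3 := Re z) in H; [|exact Hw].
      apply Rabs_def2 in H. destruct w, z; simpl in *; lra. }
    destruct w as [x y]. simpl Re in H. rewrite <- RtoC_div by (simpl; lra). simpl Re; simpl Im. unfold clog.
    rewrite carg_right by lra.
    unfold Ci, Cplus, Cmult, RtoC; simpl. apply Cpair_eq; ring.
  - apply ccont_plus; [|apply ccont_mult; [apply ccont_const|]].
    + apply (ccont_real ln (fun w => RtoC (Cmod w))); [|apply ccont_Cmod].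
      apply derivable_continuous_pt. eexists. apply derivable_pt_lim_ln.
      simpl. now apply Cmod_gt_0.
    + apply (ccont_real atan (fun w => RtoC (Im w) / RtoC (Re w))%C).
      * apply derivable_continuous_pt. eexists. apply derivable_pt_lim_atan.
      * apply ccont_div; [|apply ccont_Im|apply ccont_Re].
        intros E. apply RtoC_inj in E. lra.
Qed.

Lemma ccont_clog (z : C) : slit z -> ccont clog z.
Proof.
  intros Hs. destruct z as [x y]. unfold slit in Hs; simpl in Hs.
  destruct (Rtotal_order y 0) as [Hy|[Hy|Hy]].
  - apply (ccont_ext_loc (fun w => (0, - (PI / 2))%R + clog (Ci * w))%C _ _ (- y)); [lra| |].
    + intros [u v] Hw.
      assert (v < 0).
      { destruct (Rabs_Re_Im_le (u - x) (v - y)) as [_ H].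
        replace ((u - x, v - y) : C) with ((u, v) - (x, y))%C in H
          by (unfold Cminus, Cplus, Copp; simpl; apply Cpair_eq; ring).
        pose proof (Rle_abs (v - y)). lra. }
      replace (Ci * (u, v))%C with ((- v, u) : C) by (unfold Ci, Cmult; simpl; apply Cpair_eq; ring).
      unfold clog. rewrite carg_right, carg_lower by lra.
      replace (Cmod (- v, u)) with (Cmod (u, v)) by (unfold Cmod; simpl; f_equal; ring).
      unfold Cplus; simpl. apply Cpair_eq; ring.
    + apply ccont_plus; [apply ccont_const|]. apply (ccont_comp clog (fun w => Ci * w)%C).
      * apply ccont_clog_right. simpl. lra.
      * apply ccont_mult; [apply ccont_const|apply ccont_id].
  - apply ccont_clog_right. simpl. destruct (Rle_dec x 0); [exfalso; auto|lra].
  - apply (ccont_ext_loc (fun w => (0, PI / 2)%R + clog (- Ci * w))%C _ _ y); [lra| |].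
    + intros [u v] Hw.
      assert (0 < v).
      { destruct (Rabs_Re_Im_le (u - x) (v - y)) as [_ H].
        replace ((u - x, v - y) : C) with ((u, v) - (x, y))%C in H
          by (unfold Cminus, Cplus, Copp; simpl; apply Cpair_eq; ring).
        rewrite <- Rabs_Ropp in H. pose proof (Rle_abs (- (v - y))). lra. }
      replace (- Ci * (u, v))%C with ((v, - u) : C)
        by (unfold Ci, Copp, Cmult; simpl; apply Cpair_eq; ring).
      unfold clog. rewrite carg_right, carg_upper by lra.
      replace (Cmod (v, - u)) with (Cmod (u, v)) by (unfold Cmod; simpl; f_equal; ring).
      unfold Cplus; simpl. apply Cpair_eq; ring.
    + apply ccont_plus; [apply ccont_const|]. apply (ccont_comp clog (fun w => - Ci * w)%C).
      * apply ccont_clog_right. simpl. lra.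
      * apply ccont_mult; [apply ccont_const|apply ccont_id].
Qed.

Lemma slit_open (z : C) : slit z -> exists r, 0 < r /\ forall w, Cmod (w - z) < r -> slit w.
Proof.
  destruct z as [x y]. unfold slit; simpl. intros Hs.
  (* Off the real axis the distance to that axis is enough, since the cut lies in it; on the axis x
     is positive and is the distance to the cut. *)
  exists (if Req_EM_T y 0 then x else Rabs y). split.
  - destruct (Req_EM_T y 0); [destruct (Rle_dec x 0); [exfalso; auto|lra]|].
    now apply Rabs_pos_lt.
  - intros [u v] Hw [Hv Hu]. simpl in *. subst v.
    destruct (Rabs_Re_Im_le (u - x) (0 - y)) as [H1 H2].
    replace ((u - x, 0 - y) : C) with ((u, 0) - (x, y))%C in H1, H2
      by (unfold Cminus, Cplus, Copp; simpl; apply Cpair_eq; ring).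
    destruct (Req_EM_T y 0).
    + rewrite <- Rabs_Ropp in H1. pose proof (Rle_abs (- (u - x))). lra.
    + rewrite <- Rabs_Ropp in H2. replace (- (0 - y)) with y in H2 by ring. lra.
Qed.

(** Derivative of an inverse function: if s is the slope of exp at log z, then w - z = s (log w)
    (log w - log z), so 1 / s (log w) is a slope of log, continuous at z with value 1 / z. *)
Lemma cder_clog (z : C) : slit z -> cder clog z (/ z).
Proof.
  intros Hs. assert (Hz := slit_neq_0 z Hs).
  pose proof (ccont_clog z Hs) as Hcl.
  destruct (proj1 (cder_caratheodory _ _ _) (cder_cexp (clog z))) as [s [Hsc [Hsz Hsw]]].
  rewrite cexp_clog in Hsz by auto.
  assert (Hc : ccont (fun w => s (clog w)) z) by now apply (ccont_comp s clog).
  destruct (slit_open z Hs) as [r1 [Hr1 H1]].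
  (* On this neighbourhood s (log w) stays within |z| of its value z at the centre, hence is not
     zero. *)
  destruct (Hc (Cmod z)) as [r2 [Hr2 H2]]; [now apply Cmod_gt_0|]. cbv beta in H2.
  apply (cder_ext_loc (fun w => clog z + / s (clog w) * (w - z))%C _ z _ (Rmin r1 r2)).
  - now apply Rmin_glb_lt.
  - intros w Hw. pose proof (Rmin_l r1 r2). pose proof (Rmin_r r1 r2).
    assert (Hw1 : slit w) by (apply H1; lra).
    assert (Hn : s (clog w) <> 0%C).
    { intros E. specialize (H2 w ltac:(lra)). rewrite E, Hsz, Cmod_sub_sym in H2.
      replace (z - 0)%C with z in H2 by ring. lra. }
    specialize (Hsw (clog w)). rewrite !cexp_clog in Hsw by auto.
    replace (w - z)%C with (s (clog w) * (clog w - clog z))%C 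
      by (transitivity (z + s (clog w) * (clog w - clog z) - z)%C; [ring|now rewrite <- Hsw]).
    field. exact Hn.
  - apply cder_caratheodory. exists (fun w => / s (clog w))%C.
    assert (Hnz : s (clog z) <> 0%C) by now rewrite Hsz.
    split; [|split].
    + apply (ccont_comp Cinv (fun w => s (clog w))); [now apply ccont_inv|exact Hc].
    + now rewrite Hsz.
    + intros w. ring.
Qed.

Lemma cpow_cexp (z a : C) : z <> 0%C -> cpow z a = cexp (a * clog z)%C.
Proof. intros H. unfold cpow. destruct (Ceq_dec z 0); [contradiction|reflexivity]. Qed.

Lemma cpow_neq_0 (z a : C) : z <> 0%C -> cpow z a <> 0%C.
Proof. intros H. rewrite cpow_cexp by auto. apply cexp_neq_0. Qed.

Lemma cpow_plus (z a b : C) : z <> 0%C -> cpow z (a + b) = (cpow z a * cpow z b)%C.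
Proof. intros H. rewrite !cpow_cexp by auto. rewrite <- cexp_plus. f_equal. ring. Qed.

Lemma cpow_opp_r (z a : C) : z <> 0%C -> (cpow z (- a) * cpow z a)%C = 1%C.
Proof.
  intros H. rewrite <- cpow_plus by auto. replace (- a + a)%C with (RtoC 0) by ring.
  rewrite cpow_cexp by auto. replace (0 * clog z)%C with (RtoC 0) by ring. apply cexp_0.
Qed.

Lemma cpow_1_r (z : C) : slit z -> cpow z 1 = z.
Proof.
  intros H. rewrite cpow_cexp by now apply slit_neq_0.
  replace (1 * clog z)%C with (clog z) by ring. now apply cexp_clog.
Qed.

Lemma cpow_nat (z : C) (n : nat) : slit z -> cpow z (RtoC (INR n)) = (z ^ n)%C.
Proof.
  intros H. rewrite cpow_cexp by now apply slit_neq_0.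
  rewrite cexp_nat_mult. now rewrite cexp_clog.
Qed.

Lemma cpow_m1 (z : C) : slit z -> cpow z (- (1)) = (/ z)%C.
Proof.
  intros H. pose proof (slit_neq_0 z H) as Hz.
  pose proof (cpow_opp_r z 1 Hz) as E. rewrite cpow_1_r in E by auto.
  replace (cpow z (- (1))) with (cpow z (- (1)) * z / z)%C by (field; auto).
  rewrite E. field. auto.
Qed.

Lemma clog_1 : clog 1 = 0%C.
Proof.
  unfold clog. rewrite Cmod_1, ln_1. unfold RtoC. rewrite carg_right by lra.
  replace (0 / 1) with 0 by field. now rewrite atan_0.
Qed.

Lemma cpow_1_l (a : C) : cpow 1 a = 1%C.
Proof.
  rewrite cpow_cexp.
  - rewrite clog_1. replace (a * 0)%C with (RtoC 0) by ring. apply cexp_0.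
  - intros E. apply RtoC_inj in E. lra.
Qed.

Lemma cder_cpow (z a : C) : slit z -> cder (fun w => cpow w a) z (a * cpow z (a - 1)).
Proof.
  intros Hs. pose proof (slit_neq_0 z Hs) as Hz.
  destruct (slit_open z Hs) as [r [Hr H]].
  apply (cder_ext_loc (fun w => cexp (a * clog w)%C) _ z _ r); [exact Hr| |].
  - intros w Hw. symmetry. apply cpow_cexp. now apply slit_neq_0, H.
  - replace (a * cpow z (a - 1))%C with (cexp (a * clog z) * (a * / z))%C.
    + apply (cder_comp cexp (fun w => a * clog w)%C); [apply cder_cexp|].
      now apply cder_scal, cder_clog.
    + rewrite <- cpow_cexp by auto. unfold Cminus. rewrite cpow_plus, cpow_m1 by auto. ring.
Qed.

(** The modulus of z^a is |z|^(Re a) exp (- Im a arg z), and |arg z| <= pi. *)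
Lemma Cmod_cpow_le (z a : C) : slit z ->
  Cmod (cpow z a) <= exp (Rabs (Im a) * PI) * Rpower (Cmod z) (Re a).
Proof.
  intros Hs. rewrite cpow_cexp by now apply slit_neq_0. rewrite Cmod_cexp.
  unfold Rpower. rewrite <- exp_plus.
  apply exp_le_exp. pose proof (carg_bound z Hs) as Hb. destruct a as [p q]. simpl.
  assert (- (q * carg z) <= Rabs q * PI); [|lra].
  apply Rle_trans with (Rabs (- (q * carg z))); [apply Rle_abs|].
  rewrite Rabs_Ropp, Rabs_mult. apply Rmult_le_compat_l; [apply Rabs_pos|exact Hb].
Qed.

(** * Taylor coefficients as Cauchy integrals *)

(** The Cauchy kernel in the variable w = log z: z^(-k-1) dz = exp (-k w) dw. *)
Definition kern (k : nat) (w : C) : C := cexp (- (RtoC (INR k) * w))%C.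

Lemma kern_pow (k : nat) (w : C) : kern k w = (/ (cexp w ^ k))%C.
Proof. unfold kern. now rewrite cexp_opp, cexp_nat_mult. Qed.

Lemma kern_period (k : nat) (u t : R) : kern k (u, t + 2 * PI) = kern k (u, t).
Proof. now rewrite !kern_pow, cexp_period. Qed.

Lemma kern_0 (w : C) : kern 0 w = 1%C.
Proof. rewrite kern_pow. simpl. field. Qed.

Lemma kern_S (k : nat) (w : C) : (cexp w * kern (S k) w)%C = kern k w.
Proof.
  rewrite !kern_pow. simpl. pose proof (cexp_neq_0 w).
  assert (cexp w ^ k <> 0)%C by now apply Cpow_nz. field. auto.
Qed.

Lemma cder_kern (k : nat) (w : C) : cder (kern k) w (- RtoC (INR k) * kern k w).
Proof.
  unfold kern.
  replace (- RtoC (INR k) * cexp (- (RtoC (INR k) * w)))%C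
    with (cexp (- RtoC (INR k) * w) * (- RtoC (INR k) * 1))%C
    by (replace (- (RtoC (INR k) * w))%C with (- RtoC (INR k) * w)%C by ring; ring).
  apply (cder_ext_loc (fun w => cexp (- RtoC (INR k) * w)%C) _ _ _ 1); [lra| |].
  - intros v _. f_equal. ring.
  - apply (cder_comp cexp (fun w => - RtoC (INR k) * w)%C); [apply cder_cexp|].
    apply cder_scal, cder_id.
Qed.

Lemma Cmod_kern (k : nat) (u t : R) : Cmod (kern k (u, t)) = exp (- (INR k * u)).
Proof. unfold kern. rewrite Cmod_cexp. f_equal. simpl. ring. Qed.

(* Cauchy's integral over the circle |z| = exp u, written in the variable log z.  The initial angle
   [th] is kept free so that a period can start next to the cut. *)
Definition coef (F : C -> C) (k : nat) (u th : R) : C :=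
  (/ RtoC (2 * PI) * VI (fun w => F (cexp w) * kern k w) u th (th + 2 * PI))%C.

Definition disc_cont (F : C -> C) : Prop := forall z, Cmod z < 1 -> ccont F z.

Lemma Cmod_cexp_lt_1 (u t : R) : u < 0 -> Cmod (cexp (u, t)) < 1.
Proof. intros Hu. rewrite Cmod_cexp; simpl. rewrite <- exp_0. now apply exp_increasing. Qed.

Lemma ccont_pullback (F : C -> C) (k : nat) (w : C) : ccont F (cexp w) ->
  ccont (fun w => F (cexp w) * kern k w)%C w.
Proof.
  intros H. apply ccont_mult.
  - apply (ccont_comp F cexp); [exact H|]. eapply cder_ccont, cder_cexp.
  - eapply cder_ccont, cder_kern.
Qed.

Lemma cder_pullback (F : C -> C) (k : nat) (w l : C) : cder F (cexp w) l ->
  cder (fun w => F (cexp w) * kern k w)%C w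
    (l * cexp w * kern k w + F (cexp w) * (- RtoC (INR k) * kern k w)).
Proof.
  intros H. apply (cder_mult (fun w => F (cexp w)) (kern k)); [|apply cder_kern].
  apply (cder_comp F cexp); [exact H|apply cder_cexp].
Qed.

Lemma rcont_pullback (F : C -> C) (k : nat) (u t : R) : disc_cont F -> u < 0 ->
  rcont (fun t => F (cexp (u, t)) * kern k (u, t))%C t.
Proof.
  intros HF Hu. apply (ccont_vertical (fun w => F (cexp w) * kern k w)%C).
  apply ccont_pullback, HF. now apply Cmod_cexp_lt_1.
Qed.

Lemma two_PI_neq_0 : RtoC (2 * PI) <> 0%C.
Proof. apply RtoC_neq_0. pose proof PI_RGT_0. lra. Qed.

Lemma period_le (th : R) : th <= th + 2 * PI.
Proof. pose proof PI_RGT_0. lra. Qed.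

Lemma coef_ext (F G : C -> C) (k : nat) (u th : R) : u < 0 ->
  (forall z, Cmod z < 1 -> F z = G z) -> coef F k u th = coef G k u th.
Proof.
  intros Hu H. unfold coef, VI. f_equal. apply CI_ext; [apply period_le|].
  intros t _. rewrite H; [reflexivity|]. now apply Cmod_cexp_lt_1.
Qed.

Lemma coef_plus (F G : C -> C) (k : nat) (u th : R) : u < 0 -> disc_cont F -> disc_cont G ->
  coef (fun z => F z + G z)%C k u th = (coef F k u th + coef G k u th)%C.
Proof.
  intros Hu HF HG. unfold coef, VI.
  rewrite <- Cmult_plus_distr_l, <- CI_plus.
  - f_equal. apply CI_ext; [apply period_le|]. intros t _. ring.
  - apply period_le.
  - intros t _. now apply rcont_pullback.
  - intros t _. now apply rcont_pullback.
Qed.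

Lemma coef_scal (c : C) (F : C -> C) (k : nat) (u th : R) : u < 0 -> disc_cont F ->
  coef (fun z => c * F z)%C k u th = (c * coef F k u th)%C.
Proof.
  intros Hu HF. unfold coef, VI.
  transitivity (/ RtoC (2 * PI) * (c * CI (fun t => F (cexp (u, t)) * kern k (u, t)) th (th + 2 * PI)))%C;
    [|ring].
  rewrite <- (CI_scal c (fun t => F (cexp (u, t)) * kern k (u, t))%C).
  - f_equal. apply CI_ext; [apply period_le|]. intros t _. ring.
  - apply period_le.
  - intros t _. now apply rcont_pullback.
Qed.

Lemma disc_cont_scal (c : C) (F : C -> C) : disc_cont F -> disc_cont (fun z => c * F z)%C.
Proof. intros H z Hz. apply ccont_mult; [apply ccont_const|auto]. Qed.

Lemma disc_cont_plus (F G : C -> C) :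
  disc_cont F -> disc_cont G -> disc_cont (fun z => F z + G z)%C.
Proof. intros H H' z Hz. apply ccont_plus; auto. Qed.

Lemma disc_cont_mulz (F : C -> C) : disc_cont F -> disc_cont (fun z => z * F z)%C.
Proof. intros H z Hz. apply ccont_mult; [apply ccont_id|auto]. Qed.

Lemma coef_minus (F G : C -> C) (k : nat) (u th : R) : u < 0 -> disc_cont F -> disc_cont G ->
  coef (fun z => F z - G z)%C k u th = (coef F k u th - coef G k u th)%C.
Proof.
  intros Hu HF HG.
  rewrite (coef_ext _ (fun z => F z + (-1) * G z)%C) by (auto; intros; ring).
  rewrite coef_plus, coef_scal; auto; [ring|now apply disc_cont_scal].
Qed.

Lemma coef_mulz (F : C -> C) (k : nat) (u th : R) :
  coef (fun z => z * F z)%C (S k) u th = coef F k u th.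
Proof.
  unfold coef, VI. f_equal. apply CI_ext; [apply period_le|].
  intros t _. rewrite <- (kern_S k). ring.
Qed.

Lemma coef_bound (F : C -> C) (k : nat) (u th B : R) : u < 0 -> disc_cont F ->
  (forall t, Cmod (F (cexp (u, t))) <= B) -> Cmod (coef F k u th) <= exp (- (INR k * u)) * B.
Proof.
  intros Hu HF HB. unfold coef, VI. pose proof PI_RGT_0.
  rewrite Cmod_mult, Cmod_inv by apply two_PI_neq_0.
  rewrite Cmod_R, Rabs_pos_eq by lra.
  assert (H1 : Cmod (CI (fun t => F (cexp (u, t)) * kern k (u, t)) th (th + 2 * PI))%C
               <= (th + 2 * PI - th) * (exp (- (INR k * u)) * B)).
  { apply CI_bound; [apply period_le| |].
    - intros t _. now apply rcont_pullback.
    - intros t _. rewrite Cmod_mult, Cmod_kern, Rmult_comm.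
      apply Rmult_le_compat_l; [left; apply exp_pos|apply HB]. }
  apply (Rmult_le_compat_l (/ (2 * PI))) in H1; [|left; apply Rinv_0_lt_compat; lra].
  eapply Rle_trans; [apply H1|]. right. field. lra.
Qed.

(** The derivative of F(exp w) exp (-k w) integrates to zero over a period of Im w. This integration
    by parts is the source of all recurrences for the coefficients of the model functions. *)
Lemma coef_zder (F F' : C -> C) (k : nat) (u th : R) : u < 0 ->
  (forall z, Cmod z < 1 -> cder F z (F' z)) -> disc_cont F' ->
  coef (fun z => z * F' z)%C k u th = (RtoC (INR k) * coef F k u th)%C.
Proof.
  intros Hu HF HF'.
  assert (HFc : disc_cont F) by (intros z Hz; eapply cder_ccont, HF, Hz).
  unfold coef, VI.
  set (G := fun w => (F (cexp w) * kern k w)%C).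
  assert (R0 : forall t, rcont (fun t => cexp (u, t) * F' (cexp (u, t)) * kern k (u, t)
                  + - RtoC (INR k) * (F (cexp (u, t)) * kern k (u, t)))%C t).
  { intros t. apply (ccont_vertical (fun w => cexp w * F' (cexp w) * kern k w
                                      + - RtoC (INR k) * (F (cexp w) * kern k w))%C).
    apply ccont_plus; [|apply ccont_mult; [apply ccont_const|]].
    - apply (ccont_pullback (fun z => z * F' z)%C).
      apply ccont_mult; [apply ccont_id|]. apply HF'. now apply Cmod_cexp_lt_1.
    - apply ccont_pullback, HFc. now apply Cmod_cexp_lt_1. }
  assert (E : CI (fun t => Ci * ((cexp (u, t) * F' (cexp (u, t))) * kern k (u, t)
                  + - RtoC (INR k) * (F (cexp (u, t)) * kern k (u, t))))%C th (th + 2 * PI) = 0%C).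
  { rewrite (CI_FTC (fun t => G (u, t))).
    - unfold G. rewrite cexp_period, kern_period. ring.
    - apply period_le.
    - intros t _. apply cder_vertical.
      replace (cexp (u, t) * F' (cexp (u, t)) * kern k (u, t)
        + - RtoC (INR k) * (F (cexp (u, t)) * kern k (u, t)))%C
        with (F' (cexp (u, t)) * cexp (u, t) * kern k (u, t)
              + F (cexp (u, t)) * (- RtoC (INR k) * kern k (u, t)))%C by ring.
      apply (cder_pullback F). apply HF. now apply Cmod_cexp_lt_1.
    - intros t _. apply rcont_scal, R0. }
  assert (R1 : forall t, rcont (fun t => cexp (u, t) * F' (cexp (u, t)) * kern k (u, t))%C t).
  { intros t. apply (rcont_pullback (fun z => z * F' z)%C); [now apply disc_cont_mulz|exact Hu]. }
  assert (R2 : forall t, rcont (fun t => F (cexp (u, t)) * kern k (u, t))%C t).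
  { intros t. now apply rcont_pullback. }
  assert (R3 : forall t, rcont (fun t => - RtoC (INR k) * (F (cexp (u, t)) * kern k (u, t)))%C t).
  { intros t. now apply rcont_scal. }
  pose proof (period_le th) as Hth.
  rewrite CI_scal in E; auto.
  rewrite (CI_plus (fun t => cexp (u, t) * F' (cexp (u, t)) * kern k (u, t))%C
             (fun t => - RtoC (INR k) * (F (cexp (u, t)) * kern k (u, t)))%C) in E; auto.
  rewrite CI_scal in E; auto.
  set (X := CI (fun t => cexp (u, t) * F' (cexp (u, t)) * kern k (u, t))%C th (th + 2 * PI)) in *.
  set (Y := CI (fun t => F (cexp (u, t)) * kern k (u, t))%C th (th + 2 * PI)) in *.
  assert (HX : X = (RtoC (INR k) * Y)%C).
  { apply Cminus_eq_0. assert (HC : Ci <> 0%C) by (intros H; injection H; lra).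
    replace (X - RtoC (INR k) * Y)%C with (/ Ci * (Ci * (X + - RtoC (INR k) * Y)))%C
      by (field; auto).
    rewrite E. ring. }
  rewrite HX. ring.
Qed.

(** The mean value property. Goursat on a rectangle of height 2 pi, whose horizontal sides cancel by
    periodicity, makes the mean independent of the radius; then the radius tends to 0 and continuity
    at the centre concludes. *)
Lemma coef_0 (F : C -> C) (u th : R) : u < 0 ->
  (forall z, Cmod z < 1 -> exists l, cder F z l) -> coef F 0 u th = F 0%C.
Proof.
  intros Hu HF.
  assert (HFc : disc_cont F).
  { intros z Hz. destruct (HF z Hz) as [l Hl]. eapply cder_ccont, Hl. }
  pose proof PI_RGT_0.
  set (g := fun w => (F (cexp w) * kern 0 w)%C).
  assert (Hind : forall v, v < u -> coef F 0 u th = coef F 0 v th).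
  { intros v Hv. unfold coef. f_equal. fold g.
    assert (E : rect_int g v u th (th + 2 * PI) = 0%C).
    { apply goursat; [lra|apply period_le|]. intros x y Hx Hy.
      destruct (HF (cexp (x, y))) as [l Hl]; [apply Cmod_cexp_lt_1; lra|].
      eexists. apply cder_pullback, Hl. }
    unfold rect_int in E.
    assert (E' : HI g (th + 2 * PI) v u = HI g th v u).
    { unfold HI. apply CI_ext; [lra|]. intros t _. unfold g.
      now rewrite cexp_period, kern_period. }
    rewrite E' in E. apply Cminus_eq_0.
    assert (HC : Ci <> 0%C) by (intros H'; injection H'; lra).
    replace (VI g u th (th + 2 * PI) - VI g v th (th + 2 * PI))%C with
      (/ Ci * (HI g th v u + Ci * VI g u th (th + 2 * PI) - HI g th v u
               - Ci * VI g v th (th + 2 * PI)))%C by (field; auto).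
    rewrite E. ring. }
  assert (H1 : forall v, v < 0 -> coef (fun _ => F 0%C) 0 v th = F 0%C).
  { intros v Hv. unfold coef, VI.
    rewrite (CI_ext _ (fun _ => F 0%C)); [|apply period_le|intros; rewrite kern_0; ring].
    rewrite CI_const. replace (th + 2 * PI - th) with (2 * PI) by ring.
    field. apply two_PI_neq_0. }
  apply Cminus_eq_0, Cmod_eq_0. apply Rle_antisym; [|apply Cmod_ge_0].
  apply le_epsilon. intros eps He. rewrite Rplus_0_l.
  destruct (HFc 0%C ltac:(rewrite Cmod_0; lra) eps He) as [d [Hd Hw]].
  (* A circle smaller than the given one and of radius exp v < d, inside the neighbourhood given by
     continuity at 0. *)
  set (v := Rmin (u - 1) (ln d - 1)).
  assert (Hv : v < u /\ v < ln d).
  { unfold v. pose proof (Rmin_l (u - 1) (ln d - 1)). pose proof (Rmin_r (u - 1) (ln d - 1)). lra. }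
  rewrite (Hind v) by lra. rewrite <- (H1 v) by lra.
  rewrite <- coef_minus; [|lra|auto|intros z Hz; apply ccont_const].
  eapply Rle_trans.
  - apply (coef_bound _ _ _ _ eps); [lra| |].
    + intros z Hz. apply ccont_minus; [auto|apply ccont_const].
    + intros t. left. apply Hw. replace (cexp (v, t) - 0)%C with (cexp (v, t)) by ring.
      rewrite Cmod_cexp; simpl. rewrite <- (exp_ln d) by auto. apply exp_increasing; lra.
  - simpl. rewrite Rmult_0_l, Ropp_0, exp_0. lra.
Qed.

Lemma disc_cont_pow (j : nat) : disc_cont (fun z => z ^ j)%C.
Proof. intros z _. eapply cder_ccont, cder_pow. Qed.

Lemma coef_pow_diag (k : nat) (u th : R) : u < 0 -> coef (fun z => z ^ k)%C k u th = 1%C.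
Proof.
  intros Hu. induction k as [|k IH].
  - rewrite coef_0; auto. intros z _. eexists. apply (cder_pow z 0).
  - rewrite <- IH. apply (coef_mulz (fun z => z ^ k)%C).
Qed.

(** Since z d/dz multiplies z^j by j and the k-th coefficient by k, that coefficient is annihilated
    by j - k. *)
Lemma coef_pow_off (j k : nat) (u th : R) : u < 0 -> j <> k -> coef (fun z => z ^ j)%C k u th = 0%C.
Proof.
  intros Hu Hjk.
  assert (E := coef_zder (fun z => z ^ j)%C (fun z => RtoC (INR j) * z ^ (pred j))%C k u th Hu
                 (fun z _ => cder_pow z j) (disc_cont_scal _ _ (disc_cont_pow _))).
  rewrite (coef_ext _ (fun z => RtoC (INR j) * z ^ j)%C) in E; auto.
  2: { intros z _. destruct j; simpl; ring. }
  rewrite coef_scal in E; auto; [|apply disc_cont_pow].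
  assert (Hn : (RtoC (INR j) - RtoC (INR k))%C <> 0%C).
  { rewrite <- RtoC_minus. intros H. apply RtoC_inj in H. apply Hjk, INR_eq. lra. }
  set (c := coef (fun z => z ^ j)%C k u th) in *.
  replace c with (/ (RtoC (INR j) - RtoC (INR k)) * (RtoC (INR j) * c - RtoC (INR k) * c))%C
    by (field; auto).
  rewrite E. ring.
Qed.

(** * Finite sums, limits of sequences and power series *)

Fixpoint csum (a : nat -> C) (n : nat) : C :=
  match n with O => 0%C | S n => (csum a n + a n)%C end.

Lemma csum_ext (a b : nat -> C) (n : nat) :
  (forall j, (j < n)%nat -> a j = b j) -> csum a n = csum b n.
Proof.
  induction n as [|n IH]; intros H; [reflexivity|]. simpl. rewrite IH, H; auto.
Qed.

Lemma csum_scal (c : C) (a : nat -> C) (n : nat) : csum (fun j => c * a j)%C n = (c * csum a n)%C.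
Proof. induction n as [|n IH]; simpl; [ring|rewrite IH; ring]. Qed.

Lemma ccont_csum (a : nat -> C -> C) (n : nat) (z : C) :
  (forall j, ccont (a j) z) -> ccont (fun z => csum (fun j => a j z) n) z.
Proof.
  intros H. induction n as [|n IH]; simpl; [apply ccont_const|]. now apply ccont_plus.
Qed.

Lemma cder_csum (a : nat -> C -> C) (n : nat) (z : C) :
  (forall j, exists l, cder (a j) z l) -> exists l, cder (fun z => csum (fun j => a j z) n) z l.
Proof.
  intros H. induction n as [|n [l IH]]; simpl; [eexists; apply cder_const|].
  destruct (H n) as [m Hm]. eexists. apply cder_plus; eassumption.
Qed.

Lemma coef_csum (a : nat -> C -> C) (n k : nat) (u th : R) : u < 0 ->
  (forall j, disc_cont (a j)) ->
  coef (fun z => csum (fun j => a j z) n) k u th = csum (fun j => coef (a j) k u th) n.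
Proof.
  intros Hu H. induction n as [|n IH]; simpl.
  - rewrite (coef_ext _ (fun z => 0 * z ^ 0)%C); auto.
    + rewrite coef_scal; auto; [ring|apply disc_cont_pow].
    + intros; ring.
  - rewrite coef_plus; auto; [now rewrite IH|].
    intros z Hz. apply ccont_csum. intros j. now apply H.
Qed.

Lemma csum_delta (a : nat -> C) (n k : nat) : (k < n)%nat ->
  (forall j, j <> k -> a j = 0%C) -> csum a n = a k.
Proof.
  intros Hk H. induction n as [|n IH]; [lia|]. simpl.
  destruct (Nat.eq_dec k n) as [->|Hn].
  - replace (csum a n) with (RtoC 0); [ring|]. clear IH Hk.
    symmetry. transitivity (csum (fun j => 0 * a j)%C n).
    + apply csum_ext. intros j Hj. rewrite H by lia. ring.
    + rewrite csum_scal. ring.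
  - rewrite IH by lia. rewrite (H n) by auto. ring.
Qed.

Definition clim (u : nat -> C) (l : C) : Prop :=
  forall eps, 0 < eps -> exists n0, forall n, (n0 <= n)%nat -> Cmod (u n - l) < eps.

Lemma filterlim_clim (u : nat -> C) (l : C) :
  filterlim u eventually (locally (l : C_NormedModule)) <-> clim u l.
Proof.
  split.
  - intros H eps He. apply (H (fun z => Cmod (z - l) < eps)).
    apply locally_C. exists (mkposreal eps He). intros y Hy. exact Hy.
  - intros H Q [eps HQ]. destruct (H eps (cond_pos eps)) as [n0 Hn0].
    exists n0. intros n Hn. apply HQ. apply C_NormedModule_mixin_compat1. now apply Hn0.
Qed.

Lemma cseries_limit (a : nat -> C) (s : C) : cseries a s -> clim (csum a) s.
Proof.
  intros H eps He.
  assert (Hs : forall n, sum_n (a : nat -> C_NormedModule) n = csum a (S n)).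
  { induction n as [|n IH]; [rewrite sum_O; simpl; ring|].
    rewrite sum_Sn, IH. reflexivity. }
  destruct (proj1 (filterlim_clim _ _) H eps He) as [n0 Hn0].
  exists (S n0). intros n Hn. destruct n as [|n]; [lia|].
  rewrite <- Hs. apply Hn0. lia.
Qed.

Lemma cseries_terms_bounded (a : nat -> C) (s : C) : cseries a s ->
  exists M, forall j, Cmod (a j) <= M.
Proof.
  intros H. destruct (cseries_limit a s H 1 Rlt_0_1) as [n0 Hn0].
  assert (Hb : forall n, (n0 <= n)%nat -> Cmod (a n) <= 2).
  { intros n Hn. pose proof (Hn0 n Hn) as A1. pose proof (Hn0 (S n) ltac:(lia)) as A2.
    simpl in A2. replace (a n) with ((csum a n + a n - s) - (csum a n - s))%C by ring.
    eapply Rle_trans; [apply Cmod_sub_le|]. lra. }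
  assert (Hf : forall n, exists M, forall j, (j < n)%nat -> Cmod (a j) <= M).
  { induction n as [|n [M HM]]; [exists 0; intros; lia|].
    exists (Rmax M (Cmod (a n))). intros j Hj.
    destruct (Nat.eq_dec j n) as [->|Hn]; [apply Rmax_r|].
    eapply Rle_trans; [apply HM; lia|apply Rmax_l]. }
  destruct (Hf n0) as [M HM]. exists (Rmax M 2). intros j.
  destruct (le_lt_dec n0 j).
  - eapply Rle_trans; [apply Hb; auto|apply Rmax_r].
  - eapply Rle_trans; [apply HM; auto|apply Rmax_l].
Qed.

Lemma power_series_remainder (a : nat -> C) (w s : C) (rho M : R) (N : nat) :
  0 < rho -> Cmod w < rho -> (forall j, Cmod (a j) * rho ^ j <= M) ->
  cseries (fun j => w ^ j * a j)%C s ->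
  Cmod (s - csum (fun j => w ^ j * a j)%C N) <= M * (Cmod w / rho) ^ N / (1 - Cmod w / rho).
Proof.
  intros Hr Hw HM Hs. set (q := Cmod w / rho).
  assert (Hq0 : 0 <= q) by (apply Rdiv_le_0_compat; [apply Cmod_ge_0|auto]).
  assert (Hq1 : q < 1) by (unfold q; apply Rlt_div_l; lra).
  assert (HM0 : 0 <= M).
  { eapply Rle_trans; [|apply (HM O)]. simpl. pose proof (Cmod_ge_0 (a O)). lra. }
  set (b := fun j => (w ^ j * a j)%C) in *.
  assert (Hb : forall j, Cmod (b j) <= M * q ^ j).
  { intros j. unfold b, q. rewrite Cmod_mult, Cmod_pow.
    unfold Rdiv. rewrite Rpow_mult_distr, pow_inv.
    assert (0 < rho ^ j) by now apply pow_lt.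
    apply (Rmult_le_reg_r (rho ^ j)); [auto|].
    replace (M * (Cmod w ^ j * / rho ^ j) * rho ^ j) with (Cmod w ^ j * M) by (field; lra).
    rewrite Rmult_assoc. apply Rmult_le_compat_l; [apply pow_le, Cmod_ge_0|apply HM]. }
  (* The finite geometric sum is kept exact, which makes the induction on p close with equality. *)
  assert (Hp : forall p, Cmod (csum b (N + p) - csum b N) <= M * q ^ N * (1 - q ^ p) / (1 - q)).
  { induction p as [|p IH].
    - rewrite Nat.add_0_r, Cmod_sub_self. simpl. unfold Rdiv.
      replace (1 - 1) with 0 by ring. lra.
    - rewrite Nat.add_succ_r. simpl csum.
      replace (csum b (N + p) + b (N + p)%nat - csum b N)%C
        with ((csum b (N + p) - csum b N) + b (N + p)%nat)%C by ring.
      eapply Rle_trans; [apply Cmod_triangle|].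
      specialize (Hb (N + p)%nat). rewrite pow_add in Hb.
      eapply Rle_trans; [apply Rplus_le_compat; [exact IH|exact Hb]|].
      right. simpl. field. lra. }
  apply le_epsilon. intros eps He.
  destruct (cseries_limit b s Hs eps He) as [n0 Hn0].
  specialize (Hp n0). specialize (Hn0 (N + n0)%nat ltac:(lia)).
  replace (s - csum b N)%C with ((csum b (N + n0) - csum b N) - (csum b (N + n0) - s))%C by ring.
  eapply Rle_trans; [apply Cmod_sub_le|].
  assert (M * q ^ N * (1 - q ^ n0) / (1 - q) <= M * q ^ N / (1 - q)).
  { unfold Rdiv. apply Rmult_le_compat_r; [left; apply Rinv_0_lt_compat; lra|].
    pose proof (pow_le q n0 Hq0). pose proof (pow_le q N Hq0).
    assert (0 <= M * q ^ N) by now apply Rmult_le_pos. nra. }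
  lra.
Qed.

(** Cauchy integrals recover the given coefficients: a partial sum contributes exactly d k by
    orthogonality of the powers, and the tail contributes at most a fixed factor times q^n on the
    circle |z| = exp u. *)
Lemma coef_power_series (f : C -> C) (d : nat -> C) (k : nat) (u th : R) : u < 0 -> disc_cont f ->
  (forall z, Cmod z < 1 -> cseries (fun j => z ^ j * d j)%C (f z)) -> coef f k u th = d k.
Proof.
  intros Hu Hf Hs.
  (* A radius strictly between exp u and 1: convergence at rho bounds the terms, so the tail on |z|
     = exp u is geometric. *)
  set (rho := exp (u / 2)).
  assert (Hr0 : 0 < rho) by apply exp_pos.
  assert (Hr1 : rho < 1) by (unfold rho; rewrite <- exp_0; apply exp_increasing; lra).
  assert (Hr2 : exp u < rho) by (unfold rho; apply exp_increasing; lra).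
  destruct (cseries_terms_bounded _ _ (Hs (RtoC rho) ltac:(rewrite Cmod_R, Rabs_pos_eq; lra)))
    as [M HM].
  set (q := exp u / rho).
  assert (Hq0 : 0 <= q) by (apply Rdiv_le_0_compat; [left; apply exp_pos|auto]).
  assert (Hq1 : q < 1) by (unfold q; apply Rlt_div_l; lra).
  apply Cminus_eq_0, Cmod_eq_0. apply Rle_antisym; [|apply Cmod_ge_0].
  apply le_epsilon. intros eps He. rewrite Rplus_0_l.
  assert (HM' : forall j, Cmod (d j) * rho ^ j <= M).
  { intros j. specialize (HM j).
    rewrite Cmod_mult, Cmod_pow, Cmod_R, Rabs_pos_eq in HM by lra. lra. }
  assert (HM0 : 0 <= M).
  { eapply Rle_trans; [|apply (HM' O)]. simpl. pose proof (Cmod_ge_0 (d O)). lra. }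
  set (B := exp (- (INR k * u)) * (M / (1 - q)) + 1).
  assert (HB0 : 0 <= exp (- (INR k * u)) * (M / (1 - q))).
  { apply Rmult_le_pos; [left; apply exp_pos|]. apply Rdiv_le_0_compat; lra. }
  destruct (pow_lt_1_zero q ltac:(rewrite Rabs_pos_eq; lra) (eps / B)
              ltac:(apply Rdiv_lt_0_compat; unfold B; lra)) as [N HN].
  (* The added S k makes the partial sum long enough to contain the term of index k. *)
  specialize (HN (N + S k)%nat ltac:(lia)).
  set (n := (N + S k)%nat) in *.
  rewrite Rabs_pos_eq in HN by now apply pow_le.
  assert (Hd : d k = coef (fun z => csum (fun j => z ^ j * d j)%C n) k u th).
  { rewrite (coef_csum (fun j z => z ^ j * d j)%C); auto.
    2: { intros j z Hz. apply ccont_mult; [now apply disc_cont_pow|apply ccont_const]. }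
    assert (Hj : forall j, coef (fun z => z ^ j * d j)%C k u th
                           = (d j * coef (fun z => z ^ j)%C k u th)%C).
    { intros j. rewrite <- coef_scal; auto; [|apply disc_cont_pow].
      apply coef_ext; auto. intros; ring. }
    rewrite (csum_delta _ _ k).
    - rewrite Hj, coef_pow_diag by auto. ring.
    - unfold n. lia.
    - intros j Hjk. rewrite Hj, coef_pow_off by auto. ring. }
  rewrite Hd, <- coef_minus; auto.
  2: { intros z Hz. apply (ccont_csum (fun j z => z ^ j * d j)%C). intros j.
       apply ccont_mult; [now apply disc_cont_pow|apply ccont_const]. }
  eapply Rle_trans.
  - apply (coef_bound _ _ _ _ (M * q ^ n / (1 - q))); auto.
    + intros z Hz. apply ccont_minus; [auto|].
      apply (ccont_csum (fun j z => z ^ j * d j)%C). intros j.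
      apply ccont_mult; [now apply disc_cont_pow|apply ccont_const].
    + intros t.
      pose proof (power_series_remainder d (cexp (u, t)) (f (cexp (u, t))) rho M n Hr0) as H.
      rewrite Cmod_cexp in H; simpl Re in H. fold q in H. apply H; auto.
      apply Hs. now apply Cmod_cexp_lt_1.
  - replace (exp (- (INR k * u)) * (M * q ^ n / (1 - q)))
      with (exp (- (INR k * u)) * (M / (1 - q)) * q ^ n) by (field; lra).
    assert (HBp : 0 < B) by (unfold B; lra).
    apply (Rmult_lt_compat_l B) in HN; [|auto].
    replace (B * (eps / B)) with eps in HN by (field; lra).
    assert (0 <= q ^ n) by now apply pow_le.
    unfold B in HN. nra.
Qed.

(** * Coefficients of the model functions *)

Lemma slit_disc (z : C) : Cmod z < 1 -> slit (1 - z).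
Proof.
  intros Hz [_ H]. pose proof (re_le_Cmod z). pose proof (Rle_abs (Re z)).
  destruct z as [x y]. simpl in *. lra.
Qed.

Lemma cder_one_minus (z : C) : cder (fun w => 1 - w)%C z (- (1)).
Proof.
  replace (- (1))%C with (0 - 1)%C by ring. apply cder_minus; [apply cder_const|apply cder_id].
Qed.

Lemma cder_cpow_one_minus (z a : C) : slit (1 - z) ->
  cder (fun w => cpow (1 - w) a) z (- a * cpow (1 - z) (a - 1)).
Proof.
  intros H.
  replace (- a * cpow (1 - z) (a - 1))%C with (a * cpow (1 - z) (a - 1) * - (1))%C by ring.
  apply (cder_comp (fun w => cpow w a) (fun w => 1 - w)%C); [|apply cder_one_minus].
  now apply (cder_cpow (1 - z)).
Qed.

Lemma cder_clog_one_minus (z : C) : slit (1 - z) ->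
  cder (fun w => clog (1 - w)) z (- / (1 - z)).
Proof.
  intros H. replace (- / (1 - z))%C with (/ (1 - z) * - (1))%C by ring.
  apply (cder_comp clog (fun w => 1 - w)%C); [|apply cder_one_minus].
  now apply (cder_clog (1 - z)).
Qed.

Lemma cder_pow_one_minus (z : C) (n : nat) :
  cder (fun w => (1 - w) ^ n)%C z (- (RtoC (INR n) * (1 - z) ^ (pred n))).
Proof.
  replace (- (RtoC (INR n) * (1 - z) ^ pred n))%C
    with (RtoC (INR n) * (1 - z) ^ pred n * - (1))%C by ring.
  apply (cder_comp (fun w => w ^ n)%C (fun w => 1 - w)%C); [|apply cder_one_minus].
  apply (cder_pow (1 - z)).
Qed.

Lemma disc_cont_cpow (a : C) : disc_cont (fun z => cpow (1 - z) a).
Proof. intros z Hz. eapply cder_ccont, cder_cpow_one_minus. now apply slit_disc. Qed.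

(** The binomial recurrence. [coef_zder] is applied to (1-z)^(a+1), so that its derivative and the
    function itself, (1-z)^a - z (1-z)^a, both involve only the exponent a. *)
Lemma coef_cpow_rec (a : C) (j : nat) (u th : R) : u < 0 ->
  (RtoC (INR (S j)) * coef (fun z => cpow (1 - z) a) (S j) u th
   = (RtoC (INR j) - a) * coef (fun z => cpow (1 - z) a) j u th)%C.
Proof.
  intros Hu.
  assert (E := coef_zder (fun z => cpow (1 - z) (a + 1)%C)
                 (fun z => - (a + 1) * cpow (1 - z) (a + 1 - 1))%C (S j) u th Hu
                 (fun z Hz => cder_cpow_one_minus z _ (slit_disc z Hz))
                 (disc_cont_scal _ _ (disc_cont_cpow _))).
  rewrite (coef_ext _ (fun z => - (a + 1) * (z * cpow (1 - z) a))%C) in E; try exact Hu.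
  2: { intros z _. replace (a + 1 - 1)%C with a by ring. ring. }
  rewrite coef_scal in E; try exact Hu; [|apply disc_cont_mulz, disc_cont_cpow].
  rewrite (coef_mulz (fun z => cpow (1 - z) a)) in E.
  rewrite (coef_ext (fun z => cpow (1 - z) (a + 1)%C)
             (fun z => cpow (1 - z) a - z * cpow (1 - z) a)%C) in E; try exact Hu.
  2: { intros z Hz. pose proof (slit_disc z Hz) as Hs. rewrite cpow_plus by now apply slit_neq_0.
       rewrite cpow_1_r by auto. ring. }
  rewrite coef_minus in E; try exact Hu; [|apply disc_cont_cpow|apply disc_cont_mulz, disc_cont_cpow].
  rewrite (coef_mulz (fun z => cpow (1 - z) a)) in E.
  set (x := coef (fun z => cpow (1 - z) a) (S j) u th) in *.
  set (y := coef (fun z => cpow (1 - z) a) j u th) in *.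
  rewrite S_INR, RtoC_plus in *.
  replace ((RtoC (INR j) + 1) * x)%C with ((RtoC (INR j) + 1) * (x - y) + (RtoC (INR j) + 1) * y)%C
    by ring.
  rewrite <- E. ring.
Qed.

Lemma coef_cpow_0 (a : C) (u th : R) : u < 0 -> coef (fun z => cpow (1 - z) a) 0 u th = 1%C.
Proof.
  intros Hu. rewrite coef_0; auto.
  - replace (1 - 0)%C with (RtoC 1) by ring. apply cpow_1_l.
  - intros z Hz. eexists. apply cder_cpow_one_minus. now apply slit_disc.
Qed.

Lemma coef_inv_one_minus (k : nat) (u th : R) : u < 0 -> coef (fun z => / (1 - z))%C k u th = 1%C.
Proof.
  intros Hu. rewrite (coef_ext _ (fun z => cpow (1 - z) (- (1)))); auto.
  2: { intros z Hz. now rewrite cpow_m1 by now apply slit_disc. }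
  induction k as [|k IH]; [now apply coef_cpow_0|].
  pose proof (coef_cpow_rec (- (1)) k u th Hu) as E. rewrite IH in E.
  rewrite S_INR, RtoC_plus in E.
  assert (Hn : (RtoC (INR k) + 1)%C <> 0%C).
  { rewrite <- RtoC_plus. intros H. apply RtoC_inj in H. pose proof (pos_INR k). lra. }
  set (x := coef (fun z => cpow (1 - z) (- (1))) (S k) u th) in *.
  replace x with (/ (RtoC (INR k) + 1) * ((RtoC (INR k) + 1) * x))%C by (field; auto).
  rewrite E. field. auto.
Qed.

Lemma disc_cont_pow_one_minus (m : nat) : disc_cont (fun z => (1 - z) ^ m)%C.
Proof. intros z _. eapply cder_ccont, cder_pow_one_minus. Qed.

(** The coefficients from index m on are the inhomogeneous term in the recurrence for (1-z)^m log
    (1-z): nonzero at k = m, zero beyond. *)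
Lemma coef_pow_one_minus (m k : nat) (u th : R) : u < 0 -> (m <= k)%nat ->
  coef (fun z => (1 - z) ^ m)%C k u th = if Nat.eq_dec k m then ((-1) ^ m)%C else 0%C.
Proof.
  intros Hu. revert k. induction m as [|m IH]; intros k Hk.
  - rewrite (coef_ext _ (fun z => z ^ 0)%C) by (auto; intros; reflexivity).
    destruct (Nat.eq_dec k 0) as [->|Hn]; [now apply coef_pow_diag|].
    apply coef_pow_off; auto.
  - destruct k as [|k]; [lia|].
    rewrite (coef_ext _ (fun z => (1 - z) ^ m - z * (1 - z) ^ m)%C) by (auto; intros; simpl; ring).
    rewrite coef_minus; auto; [|apply disc_cont_pow_one_minus|apply disc_cont_mulz, disc_cont_pow_one_minus].
    rewrite (coef_mulz (fun z => (1 - z) ^ m)%C), !IH by lia.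
    destruct (Nat.eq_dec (S k) m); [lia|].
    destruct (Nat.eq_dec k m), (Nat.eq_dec (S k) (S m)); try lia; simpl; ring.
Qed.

(** The model singularity for a positive integer delta, with m = delta - 1. *)
Definition pow_log (m : nat) (z : C) : C := ((1 - z) ^ m * clog (1 - z))%C.

Lemma cder_pow_log (m : nat) (z : C) : slit (1 - z) ->
  cder (pow_log m) z (- (RtoC (INR m) * (1 - z) ^ (pred m)) * clog (1 - z)
                      + (1 - z) ^ m * (- / (1 - z))).
Proof.
  intros H. apply (cder_mult (fun w => (1 - w) ^ m)%C (fun w => clog (1 - w))).
  - apply cder_pow_one_minus.
  - now apply cder_clog_one_minus.
Qed.

Lemma disc_cont_pow_log (m : nat) : disc_cont (pow_log m).
Proof. intros z Hz. eapply cder_ccont, cder_pow_log. now apply slit_disc. Qed.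

(** As for powers, the exponent is raised by one first: z d/dz of (1-z)^(m+1) log (1-z) yields the
    same logarithmic function of exponent m and a polynomial. *)
Lemma coef_pow_log_rec (m j : nat) (u th : R) : u < 0 ->
  (RtoC (INR (S j)) * coef (pow_log m) (S j) u th
   = (RtoC (INR j) - RtoC (INR m)) * coef (pow_log m) j u th
     - coef (fun z => (1 - z) ^ m)%C j u th)%C.
Proof.
  intros Hu.
  assert (Hc1 : disc_cont (fun z => - RtoC (INR (S m)) * pow_log m z)%C)
    by apply disc_cont_scal, disc_cont_pow_log.
  assert (Hc2 : disc_cont (fun z => (-1) * (1 - z) ^ m)%C)
    by apply disc_cont_scal, disc_cont_pow_one_minus.
  assert (E := coef_zder (pow_log (S m))
                 (fun z => - RtoC (INR (S m)) * pow_log m z + (-1) * (1 - z) ^ m)%C (S j) u th Hu).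
  rewrite (coef_mulz (fun z => - RtoC (INR (S m)) * pow_log m z + (-1) * (1 - z) ^ m)%C) in E.
  rewrite coef_plus, !coef_scal in E; auto using disc_cont_pow_log, disc_cont_pow_one_minus.
  rewrite (coef_ext (pow_log (S m)) (fun z => pow_log m z - z * pow_log m z)%C) in E; auto.
  2: { intros z _. unfold pow_log. simpl. ring. }
  rewrite coef_minus, coef_mulz in E; auto using disc_cont_pow_log, disc_cont_mulz.
  set (x := coef (pow_log m) (S j) u th) in *. set (y := coef (pow_log m) j u th) in *.
  set (p := coef (fun z => (1 - z) ^ m)%C j u th) in *.
  rewrite !S_INR, !RtoC_plus in *.
  replace ((RtoC (INR j) + 1) * x)%C with ((RtoC (INR j) + 1) * (x - y) + (RtoC (INR j) + 1) * y)%C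
    by ring.
  rewrite <- E; [ring| |].
  - intros z Hz. pose proof (slit_disc z Hz) as Hs. pose proof (slit_neq_0 _ Hs) as Hn.
    pose proof (cder_pow_log (S m) z Hs) as D. unfold pow_log at 2.
    match goal with |- cder _ _ ?a => match type of D with cder _ _ ?b => replace a with b end end;
      [exact D|]. rewrite S_INR, RtoC_plus. simpl. field. exact Hn.
  - now apply disc_cont_plus.
Qed.

(** At j = m the factor j - m of the recurrence vanishes, so the coefficient of index m + 1 is
    determined by the polynomial term alone; from there on the recurrence is homogeneous. *)
Lemma coef_pow_log (m j : nat) (u th : R) : u < 0 ->
  coef (pow_log m) (S (m + j)) u th
  = ((-1) ^ (S m) * RtoC (INR (fact m) * INR (fact j) / INR (fact (S (m + j)))))%C.
Proof.
  intros Hu. induction j as [|j IH].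
  - rewrite Nat.add_0_r. pose proof (coef_pow_log_rec m m u th Hu) as E.
    rewrite (coef_pow_one_minus m m) in E by auto. destruct (Nat.eq_dec m m); [|congruence].
    set (x := coef (pow_log m) (S m) u th) in *.
    assert (Hn : RtoC (INR (S m)) <> 0%C) by (apply RtoC_neq_0, not_0_INR; lia).
    replace x with (/ RtoC (INR (S m)) * (RtoC (INR (S m)) * x))%C by (field; auto).
    rewrite E.
    replace (INR (fact m) * INR (fact 0) / INR (fact (S m))) with (/ INR (S m)).
    + rewrite RtoC_inv by (apply not_0_INR; lia). simpl Cpow.
      replace (RtoC (-1)) with (- (1))%C by (rewrite <- RtoC_opp; reflexivity). ring.
    + change (fact (S m)) with (S m * fact m)%nat. rewrite mult_INR. simpl (INR (fact 0)).
      field. split; [apply INR_fact_neq_0|]. apply not_0_INR. lia.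
  - rewrite Nat.add_succ_r. pose proof (coef_pow_log_rec m (S (m + j)) u th Hu) as E.
    rewrite (coef_pow_one_minus m) in E by (auto; lia).
    destruct (Nat.eq_dec (S (m + j)) m); [lia|]. rewrite IH in E.
    set (x := coef (pow_log m) (S (S (m + j))) u th) in *.
    assert (Hn' : INR (S (S (m + j))) <> 0) by (apply not_0_INR; lia).
    assert (Hn : RtoC (INR (S (S (m + j)))) <> 0%C) by now apply RtoC_neq_0.
    replace x with (/ RtoC (INR (S (S (m + j)))) * (RtoC (INR (S (S (m + j)))) * x))%C by (field; auto).
    rewrite E, <- RtoC_minus, <- RtoC_inv by exact Hn'.
    transitivity ((-1) ^ S m * RtoC (/ INR (S (S (m + j))) * ((INR (S (m + j)) - INR m)
       * (INR (fact m) * INR (fact j) / INR (fact (S (m + j)))))))%C.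
    + rewrite !RtoC_mult. ring.
    + f_equal. f_equal.
      change (fact (S (S (m + j)))) with (S (S (m + j)) * fact (S (m + j)))%nat.
      change (fact (S j)) with (S j * fact j)%nat. rewrite !mult_INR.
      replace (INR (S (m + j)) - INR m) with (INR (S j)) by (rewrite !S_INR, plus_INR; ring).
      field. split; [apply INR_fact_neq_0|exact Hn'].
Qed.

(** * The transfer theorem *)

(** The M-th power of y / M <= exp (y / M). It both balances polynomial growth against the kernel
    and turns exponential decay into O(k^-M). *)
Lemma pow_le_exp (M : nat) (y : R) : (1 <= M)%nat -> 0 <= y -> y ^ M <= INR M ^ M * exp y.
Proof.
  intros HM Hy. assert (Hm : 0 < INR M) by (apply lt_0_INR; lia).
  assert (H : y / INR M <= exp (y / INR M)) by (pose proof (exp_ineq1_le (y / INR M)); lra).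
  assert (E : exp (y / INR M) ^ M = exp y).
  { rewrite <- Rpower_pow by apply exp_pos. unfold Rpower. rewrite ln_exp. f_equal. field. lra. }
  rewrite <- E, <- Rpow_mult_distr. apply pow_incr. split; [exact Hy|].
  apply (Rmult_le_compat_l (INR M)) in H; [|lra].
  replace (INR M * (y / INR M)) with y in H by (field; lra). exact H.
Qed.

Lemma Rbar_exp_room (r : Rbar) (eta : R) : Rbar_lt 1 r -> 0 < eta ->
  exists u1, 0 < u1 <= 1 /\ 12 * u1 < eta /\ forall u, u <= u1 -> Rbar_lt (exp u) r.
Proof.
  (* [near_1] bounds |exp w - 1| by 6 (u1 + u1) on the square of half-side u1, whence [eta / 13];
     [ln r / 2] keeps the circle of radius exp u1 strictly inside a finite disc. *)
  intros Hr He. destruct r as [r| |]; simpl in Hr; [|exists (Rmin 1 (eta / 13))|contradiction].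
  - exists (Rmin (Rmin 1 (eta / 13)) (ln r / 2)).
    assert (0 < ln r) by (rewrite <- ln_1; apply ln_increasing; lra).
    pose proof (Rmin_l (Rmin 1 (eta / 13)) (ln r / 2)). pose proof (Rmin_r (Rmin 1 (eta / 13)) (ln r / 2)).
    pose proof (Rmin_l 1 (eta / 13)). pose proof (Rmin_r 1 (eta / 13)).
    split; [split; [repeat apply Rmin_glb_lt; lra|lra]|]. split; [lra|].
    intros u Hu. simpl. rewrite <- (exp_ln r) by lra. apply exp_increasing. lra.
  - pose proof (Rmin_l 1 (eta / 13)). pose proof (Rmin_r 1 (eta / 13)).
    split; [split; [repeat apply Rmin_glb_lt; lra|lra]|]. split; [lra|]. intros; exact I.
Qed.

Lemma dom0_disc (r : Rbar) (z : C) : Rbar_lt 1 r -> Cmod z < 1 -> dom0 r z.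
Proof.
  intros Hr Hz. split.
  - unfold diskD. destruct r; simpl in *; auto; lra.
  - intros [_ H]. pose proof (re_le_Cmod z). pose proof (Rle_abs (Re z)). lra.
Qed.

Lemma dom0_cexp (r : Rbar) (u t : R) : Rbar_lt (exp u) r -> 0 < t < 2 * PI -> dom0 r (cexp (u, t)).
Proof.
  intros Hr Ht. pose proof (exp_pos u). split.
  - unfold diskD. rewrite Cmod_cexp. exact Hr.
  - unfold cexp; simpl. intros [H1 H2].
    assert (Hs : sin t = 0).
    { apply Rmult_integral in H1. destruct H1; lra. }
    destruct (Rtotal_order t PI) as [Hlt|[Heq|Hgt]].
    + pose proof (sin_gt_0 t ltac:(lra) Hlt). lra.
    + rewrite Heq, cos_PI in H2. lra.
    + pose proof (sin_lt_0 t ltac:(lra) ltac:(lra)). lra.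
Qed.

Lemma cexp_neq_1 (u t : R) : (u, t) <> (0, 0) -> Rabs t < PI -> cexp (u, t) <> 1%C.
Proof.
  intros H0 Ht E. apply Rabs_def2 in Ht.
  assert (Hu : u = 0).
  { assert (Cmod (cexp (u, t)) = 1) as E1 by (rewrite E; apply Cmod_1).
    rewrite Cmod_cexp in E1. simpl in E1. apply exp_inv. now rewrite exp_0. }
  subst u. unfold cexp in E; simpl in E. rewrite exp_0 in E.
  injection E as E1 E2. rewrite Rmult_1_l in E1, E2. apply H0. f_equal.
  destruct (Rtotal_order t 0) as [Hlt|[Heq|Hgt]]; auto.
  - assert (0 < sin (- t)) by (apply sin_gt_0; lra). rewrite sin_neg in H. lra.
  - pose proof (sin_gt_0 t ltac:(lra) ltac:(lra)). lra.
Qed.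

Section Transfer.

Variables (r : Rbar) (F P : C -> C) (M : nat) (eta C0 B : R).
Hypothesis hr : Rbar_lt 1 r.
Hypothesis hM : (1 <= M)%nat.
Hypothesis hF : forall z, dom0 r z -> exists l, cder F z l.
Hypothesis heta : 0 < eta.
Hypothesis hC0 : 0 <= C0.
Hypothesis hB : 0 <= B.
(** The point 1 is left out because P will contain a difference quotient at 1, whose expression
    there is a division by zero; boundedness makes the singularity removable. *)
Hypothesis hP : forall z : C, z <> 1%C -> Cmod (z - 1) < eta -> (exists l, cder P z l) /\ Cmod (P z) <= B.
Hypothesis hFP : forall z, dom0 r z -> Cmod (z - 1) < eta -> Cmod (F z - P z) <= C0 * Cmod (z - 1) ^ M.

Variable u1 : R.
Hypothesis hu1 : 0 < u1 <= 1.
Hypothesis hu1e : 12 * u1 < eta.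
Hypothesis hu1r : forall u, u <= u1 -> Rbar_lt (exp u) r.

Lemma near_1 (u t : R) : Rabs u <= u1 -> Rabs t <= u1 -> Cmod (cexp (u, t) - 1) < eta.
Proof.
  intros Hu Ht. eapply Rle_lt_trans; [apply Cmod_cexp_sub1; lra|]. lra.
Qed.

(** The arc is open at the cut, so compactness covers only its middle part; next to the cut F is
    bounded through P and the estimate of F - P. *)
Lemma outer_arc_bound :
  exists B1, 0 <= B1 /\ forall y, 0 < y < 2 * PI -> Cmod (F (cexp (u1, y))) <= B1.
Proof.
  pose proof PI2_1.
  (* Boundedness on the compact middle part is read off Riemann integrability. *)
  destruct (ex_RInt_ub (V := C_R_CompleteNormedModule) (fun y => F (cexp (u1, y))) u1 (2 * PI - u1))
    as [B2 HB2].
  { eexists. apply rcont_is_RInt; [lra|]. intros t Ht.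
    apply (ccont_vertical (fun w => F (cexp w))). apply (ccont_comp F cexp).
    - destruct (hF (cexp (u1, t))) as [l Hl].
      + apply dom0_cexp; [apply hu1r; lra|lra].
      + eapply cder_ccont, Hl.
    - eapply cder_ccont, cder_cexp. }
  rewrite Rmin_left, Rmax_right in HB2 by lra.
  assert (H0 : 0 <= C0 * eta ^ M) by (apply Rmult_le_pos; [lra|apply pow_le; lra]).
  assert (Hn : forall y, 0 < y < 2 * PI -> Cmod (cexp (u1, y) - 1) < eta ->
                 Cmod (F (cexp (u1, y))) <= B + C0 * eta ^ M).
  { intros y Hy Hd.
    assert (Hne : cexp (u1, y) <> 1%C).
    { intros E. assert (Cmod (cexp (u1, y)) = 1) as E1 by (rewrite E; apply Cmod_1).
      rewrite Cmod_cexp in E1. simpl in E1. pose proof (exp_ineq1 u1 ltac:(lra)). lra. }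
    destruct (hP _ Hne Hd) as [_ Hb].
    pose proof (hFP (cexp (u1, y)) (dom0_cexp r u1 y (hu1r u1 ltac:(lra)) Hy) Hd) as Hf.
    replace (F (cexp (u1, y))) with (P (cexp (u1, y)) + (F (cexp (u1, y)) - P (cexp (u1, y))))%C by ring.
    eapply Rle_trans; [apply Cmod_triangle|].
    assert (C0 * Cmod (cexp (u1, y) - 1) ^ M <= C0 * eta ^ M).
    { apply Rmult_le_compat_l; [auto|]. apply pow_incr. split; [apply Cmod_ge_0|lra]. }
    lra. }
  exists (Rmax (B + C0 * eta ^ M) B2). split.
  { eapply Rle_trans; [|apply Rmax_l]. lra. }
  intros y Hy.
  destruct (Rle_dec y u1); [|destruct (Rle_dec y (2 * PI - u1))].
  - eapply Rle_trans; [|apply Rmax_l]. apply Hn; auto.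
    apply near_1; rewrite Rabs_pos_eq; lra.
  - eapply Rle_trans; [|apply Rmax_r].
    rewrite <- Cmod_norm_R. apply (HB2 y). lra.
  - eapply Rle_trans; [|apply Rmax_l]. apply Hn; auto.
    replace y with ((y - 2 * PI) + 2 * PI) by ring. rewrite cexp_period.
    apply near_1; [rewrite Rabs_pos_eq; lra|]. rewrite Rabs_left; lra.
Qed.

(* In the variable [w = log z] the circle [|z| = exp (-1/k)] is pushed out to [|z| = exp u1], except
   for a contour of width [2/k] around the slit.  On that contour the part [P] is integrated exactly
   (its singularity is removable) and [F - P] is small. *)
Lemma transfer_deformation (k : nat) : / INR k <= u1 -> (1 <= k)%nat ->
  let e := / INR k in
  let g := fun w => (F (cexp w) * kern k w)%C in
  let p := fun w => (P (cexp w) * kern k w)%C in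
  (Ci * VI g (- e) (- e) (- e + 2 * PI)
   = Ci * VI (fun w => g w - p w) (- e) (- e) e
     + HI (fun w => g w - p w) e (- e) u1 - HI (fun w => g w - p w) (- e) (- e) u1
     + Ci * VI g u1 e (2 * PI - e) + Ci * VI p u1 (- e) e)%C.
Proof.
  intros Hk1 Hk e g p. pose proof PI2_1.
  assert (Hkp : 0 < INR k) by (apply lt_0_INR; lia).
  assert (He : 0 < e) by (apply Rinv_0_lt_compat; auto). fold e in Hk1.
  assert (Dg : forall x y, x <= u1 -> 0 < y < 2 * PI \/ x < 0 -> exists l, cder g (x, y) l).
  { intros x y Hx Hor. destruct (hF (cexp (x, y))) as [l Hl].
    - destruct Hor as [Hy|Hx0].
      + apply dom0_cexp; auto.
      + apply dom0_disc; auto. now apply Cmod_cexp_lt_1.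
    - eexists. apply cder_pullback, Hl. }
  assert (Pg : forall x y, g (x, y + 2 * PI) = g (x, y)).
  { intros x y. unfold g. now rewrite cexp_period, kern_period. }
  assert (Cg : forall x y, x <= u1 -> 0 < y < 2 * PI \/ x < 0 -> ccont g (x, y)).
  { intros x y Hx Hor. destruct (Dg x y Hx Hor) as [l Hl]. eapply cder_ccont, Hl. }
  assert (Dp : forall x y, Rabs x <= u1 -> Rabs y <= u1 -> (x, y) <> (0, 0) -> exists l, cder p (x, y) l).
  { intros x y Hx Hy H0. destruct (hP (cexp (x, y))) as [[l Hl] _].
    - apply cexp_neq_1; auto. lra.
    - now apply near_1.
    - eexists. apply cder_pullback, Hl. }
  assert (Cp : forall x y, Rabs x <= u1 -> Rabs y <= u1 -> (x, y) <> (0, 0) -> ccont p (x, y)).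
  { intros x y Hx Hy H0. destruct (Dp x y Hx Hy H0) as [l Hl]. eapply cder_ccont, Hl. }
  (* Heights from e to 2 pi - e avoid the images Im w = 0 and Im w = 2 pi of the cut, so the
     rectangle may reach beyond the unit circle. *)
  assert (G1 : rect_int g (- e) u1 e (2 * PI - e) = 0%C).
  { apply goursat; try lra. intros x y Hx Hy. apply Dg; [lra|]. left; lra. }
  (* Here the only exceptional point is w = 0. For |w| < u1 <= 1 the kernel is at most exp k, which
     gives the bound at the singularity. *)
  assert (G2 : rect_int p (- e) u1 (- e) e = 0%C).
  { apply (goursat_bounded_singularity p (- e) u1 (- e) e (B * exp (INR k)) u1); try lra.
    - intros x y Hx Hy H0. apply Dp; auto; apply Rabs_le; lra.
    - intros [x y] Hz Hzr. destruct (Rabs_Re_Im_le x y) as [Bx By].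
      assert (Cmod (P (cexp (x, y))) <= B).
      { apply hP; [|apply near_1; lra]. apply cexp_neq_1; [exact Hz|lra]. }
      unfold p. rewrite Cmod_mult, Cmod_kern.
      apply Rmult_le_compat; auto; [apply Cmod_ge_0|left; apply exp_pos|].
      assert (- x <= 1) by (pose proof (Rle_abs (- x)) as Hx; rewrite Rabs_Ropp in Hx; lra).
      apply exp_le_exp. nra. }
  assert (Hper : HI g (2 * PI - e) (- e) u1 = HI g (- e) (- e) u1).
  { unfold HI. apply CI_ext; [lra|]. intros t _.
    replace (2 * PI - e) with (- e + 2 * PI) by ring. apply Pg. }
  assert (Hr1 : forall t, - e <= t <= u1 -> rcont (fun t => g (t, e)) t).
  { intros t Ht. apply ccont_horizontal, Cg; [lra|left; lra]. }
  (* The height -e lies outside ]0, 2 pi[, where differentiability of g past the unit circle is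
     known, so continuity is imported from one period higher. *)
  assert (Hr2 : forall t, - e <= t <= u1 -> rcont (fun t => g (t, - e)) t).
  { intros t Ht. apply ccont_horizontal.
    apply (ccont_ext_loc (fun w => g (w + (0, 2 * PI)%R)%C) _ _ 1); [lra| |].
    - intros [x y] _. replace ((x, y) + (0, 2 * PI)%R)%C with ((x, y + 2 * PI) : C); [apply Pg|].
      unfold Cplus; simpl. apply Cpair_eq; ring.
    - apply (ccont_comp g (fun w => w + (0, 2 * PI)%R)%C).
      + replace ((t, - e)%R + (0, 2 * PI)%R)%C with ((t, - e + 2 * PI) : C)
          by (unfold Cplus; simpl; apply Cpair_eq; ring).
        apply Cg; [lra|left; lra].
      + apply ccont_plus; [apply ccont_id|apply ccont_const]. }
  unfold VI at 1. rewrite (CI_Chasles (fun t => g (- e, t)) (- e) e (- e + 2 * PI)); try lra.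
  2: { intros t _. apply ccont_vertical, Cg; [lra|right; lra]. }
  replace (- e + 2 * PI) with (2 * PI - e) by ring.
  unfold VI at 1, HI at 1 2.
  rewrite (CI_minus (fun t => g (- e, t)) (fun t => p (- e, t))); try lra.
  2: { intros t _. apply ccont_vertical, Cg; [lra|right; lra]. }
  2: { intros t Ht. apply ccont_vertical, Cp; [apply Rabs_le; lra|apply Rabs_le; lra|apply pair_neq_0; lra]. }
  rewrite (CI_minus (fun t => g (t, e)) (fun t => p (t, e))); try lra; auto.
  2: { intros t Ht. apply ccont_horizontal, Cp; [apply Rabs_le; lra|apply Rabs_le; lra|apply pair_neq_0; lra]. }
  rewrite (CI_minus (fun t => g (t, - e)) (fun t => p (t, - e))); try lra; auto.
  2: { intros t Ht. apply ccont_horizontal, Cp; [apply Rabs_le; lra|apply Rabs_le; lra|apply pair_neq_0; lra]. }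
  unfold rect_int in G1, G2. rewrite Hper in G1. unfold HI, VI in *.
  set (a1 := CI (fun t => g (- e, t)) (- e) e) in *.
  set (a2 := CI (fun t => g (- e, t)) e (2 * PI - e)) in *.
  set (a3 := CI (fun t => g (t, e)) (- e) u1) in *.
  set (a4 := CI (fun t => g (t, - e)) (- e) u1) in *.
  set (a5 := CI (fun t => g (u1, t)) e (2 * PI - e)) in *.
  set (b1 := CI (fun t => p (- e, t)) (- e) e) in *.
  set (b3 := CI (fun t => p (t, e)) (- e) u1) in *.
  set (b4 := CI (fun t => p (t, - e)) (- e) u1) in *.
  set (b5 := CI (fun t => p (u1, t)) (- e) e) in *.
  (* Adding the two vanishing rectangle integrals cancels the long inner segment [a2] and pairs each
     side next to the cut for g with the same side for p. *)
  transitivity (Ci * (a1 + a2) + (a3 + Ci * a5 - a4 - Ci * a2) + (b4 + Ci * b5 - b3 - Ci * b1))%C;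
    [rewrite G1, G2|]; ring.
Qed.

Lemma transfer_aux :
  exists K, forall k : nat, (1 <= k)%nat -> / INR k <= u1 ->
    Cmod (coef F k (- / INR k) (- / INR k)) <= K * / INR k ^ M.
Proof.
  destruct outer_arc_bound as [B1 [HB1 Hout]].
  (* With e = 1/k, |z - 1| <= 6 e (k x + 3) next to the cut, and (k x + 3)^M <= M^M exp (k x + 3).
     The kernel exp (-k x) cancels the growth in x and leaves exp 3. [K2] comes from exp (-k u1) <=
     M^M / (k u1)^M. *)
  set (K1 := C0 * 6 ^ M * INR M ^ M * exp 3).
  set (K2 := INR M ^ M * / u1 ^ M).
  (* The three pieces next to the cut have length at most 2 each; 8 bounds the length of the outer
     arc, which is below 2 pi, and 2 that of the short segment for p. The prefactor 1 / (2 pi) is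
     estimated by 1. *)
  exists (6 * K1 + (8 * B1 + 2 * B) * K2).
  intros k Hk Hku. pose proof PI2_1. pose proof PI_4.
  pose proof (transfer_deformation k Hku Hk) as E. cbv zeta in E.
  assert (Hkp : 0 < INR k) by (apply lt_0_INR; lia).
  set (e := / INR k) in *.
  assert (He : 0 < e) by (apply Rinv_0_lt_compat; auto).
  set (g := fun w => (F (cexp w) * kern k w)%C) in *.
  set (p := fun w => (P (cexp w) * kern k w)%C) in *.
  assert (HeM : 0 < e ^ M) by now apply pow_lt.
  assert (HeM' : / INR k ^ M = e ^ M) by (unfold e; now rewrite pow_inv).
  rewrite HeM'.
  assert (Hpm : 0 <= INR M ^ M) by (apply pow_le, pos_INR).
  assert (Hdiff : forall x y, - e <= x <= u1 -> Rabs y <= e -> dom0 r (cexp (x, y)) ->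
            Cmod (g (x, y) - p (x, y)) <= K1 * e ^ M).
  { intros x y Hx Hy Hd. unfold g, p.
    replace (F (cexp (x, y)) * kern k (x, y) - P (cexp (x, y)) * kern k (x, y))%C
      with ((F (cexp (x, y)) - P (cexp (x, y))) * kern k (x, y))%C by ring.
    rewrite Cmod_mult, Cmod_kern.
    assert (Hxa : Rabs x <= u1) by (apply Rabs_le; lra).
    assert (Hxb : Rabs x <= x + 2 * e) by (apply Rabs_le; lra).
    pose proof (hFP _ Hd (near_1 x y Hxa ltac:(lra))) as Hf.
    pose proof (Cmod_cexp_sub1 x y ltac:(lra)) as Hs.
    assert (Hs2 : Cmod (cexp (x, y) - 1) <= 6 * e * (INR k * x + 3)).
    { eapply Rle_trans; [apply Hs|].
      replace (6 * e * (INR k * x + 3)) with (6 * (x + 3 * e)) by (unfold e; field; lra). lra. }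
    assert (Hy0 : 0 <= INR k * x + 3).
    { assert (- 1 <= INR k * x); [|lra].
      replace (-1) with (INR k * - e) by (unfold e; field; lra).
      apply Rmult_le_compat_l; lra. }
    assert (Hs3 : Cmod (cexp (x, y) - 1) ^ M <= 6 ^ M * e ^ M * (INR M ^ M * exp (INR k * x + 3))).
    { eapply Rle_trans; [apply pow_incr; split; [apply Cmod_ge_0|apply Hs2]|].
      rewrite !Rpow_mult_distr. apply Rmult_le_compat_l.
      - apply Rmult_le_pos; [apply pow_le; lra|lra].
      - now apply pow_le_exp. }
    eapply Rle_trans.
    - apply Rmult_le_compat_r; [left; apply exp_pos|].
      eapply Rle_trans; [apply Hf|]. apply Rmult_le_compat_l; [auto|apply Hs3].
    - right. unfold K1.
      transitivity (C0 * 6 ^ M * e ^ M * INR M ^ M * (exp (INR k * x + 3) * exp (- (INR k * x)))); [ring|].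
      rewrite <- exp_plus. replace (INR k * x + 3 + - (INR k * x)) with 3 by ring. ring. }
  assert (Hexp : exp (- (INR k * u1)) <= K2 * e ^ M).
  { assert (Hp : 0 < (INR k * u1) ^ M) by (apply pow_lt, Rmult_lt_0_compat; lra).
    pose proof (pow_le_exp M (INR k * u1) hM ltac:(apply Rmult_le_pos; lra)) as Hl.
    rewrite exp_Ropp. pose proof (exp_pos (INR k * u1)) as Hep.
    apply (Rmult_le_reg_l (exp (INR k * u1))); [auto|]. rewrite Rinv_r by lra.
    apply (Rmult_le_reg_l ((INR k * u1) ^ M)); [auto|].
    replace ((INR k * u1) ^ M * (exp (INR k * u1) * (K2 * e ^ M))) with (INR M ^ M * exp (INR k * u1)).
    - lra.
    - unfold K2, e. rewrite Rpow_mult_distr, pow_inv. field.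
      split; apply pow_nonzero; lra. }
  assert (Dg : forall x y, x <= u1 -> 0 < y < 2 * PI \/ x < 0 -> dom0 r (cexp (x, y))).
  { intros x y Hx [Hy|Hx0].
    - apply dom0_cexp; auto.
    - apply dom0_disc; auto. now apply Cmod_cexp_lt_1. }
  assert (Dm : forall x, dom0 r (cexp (x, - e)) <-> dom0 r (cexp (x, 2 * PI - e))).
  { intros x. replace (2 * PI - e) with (- e + 2 * PI) by ring. now rewrite cexp_period. }
  assert (Cgp : forall x y, - e <= x <= u1 -> Rabs y <= e -> (x, y) <> (0, 0) -> dom0 r (cexp (x, y)) ->
            ccont (fun w => g w - p w)%C (x, y)).
  { intros x y Hx Hy Hxy Hd. apply ccont_minus; apply ccont_pullback.
    - destruct (hF _ Hd) as [l Hl]. eapply cder_ccont, Hl.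
    - destruct (hP (cexp (x, y))) as [[l Hl] _].
      + apply cexp_neq_1; auto. lra.
      + apply near_1; [apply Rabs_le|]; lra.
      + eapply cder_ccont, Hl. }
  assert (Ra : Rabs e <= e) by (rewrite Rabs_pos_eq; lra).
  assert (Rb : Rabs (- e) <= e) by (rewrite Rabs_Ropp, Rabs_pos_eq; lra).
  assert (HK1 : 0 <= K1).
  { unfold K1. repeat apply Rmult_le_pos; auto; [apply pow_le; lra|left; apply exp_pos]. }
  assert (HK1e : 0 <= K1 * e ^ M) by (apply Rmult_le_pos; lra).
  assert (T1 : Cmod (VI (fun w => g w - p w)%C (- e) (- e) e) <= 2 * (K1 * e ^ M)).
  { eapply Rle_trans.
    - unfold VI. apply (CI_bound _ (- e) e (K1 * e ^ M)); [lra| |].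
      + intros t Ht. apply (ccont_vertical (fun w => g w - p w)%C). apply Cgp; try lra.
        * apply Rabs_le; lra. * apply pair_neq_0; lra. * apply Dg; lra.
      + intros t Ht. apply Hdiff; [lra|apply Rabs_le; lra|apply Dg; lra].
    - apply Rmult_le_compat_r; lra. }
  assert (T2 : Cmod (HI (fun w => g w - p w)%C e (- e) u1) <= 2 * (K1 * e ^ M)).
  { eapply Rle_trans.
    - unfold HI. apply (CI_bound _ (- e) u1 (K1 * e ^ M)); [lra| |].
      + intros t Ht. apply (ccont_horizontal (fun w => g w - p w)%C).
        apply Cgp; auto; [apply pair_neq_0; lra|apply Dg; lra].
      + intros t Ht. apply Hdiff; [lra|auto|apply Dg; lra].
    - apply Rmult_le_compat_r; lra. }
  assert (T3 : Cmod (HI (fun w => g w - p w)%C (- e) (- e) u1) <= 2 * (K1 * e ^ M)).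
  { eapply Rle_trans.
    - unfold HI. apply (CI_bound _ (- e) u1 (K1 * e ^ M)); [lra| |].
      + intros t Ht. apply (ccont_horizontal (fun w => g w - p w)%C).
        apply Cgp; auto; [apply pair_neq_0; lra|apply Dm, Dg; lra].
      + intros t Ht. apply Hdiff; [lra|auto|apply Dm, Dg; lra].
    - apply Rmult_le_compat_r; lra. }
  assert (HK2 : 0 <= K2 * e ^ M) by (pose proof (exp_pos (- (INR k * u1))); lra).
  assert (T4 : Cmod (VI g u1 e (2 * PI - e)) <= 8 * (B1 * (K2 * e ^ M))).
  { eapply Rle_trans.
    - unfold VI. apply (CI_bound _ e (2 * PI - e) (B1 * (K2 * e ^ M))); [lra| |].
      + intros t Ht. apply (ccont_vertical g). apply ccont_pullback.
        destruct (hF (cexp (u1, t))) as [l Hl]; [apply Dg; lra|]. eapply cder_ccont, Hl.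
      + intros t Ht. unfold g. rewrite Cmod_mult, Cmod_kern.
        apply Rmult_le_compat; auto; [apply Cmod_ge_0|left; apply exp_pos|apply Hout; lra].
    - apply Rmult_le_compat_r; [|lra]. apply Rmult_le_pos; lra. }
  assert (T5 : Cmod (VI p u1 (- e) e) <= 2 * (B * (K2 * e ^ M))).
  { eapply Rle_trans.
    - assert (Hp1 : forall t, - e <= t <= e -> (exists l, cder P (cexp (u1, t)) l) /\ Cmod (P (cexp (u1, t))) <= B).
      { intros t Ht. apply hP.
        - apply cexp_neq_1; [apply pair_neq_0; lra|]. assert (Rabs t <= e) by (apply Rabs_le; lra). lra.
        - apply near_1; apply Rabs_le; lra. }
      unfold VI. apply (CI_bound _ (- e) e (B * (K2 * e ^ M))); [lra| |].
      + intros t Ht. apply (ccont_vertical p). apply ccont_pullback.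
        destruct (Hp1 t Ht) as [[l Hl] _]. eapply cder_ccont, Hl.
      + intros t Ht. unfold p. rewrite Cmod_mult, Cmod_kern.
        apply Rmult_le_compat; auto; [apply Cmod_ge_0|left; apply exp_pos|apply Hp1; auto].
    - apply Rmult_le_compat_r; [|lra]. apply Rmult_le_pos; lra. }
  assert (T : Cmod (Ci * VI g (- e) (- e) (- e + 2 * PI)) <= (6 * K1 + (8 * B1 + 2 * B) * K2) * e ^ M).
  { rewrite E.
    eapply Rle_trans; [apply Cmod_triangle|].
    eapply Rle_trans; [apply Rplus_le_compat_r, Cmod_triangle|].
    eapply Rle_trans; [apply Rplus_le_compat_r, Rplus_le_compat_r, Cmod_sub_le|].
    eapply Rle_trans; [apply Rplus_le_compat_r, Rplus_le_compat_r, Rplus_le_compat_r, Cmod_triangle|].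
    rewrite !Cmod_mult, Cmod_Ci. lra. }
  rewrite Cmod_mult, Cmod_Ci, Rmult_1_l in T.
  unfold coef. fold g. rewrite Cmod_mult, Cmod_inv by apply two_PI_neq_0.
  rewrite Cmod_R, Rabs_pos_eq by lra.
  eapply Rle_trans; [|apply T].
  rewrite <- (Rmult_1_l (Cmod (VI g (- e) (- e) (- e + 2 * PI)))) at 2.
  apply Rmult_le_compat_r; [apply Cmod_ge_0|].
  rewrite <- Rinv_1. apply Rinv_le_contravar; lra.
Qed.

End Transfer.

Theorem transfer (r : Rbar) (F P : C -> C) (M : nat) (eta C0 B : R) :
  Rbar_lt 1 r -> (1 <= M)%nat ->
  (forall z, dom0 r z -> exists l, cder F z l) ->
  0 < eta -> 0 <= C0 -> 0 <= B ->
  (forall z : C, z <> 1%C -> Cmod (z - 1) < eta -> (exists l, cder P z l) /\ Cmod (P z) <= B) ->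
  (forall z, dom0 r z -> Cmod (z - 1) < eta -> Cmod (F z - P z) <= C0 * Cmod (z - 1) ^ M) ->
  exists K k0, forall k : nat, (k0 <= k)%nat -> (1 <= k)%nat /\
    Cmod (coef F k (- / INR k) (- / INR k)) <= K * / INR k ^ M.
Proof.
  intros hr hM hF heta hC0 hB hP hFP.
  destruct (Rbar_exp_room r eta hr heta) as [u1 [H1 [H2 H3]]].
  destruct (transfer_aux r F P M eta C0 B hr hM hF heta hC0 hB hP hFP u1 H1 H2 H3) as [K HK].
  destruct (archimed_cor1 u1 ltac:(lra)) as [N [HN HN0]].
  exists K, N. intros k Hk. split; [lia|]. apply HK; [lia|].
  apply Rle_trans with (/ INR N); [|lra].
  apply Rinv_le_contravar; [apply lt_0_INR; lia|apply le_INR; lia].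
Qed.

(** * Gauss' limit for the Gamma function *)

Lemma clim_unique (u : nat -> C) (l m : C) : clim u l -> clim u m -> l = m.
Proof.
  intros H1 H2. apply Cminus_eq_0, Cmod_eq_0. apply Rle_antisym; [|apply Cmod_ge_0].
  apply le_epsilon. intros eps He. rewrite Rplus_0_l.
  destruct (H1 (eps / 2) ltac:(lra)) as [n1 N1]. destruct (H2 (eps / 2) ltac:(lra)) as [n2 N2].
  specialize (N1 (n1 + n2)%nat ltac:(lia)). specialize (N2 (n1 + n2)%nat ltac:(lia)).
  replace (l - m)%C with ((u (n1 + n2)%nat - m) - (u (n1 + n2)%nat - l))%C by ring.
  eapply Rle_trans; [apply Cmod_sub_le|]. lra.
Qed.

Lemma Clim_eq (u : nat -> C) (l : C) : clim u l -> Clim u = l.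
Proof.
  intros H. unfold Clim. destruct excluded_middle_informative as [He|Hn].
  - destruct (constructive_indefinite_description _ He) as [m Hm]. simpl.
    apply (clim_unique u); [now apply filterlim_clim|exact H].
  - exfalso. apply Hn. exists l. now apply filterlim_clim.
Qed.

Lemma clim_cauchy (u : nat -> C) :
  (forall eps, 0 < eps -> exists N, forall n, (N <= n)%nat -> Cmod (u n - u N) <= eps) ->
  exists l, clim u l.
Proof.
  intros H.
  assert (HR : forall p : C -> R, (forall z w : C, Rabs (p z - p w) <= Cmod (z - w)%C) ->
             exists l, Un_cv (fun n => p (u n)) l).
  { intros p Hp. destruct (Rcomplete.R_complete (fun n => p (u n))) as [l Hl]; [|now exists l].
    intros eps He. destruct (H (eps / 3) ltac:(lra)) as [N HN]. exists N. intros n m Hn Hm.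
    unfold Rdist. eapply Rle_lt_trans; [apply Hp|].
    replace (u n - u m)%C with ((u n - u N) - (u m - u N))%C by ring.
    eapply Rle_lt_trans; [apply Cmod_sub_le|].
    pose proof (HN n ltac:(lia)). pose proof (HN m ltac:(lia)). lra. }
  destruct (HR Re) as [x Hx].
  { intros z w. apply (re_le_Cmod (z - w)). }
  destruct (HR Im) as [y Hy].
  { intros [z1 z2] [w1 w2]. destruct (Rabs_Re_Im_le (z1 - w1) (z2 - w2)) as [_ A]. exact A. }
  exists (x, y). intros eps He.
  destruct (Hx (eps / 2) ltac:(lra)) as [n1 N1]. destruct (Hy (eps / 2) ltac:(lra)) as [n2 N2].
  exists (n1 + n2)%nat. intros n Hn. specialize (N1 n ltac:(lia)). specialize (N2 n ltac:(lia)).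
  unfold Rdist in *. destruct (u n) as [a b]. simpl in *.
  eapply Rle_lt_trans; [apply (Cmod_le_abs (a - x) (b - y))|]. lra.
Qed.

Lemma clim_mult (u v : nat -> C) (l m : C) :
  clim u l -> clim v m -> clim (fun n => u n * v n)%C (l * m).
Proof.
  intros Hu Hv eps He.
  set (A := Cmod l). set (D := Cmod m).
  assert (HA : 0 <= A) by apply Cmod_ge_0. assert (HD : 0 <= D) by apply Cmod_ge_0.
  set (e := Rmin 1 (eps / (A + D + 1))).
  assert (He' : 0 < e) by (apply Rmin_glb_lt; [lra|apply Rdiv_lt_0_compat; lra]).
  destruct (Hu e He') as [n1 N1]. destruct (Hv e He') as [n2 N2].
  exists (n1 + n2)%nat. intros n Hn. specialize (N1 n ltac:(lia)). specialize (N2 n ltac:(lia)).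
  replace (u n * v n - l * m)%C with
    ((u n - l) * (v n - m) + (l * (v n - m) + m * (u n - l)))%C by ring.
  eapply Rle_lt_trans; [apply Cmod_triangle|].
  eapply Rle_lt_trans; [apply Rplus_le_compat_l, Cmod_triangle|].
  rewrite !Cmod_mult. fold A D.
  pose proof (Cmod_ge_0 (u n - l)). pose proof (Cmod_ge_0 (v n - m)).
  assert (He1 : e <= 1) by apply Rmin_l.
  assert (He2 : e * (A + D + 1) <= eps).
  { replace eps with (eps / (A + D + 1) * (A + D + 1)) by (field; lra).
    apply Rmult_le_compat_r; [lra|apply Rmin_r]. }
  set (x := Cmod (u n - l)) in *. set (y := Cmod (v n - m)) in *. nra.
Qed.

Lemma clim_const (c : C) : clim (fun _ => c) c.
Proof. intros eps He. exists O. intros. rewrite Cmod_sub_self. exact He. Qed.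

Lemma clim_ext_eventually (u v : nat -> C) (l : C) (N : nat) :
  (forall n, (N <= n)%nat -> u n = v n) -> clim u l -> clim v l.
Proof.
  intros E H eps He. destruct (H eps He) as [n0 Hn0]. exists (N + n0)%nat.
  intros n Hn. rewrite <- E by lia. apply Hn0. lia.
Qed.

(* Taylor's formula with integral remainder along the segment [0, w]. *)
Lemma Cmod_cexp_sub1_sub (w : C) : Cmod w <= 1 -> Cmod (cexp w - 1 - w) <= 3 * (Cmod w * Cmod w).
Proof.
  intros Hw.
  set (G := fun s => ((1 - s) * (w * cexp (s * w)) + cexp (s * w))%C).
  set (g := fun s => ((1 - s) * (w * w * cexp (s * w)))%C).
  assert (De : forall s, cder (fun s => cexp (s * w)) s (cexp (s * w) * (1 * w + s * 0))).
  { intros s. apply (cder_comp cexp (fun s => s * w)%C); [apply cder_cexp|].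
    apply (cder_mult (fun s => s) (fun _ => w)); [apply cder_id|apply cder_const]. }
  assert (D1 : forall s, cder (fun s => 1 - s)%C s (0 - 1)).
  { intros s. apply cder_minus; [apply cder_const|apply cder_id]. }
  assert (DG : forall s, cder G s (g s)).
  { intros s. unfold G, g.
    pose proof (cder_plus _ _ _ _ _ (cder_mult _ _ _ _ _ (D1 s) (cder_scal w _ _ _ (De s))) (De s)) as D.
    cbv beta in D.
    match type of D with cder _ _ ?b => replace b with ((1 - s) * (w * w * cexp (s * w)))%C in D by ring end.
    exact D. }
  assert (Cg : forall s, ccont g s).
  { intros s. unfold g. apply ccont_mult; [eapply cder_ccont, D1|].
    apply ccont_mult; [apply ccont_const|eapply cder_ccont, De]. }
  assert (E : CI (fun t => g (t, 0)) 0 1 = (cexp w - 1 - w)%C).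
  { rewrite (CI_FTC (fun t => G (t, 0))); [|lra| |].
    - unfold G. change ((1, 0) : C) with (RtoC 1). change ((0, 0) : C) with (RtoC 0).
      replace (1 * w)%C with w by ring. replace (0 * w)%C with (RtoC 0) by ring.
      rewrite cexp_0. ring.
    - intros t _. now apply cder_horizontal.
    - intros t _. now apply ccont_horizontal. }
  rewrite <- E.
  replace (3 * (Cmod w * Cmod w)) with ((1 - 0) * (3 * (Cmod w * Cmod w))) by ring.
  apply CI_bound; [lra|intros t _; now apply ccont_horizontal|].
  intros t Ht. unfold g. change ((t, 0) : C) with (RtoC t).
  rewrite <- RtoC_minus, !Cmod_mult, Cmod_R, Rabs_pos_eq, Cmod_cexp by lra.
  assert (Hre : Re (t * w) <= 1).
  { pose proof (re_le_Cmod (t * w)) as A. pose proof (Rle_abs (Re (t * w))).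
    rewrite Cmod_mult, Cmod_R in A. rewrite (Rabs_pos_eq t) in A by lra. pose proof (Cmod_ge_0 w). nra. }
  assert (exp (Re (t * w)) <= 3).
  { eapply Rle_trans; [apply exp_le_exp, Hre|apply exp_le_3]. }
  pose proof (exp_pos (Re (t * w))). pose proof (Cmod_ge_0 w).
  assert (0 <= Cmod w * Cmod w) by (apply Rmult_le_pos; lra).
  set (x := Cmod w * Cmod w) in *. set (y := exp (Re (t * w))) in *.
  assert (0 <= x * y) by (apply Rmult_le_pos; lra). assert (x * y <= x * 3) by (apply Rmult_le_compat_l; lra).
  nra.
Qed.

Definition nonpole (z : C) : Prop := forall n : nat, (z + RtoC (INR n))%C <> 0%C.

Definition gauss (z : C) (n : nat) : C :=
  (RtoC (INR (fact n)) * cpow (RtoC (INR n)) z / cpoch z n)%C.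

Lemma cpoch_neq_0 (z : C) (n : nat) : nonpole z -> cpoch z n <> 0%C.
Proof.
  intros H. induction n as [|n IH]; simpl cpoch.
  - specialize (H O). simpl in H. intros E. apply H. rewrite E. ring.
  - apply Cmult_neq_0; [exact IH|exact (H (S n))].
Qed.

Lemma cpow_pos_real (x : R) (z : C) : 0 < x -> cpow (RtoC x) z = cexp (z * RtoC (ln x)).
Proof.
  intros Hx. rewrite cpow_cexp by (intros E; apply RtoC_inj in E; lra).
  f_equal. f_equal. unfold clog. rewrite Cmod_R, Rabs_pos_eq by lra.
  unfold RtoC at 1. rewrite carg_right by lra. replace (0 / x) with 0 by (field; lra).
  now rewrite atan_0.
Qed.

Lemma gauss_neq_0 (z : C) (n : nat) : nonpole z -> (1 <= n)%nat -> gauss z n <> 0%C.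
Proof.
  intros H Hn. unfold gauss, Cdiv. apply Cmult_neq_0.
  - apply Cmult_neq_0.
    + apply RtoC_neq_0, INR_fact_neq_0.
    + rewrite cpow_pos_real by (apply lt_0_INR; lia). apply cexp_neq_0.
  - pose proof (cpoch_neq_0 z n H) as Hp. intros E.
    assert (cpoch z n * / cpoch z n = 1)%C as E1 by (field; auto).
    rewrite E in E1. replace (cpoch z n * 0)%C with (RtoC 0) in E1 by ring.
    apply RtoC_inj in E1. lra.
Qed.

Definition gauss_ratio (z : C) (n : nat) : C :=
  (cexp (z * RtoC (ln (INR (S n)) - ln (INR n))) * RtoC (INR (S n)) / (z + RtoC (INR (S n))))%C.

Lemma gauss_S (z : C) (n : nat) : nonpole z -> (1 <= n)%nat ->
  gauss z (S n) = (gauss z n * gauss_ratio z n)%C.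
Proof.
  intros H Hn. unfold gauss, gauss_ratio.
  rewrite !cpow_pos_real by (apply lt_0_INR; lia).
  replace (z * RtoC (ln (INR (S n))))%C
    with (z * RtoC (ln (INR n)) + z * RtoC (ln (INR (S n)) - ln (INR n)))%C
    by (rewrite RtoC_minus; ring).
  rewrite cexp_plus. change (fact (S n)) with (S n * fact n)%nat. rewrite mult_INR, RtoC_mult.
  cbn [cpoch]. pose proof (cpoch_neq_0 z n H). pose proof (H (S n)). field. auto.
Qed.

Lemma ln_succ_bounds (n : nat) : (1 <= n)%nat ->
  / INR (S n) <= ln (INR (S n)) - ln (INR n) <= / INR n.
Proof.
  intros Hn. assert (0 < INR n) by (apply lt_0_INR; lia).
  assert (0 < INR (S n)) by (apply lt_0_INR; lia).
  assert (E : forall x, 0 < x -> ln x <= x - 1).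
  { intros x Hx. pose proof (exp_ineq1_le (ln x)). rewrite exp_ln in H1 by auto. lra. }
  split.
  - pose proof (E (INR n / INR (S n)) ltac:(apply Rdiv_lt_0_compat; auto)) as H1.
    rewrite ln_div in H1 by auto.
    replace (INR n / INR (S n) - 1) with (- / INR (S n)) in H1 by (rewrite S_INR in *; field; lra). lra.
  - pose proof (E (INR (S n) / INR n) ltac:(apply Rdiv_lt_0_compat; auto)) as H1.
    rewrite ln_div in H1 by auto.
    replace (INR (S n) / INR n - 1) with (/ INR n) in H1 by (rewrite S_INR in *; field; lra). lra.
Qed.

(** With L = log (n+1) - log n, the ratio minus 1 has numerator (n+1)(exp (z L) - 1 - z L) + z
    ((n+1) L - 1). The first-order terms have cancelled, so it is O(1/n); the denominator z + n + 1
    supplies another 1/n, and the product converges. *)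
Lemma gauss_ratio_bound (z : C) : nonpole z ->
  exists K N, 0 < K /\ (2 <= N)%nat /\ forall n, (N <= n)%nat ->
    Cmod (gauss_ratio z n - 1) <= K / (INR n * INR n).
Proof.
  intros H. set (A := Cmod z). assert (HA : 0 <= A) by apply Cmod_ge_0.
  (* Numerator at most (6 A^2 + A) / n over a denominator of modulus at least n / 2; the final 1
     keeps the constant positive. The threshold n > 2 A + 2 secures that denominator and |z L| <=
     1. *)
  exists (12 * A * A + 2 * A + 1).
  destruct (archimed_cor1 (/ (2 * A + 2)) ltac:(apply Rinv_0_lt_compat; lra)) as [N0 [HN0 HN0']].
  assert (HN1 : 2 * A + 2 < INR N0).
  { apply Rinv_lt_cancel in HN0; [exact HN0|]. apply lt_0_INR; lia. }
  exists (N0 + 2)%nat. split; [nra|]. split; [lia|]. intros n Hn.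
  assert (Hnn : INR N0 <= INR n) by (apply le_INR; lia).
  assert (Hn0 : 0 < INR n) by lra.
  pose proof (ln_succ_bounds n ltac:(lia)) as [L1 L2].
  set (L := ln (INR (S n)) - ln (INR n)) in *.
  assert (HS : INR (S n) = INR n + 1) by apply S_INR.
  assert (HL0 : 0 <= L).
  { eapply Rle_trans; [|apply L1]. left. apply Rinv_0_lt_compat. lra. }
  unfold gauss_ratio. fold L. pose proof (H (S n)) as HSn.
  replace (cexp (z * RtoC L) * RtoC (INR (S n)) / (z + RtoC (INR (S n))) - 1)%C
    with ((RtoC (INR (S n)) * (cexp (z * RtoC L) - 1 - z * RtoC L)
           + z * RtoC (INR (S n) * L - 1)) / (z + RtoC (INR (S n))))%C.
  2: { rewrite RtoC_minus, RtoC_mult. field. exact HSn. }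
  rewrite Cmod_div by exact HSn.
  assert (Hden : INR n / 2 <= Cmod (z + RtoC (INR (S n)))).
  { pose proof (Cmod_sub_le (z + RtoC (INR (S n))) z) as T.
    replace (z + RtoC (INR (S n)) - z)%C with (RtoC (INR (S n))) in T by ring.
    rewrite Cmod_R, Rabs_pos_eq in T by lra. fold A in T. lra. }
  assert (Hz : Cmod (z * RtoC L) <= A / INR n).
  { rewrite Cmod_mult, Cmod_R, Rabs_pos_eq by lra. fold A. unfold Rdiv.
    apply Rmult_le_compat_l; auto. }
  assert (Hz1 : A / INR n <= 1) by (apply Rle_div_l; lra).
  pose proof (Cmod_cexp_sub1_sub (z * RtoC L) ltac:(lra)) as T1.
  assert (T2 : Cmod (z * RtoC L) * Cmod (z * RtoC L) <= A / INR n * (A / INR n)).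
  { apply Rmult_le_compat; auto; apply Cmod_ge_0. }
  assert (T3 : Rabs (INR (S n) * L - 1) <= / INR n).
  { apply Rabs_le. apply (Rmult_le_compat_l (INR (S n))) in L1, L2; try lra.
    rewrite Rinv_r in L1 by lra.
    replace (INR (S n) * / INR n) with (1 + / INR n) in L2 by (rewrite HS; field; lra).
    assert (0 < / INR n) by now apply Rinv_0_lt_compat. lra. }
  assert (Hnum : Cmod (RtoC (INR (S n)) * (cexp (z * RtoC L) - 1 - z * RtoC L)
                   + z * RtoC (INR (S n) * L - 1)) <= (6 * A * A + A) / INR n).
  { eapply Rle_trans; [apply Cmod_triangle|]. rewrite !Cmod_mult, !Cmod_R.
    rewrite (Rabs_pos_eq (INR (S n))) by lra. fold A.
    assert (INR (S n) * Cmod (cexp (z * RtoC L) - 1 - z * RtoC L)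
            <= (2 * INR n) * (3 * (A / INR n * (A / INR n)))).
    { apply Rmult_le_compat; [lra|apply Cmod_ge_0| |lra].
      assert (1 <= INR n) by (replace 1 with (INR 1) by reflexivity; apply le_INR; lia). lra. }
    assert (A * Rabs (INR (S n) * L - 1) <= A * / INR n) by (apply Rmult_le_compat_l; auto).
    replace ((6 * A * A + A) / INR n)
      with (2 * INR n * (3 * (A / INR n * (A / INR n))) + A * / INR n) by (field; lra).
    lra. }
  apply Rle_div_l; [lra|].
  eapply Rle_trans; [apply Hnum|].
  apply Rle_trans with ((12 * A * A + 2 * A + 1) / (INR n * INR n) * (INR n / 2)).
  - replace ((12 * A * A + 2 * A + 1) / (INR n * INR n) * (INR n / 2))
      with ((6 * A * A + A + / 2) / INR n) by (field; lra).
    unfold Rdiv. apply Rmult_le_compat_r; [left; now apply Rinv_0_lt_compat|lra].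
  - apply Rmult_le_compat_l; [|exact Hden].
    apply Rdiv_le_0_compat; [nra|]. now apply Rmult_lt_0_compat.
Qed.

(** Each factor costs at most exp (K / n^2), and 1 / n^2 <= 1 / (n-1) - 1 / n telescopes in the
    exponent. This is why [pred] appears and N is at least 2. *)
Lemma product_drift (a q : nat -> C) (K : R) (N : nat) : 0 < K -> (2 <= N)%nat ->
  (forall n, (N <= n)%nat -> a (S n) = a n * q n)%C ->
  (forall n, (N <= n)%nat -> Cmod (q n - 1) <= K / (INR n * INR n)) ->
  forall m, Cmod (a (N + m)%nat - a N)
    <= Cmod (a N) * (exp (K * (/ INR (pred N) - / INR (pred (N + m)))) - 1).
Proof.
  intros HK HN Ha Hq. induction m as [|m IH].
  - rewrite Nat.add_0_r, Cmod_sub_self.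
    replace (/ INR (pred N) - / INR (pred N)) with 0 by ring. rewrite Rmult_0_r, exp_0. lra.
  - rewrite Nat.add_succ_r, Ha by lia. set (n := (N + m)%nat) in *.
    assert (Hp : INR n = INR (pred n) + 1).
    { rewrite <- S_INR. f_equal. unfold n. lia. }
    assert (Hp0 : 0 < INR (pred n)) by (apply lt_0_INR; unfold n; lia).
    specialize (Hq n ltac:(unfold n; lia)).
    set (E := exp (K * (/ INR (pred N) - / INR (pred n)))) in *.
    assert (HE : E * exp (K / (INR n * INR n)) <= exp (K * (/ INR (pred N) - / INR (pred (S n))))).
    { unfold E. rewrite <- exp_plus. apply exp_le_exp. simpl pred.
      assert (/ (INR n * INR n) <= / INR (pred n) - / INR n); [|unfold Rdiv; nra].
      replace (/ INR (pred n) - / INR n) with (/ (INR (pred n) * INR n)) by (rewrite Hp; field; lra).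
      apply Rinv_le_contravar; [apply Rmult_lt_0_compat; lra|]. apply Rmult_le_compat_r; lra. }
    pose proof (exp_ineq1_le (K / (INR n * INR n))) as He.
    assert (HE0 : 0 < E) by apply exp_pos.
    assert (Han : Cmod (a n) <= Cmod (a N) * E).
    { replace (a n) with ((a n - a N) + a N)%C by ring.
      eapply Rle_trans; [apply Cmod_triangle|]. lra. }
    replace (a n * q n - a N)%C with ((a n - a N) + a n * (q n - 1))%C by ring.
    eapply Rle_trans; [apply Cmod_triangle|]. rewrite Cmod_mult.
    assert (Cmod (a n) * Cmod (q n - 1) <= Cmod (a N) * E * (K / (INR n * INR n))).
    { apply Rmult_le_compat; auto; apply Cmod_ge_0. }
    assert (Hfin : E * (1 + K / (INR n * INR n)) <= exp (K * (/ INR (pred N) - / INR (pred (S n))))).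
    { eapply Rle_trans; [|apply HE]. apply Rmult_le_compat_l; lra. }
    apply (Rmult_le_compat_l (Cmod (a N))) in Hfin; [|apply Cmod_ge_0].
    lra.
Qed.

Lemma product_clim (a q : nat -> C) (K : R) (N : nat) : 0 < K -> (2 <= N)%nat ->
  (forall n, (N <= n)%nat -> a (S n) = a n * q n)%C ->
  (forall n, (N <= n)%nat -> Cmod (q n - 1) <= K / (INR n * INR n)) ->
  (forall n, (N <= n)%nat -> a n <> 0%C) ->
  exists l, clim a l /\ l <> 0%C.
Proof.
  intros HK HN Ha Hq Hnz.
  assert (Hdrift : forall n m, (N <= n)%nat ->
    Cmod (a (n + m)%nat - a n) <= Cmod (a n) * (exp (K * / INR (pred n)) - 1)).
  { intros n m Hn.
    pose proof (product_drift a q K n HK ltac:(lia)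
      (fun j Hj => Ha j ltac:(lia)) (fun j Hj => Hq j ltac:(lia)) m) as D.
    eapply Rle_trans; [apply D|]. apply Rmult_le_compat_l; [apply Cmod_ge_0|].
    assert (0 < / INR (pred (n + m))) by (apply Rinv_0_lt_compat, lt_0_INR; lia).
    assert (K * (/ INR (pred n) - / INR (pred (n + m))) < K * / INR (pred n)) by nra.
    apply exp_increasing in H0. lra. }
  assert (Hsmall : forall eps, 0 < eps -> exists n, (N <= n)%nat /\ exp (K * / INR (pred n)) - 1 <= eps).
  { intros eps He.
    destruct (archimed_cor1 (ln (1 + eps) / K)) as [n0 [Hn0 Hn0']].
    { apply Rdiv_lt_0_compat; auto. rewrite <- ln_1. apply ln_increasing; lra. }
    exists (S (N + n0)). split; [lia|]. simpl pred.
    assert (Hle : / INR (N + n0) <= / INR n0).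
    { apply Rinv_le_contravar; [apply lt_0_INR; lia|apply le_INR; lia]. }
    assert (Hlt : K * / INR (N + n0) < ln (1 + eps)).
    { apply Rle_lt_trans with (K * / INR n0); [apply Rmult_le_compat_l; lra|].
      apply (Rmult_lt_compat_l K) in Hn0; auto.
      replace (K * (ln (1 + eps) / K)) with (ln (1 + eps)) in Hn0 by (field; lra). exact Hn0. }
    apply exp_increasing in Hlt. rewrite exp_ln in Hlt by lra. lra. }
  assert (Hbd : exists A, 0 < A /\ forall n, (N <= n)%nat -> Cmod (a n) <= A).
  { exists (Cmod (a N) * exp (K * / INR (pred N))). split.
    - apply Rmult_lt_0_compat; [apply Cmod_gt_0, Hnz; lia|apply exp_pos].
    - intros n Hn. pose proof (Hdrift N (n - N)%nat (Nat.le_refl N)) as D.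
      replace (N + (n - N))%nat with n in D by lia.
      replace (a n) with ((a n - a N) + a N)%C by ring.
      eapply Rle_trans; [apply Cmod_triangle|]. lra. }
  destruct Hbd as [A [HA HbA]].
  destruct (clim_cauchy a) as [l Hl].
  { intros eps He. destruct (Hsmall (eps / A)) as [n0 [Hn0 Hs]]; [now apply Rdiv_lt_0_compat|].
    exists n0. intros n Hn. pose proof (Hdrift n0 (n - n0)%nat Hn0) as D.
    replace (n0 + (n - n0))%nat with n in D by lia.
    eapply Rle_trans; [apply D|].
    apply Rle_trans with (A * (eps / A)); [|right; field; lra].
    apply Rmult_le_compat; auto; [apply Cmod_ge_0|].
    pose proof (exp_ineq1_le (K * / INR (pred n0))).
    assert (0 < / INR (pred n0)) by (apply Rinv_0_lt_compat, lt_0_INR; lia).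
    assert (0 < K * / INR (pred n0)) by now apply Rmult_lt_0_compat. lra. }
  exists l. split; [exact Hl|]. intros ->.
  (* From n0 on the sequence never moves farther than half of |a n0| from a n0, so it cannot come
     within |a n0| / 4 of zero. *)
  destruct (Hsmall (/ 2) ltac:(lra)) as [n0 [Hn0 Hs]].
  pose proof (proj1 (Cmod_gt_0 _) (Hnz n0 Hn0)) as Hp.
  destruct (Hl (Cmod (a n0) / 4) ltac:(lra)) as [n1 Hn1].
  specialize (Hn1 (n0 + n1)%nat ltac:(lia)). specialize (Hdrift n0 n1 Hn0).
  replace (a (n0 + n1)%nat - 0)%C with (a (n0 + n1)%nat) in Hn1 by ring.
  pose proof (Cmod_sub_le (a (n0 + n1)%nat) (a (n0 + n1)%nat - a n0)) as T.
  replace (a (n0 + n1)%nat - (a (n0 + n1)%nat - a n0))%C with (a n0) in T by ring.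
  nra.
Qed.

Lemma gauss_clim (z : C) : nonpole z -> clim (gauss z) (CGamma z) /\ CGamma z <> 0%C.
Proof.
  intros H. destruct (gauss_ratio_bound z H) as [K [N [HK [HN Hb]]]].
  destruct (product_clim (gauss z) (gauss_ratio z) K N HK HN) as [l [Hl Hl0]].
  - intros n Hn. apply gauss_S; auto; lia.
  - exact Hb.
  - intros n Hn. apply gauss_neq_0; auto; lia.
  - assert (E : CGamma z = l) by (apply Clim_eq; exact Hl). now rewrite E.
Qed.

Lemma nonpole_succ (z : C) : nonpole z -> nonpole (z + 1).
Proof.
  intros H n. replace (z + 1 + RtoC (INR n))%C with (z + RtoC (INR (S n)))%C; [apply H|].
  rewrite S_INR, RtoC_plus. ring.
Qed.

Lemma cpoch_succ (z : C) (n : nat) : (z * cpoch (z + 1) n)%C = (cpoch z n * (z + RtoC (INR (S n))))%C.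
Proof.
  induction n as [|n IH]; [simpl; ring|].
  cbn [cpoch] in *. rewrite Cmult_assoc, IH, !S_INR, !RtoC_plus. ring.
Qed.

(** The Gauss terms satisfy gauss (z+1) n = z gauss z n times n / (z + n + 1), and the last factor
    tends to 1. *)
Lemma CGamma_succ (z : C) : nonpole z -> CGamma (z + 1) = (z * CGamma z)%C.
Proof.
  intros H. destruct (gauss_clim z H) as [H1 _].
  destruct (gauss_clim (z + 1) (nonpole_succ z H)) as [H2 _].
  apply (clim_unique (gauss (z + 1))); [exact H2|].
  assert (Hz : z <> 0%C) by (specialize (H O); simpl in H; intros E; apply H; rewrite E; ring).
  assert (Hlim : clim (fun n => RtoC (INR n) / (z + RtoC (INR (S n))))%C 1).
  { intros eps He. set (A := Cmod (z + 1)). assert (HA : 0 <= A) by apply Cmod_ge_0.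
    destruct (archimed_cor1 (/ (A + A / eps + 1))) as [n0 [Hn0 Hn0']].
    { apply Rinv_0_lt_compat. assert (0 <= A / eps) by (apply Rdiv_le_0_compat; auto). lra. }
    assert (0 <= A / eps) by (apply Rdiv_le_0_compat; auto).
    apply Rinv_lt_cancel in Hn0; [|apply lt_0_INR; lia].
    exists n0. intros n Hn. assert (INR n0 <= INR n) by (apply le_INR; auto).
    pose proof (H (S n)) as Hd.
    replace (RtoC (INR n) / (z + RtoC (INR (S n))) - 1)%C with (- (z + 1) / (z + RtoC (INR (S n))))%C.
    2: { rewrite S_INR, RtoC_plus in *. field. exact Hd. }
    rewrite Cmod_div, Cmod_opp by exact Hd. fold A.
    assert (Hden : INR n - A <= Cmod (z + RtoC (INR (S n)))).
    { pose proof (Cmod_sub_le (z + RtoC (INR (S n))) (z + 1)) as T.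
      replace (z + RtoC (INR (S n)) - (z + 1))%C with (RtoC (INR n)) in T
        by (rewrite S_INR, RtoC_plus; ring).
      rewrite Cmod_R, Rabs_pos_eq in T by apply pos_INR. fold A in T. lra. }
    apply Rlt_div_l; [lra|].
    apply Rlt_le_trans with (eps * (A / eps + 1)); [|apply Rmult_le_compat_l; lra].
    replace (eps * (A / eps + 1)) with (A + eps) by (field; lra). lra. }
  pose proof (clim_mult _ _ _ _ (clim_mult _ _ _ _ (clim_const z) H1) Hlim) as H3.
  replace (z * CGamma z * 1)%C with (z * CGamma z)%C in H3 by ring.
  apply (clim_ext_eventually _ _ _ 1) with (2 := H3).
  intros n Hn. unfold gauss.
  rewrite !cpow_pos_real by (apply lt_0_INR; lia).
  replace ((z + 1) * RtoC (ln (INR n)))%C with (z * RtoC (ln (INR n)) + RtoC (ln (INR n)))%C by ring.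
  rewrite cexp_plus, cexp_ln by (apply lt_0_INR; lia).
  pose proof (cpoch_succ z n) as E. pose proof (cpoch_neq_0 z n H) as P1.
  pose proof (cpoch_neq_0 (z + 1) n (nonpole_succ z H)) as P2.
  assert (E' : cpoch (z + 1) n = (/ z * (cpoch z n * (z + RtoC (INR (S n)))))%C).
  { rewrite <- E. field. exact Hz. }
  rewrite E'. field. repeat split; auto.
Qed.

Lemma nonpole_pos (x : R) : 0 < x -> nonpole (RtoC x).
Proof.
  intros Hx n E. rewrite <- RtoC_plus in E. apply RtoC_inj in E. pose proof (pos_INR n). lra.
Qed.

Lemma CGamma_1 : CGamma 1 = 1%C.
Proof.
  apply Clim_eq. apply (clim_ext_eventually (fun n => RtoC (INR n / INR (S n))) _ _ 1).
  - intros n Hn. rewrite cpow_pos_real by (apply lt_0_INR; lia).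
    replace (1 * RtoC (ln (INR n)))%C with (RtoC (ln (INR n))) by ring.
    rewrite cexp_ln by (apply lt_0_INR; lia).
    assert (Hp : forall m, cpoch 1 m = RtoC (INR (fact (S m)))).
    { induction m as [|m IH]; [simpl; f_equal; ring|]. cbn [cpoch]. rewrite IH.
      change (fact (S (S m))) with (S (S m) * fact (S m))%nat.
      rewrite mult_INR, (S_INR (S m)), <- RtoC_plus, <- RtoC_mult. f_equal. ring. }
    rewrite Hp. change (fact (S n)) with (S n * fact n)%nat.
    assert (INR (S n) <> 0) by (apply not_0_INR; lia).
    pose proof (INR_fact_neq_0 n). rewrite mult_INR.
    rewrite <- RtoC_mult, <- RtoC_div by (apply Rmult_integral_contrapositive; auto).
    f_equal. field. auto.
  - intros eps He. destruct (archimed_cor1 eps He) as [n0 [Hn0 Hn0']].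
    exists n0. intros n Hn. rewrite <- RtoC_minus, Cmod_R.
    assert (0 < INR (S n)) by (apply lt_0_INR; lia).
    replace (INR n / INR (S n) - 1) with (- / INR (S n)) by (rewrite S_INR in *; field; lra).
    rewrite Rabs_Ropp, Rabs_pos_eq by (left; now apply Rinv_0_lt_compat).
    apply Rle_lt_trans with (/ INR n0); [|exact Hn0].
    apply Rinv_le_contravar; [apply lt_0_INR; lia|apply le_INR; lia].
Qed.

Lemma CGamma_nat (k : nat) : CGamma (RtoC (INR (k + 1))) = RtoC (INR (fact k)).
Proof.
  rewrite Nat.add_1_r. induction k as [|k IH]; [apply CGamma_1|].
  rewrite (S_INR (S k)), RtoC_plus, CGamma_succ, IH.
  - change (fact (S k)) with (S k * fact k)%nat. now rewrite mult_INR, RtoC_mult.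
  - apply nonpole_pos, lt_0_INR. lia.
Qed.

Lemma CGamma_shift (z : C) (k : nat) : nonpole z ->
  (CGamma (z + RtoC (INR k)) * (z + RtoC (INR k)) = CGamma z * cpoch z k)%C.
Proof.
  intros H. induction k as [|k IH].
  - simpl. replace (z + 0)%C with z by ring. reflexivity.
  - cbn [cpoch]. rewrite Cmult_assoc, <- IH.
    replace (z + RtoC (INR (S k)))%C with (z + RtoC (INR k) + 1)%C by (rewrite S_INR, RtoC_plus; ring).
    rewrite CGamma_succ; [ring|].
    intros n. rewrite <- Cplus_assoc, <- RtoC_plus, <- plus_INR. apply H.
Qed.

(** Gauss' limit is read backwards instead of using Stirling's formula. Eventually |gauss z k| >=
    |Gamma z| / 2, which bounds z (z+1) ... (z+k) from above, and [CGamma_shift] turns this into a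
    bound on Gamma (z+k). The 4 is one factor 2 from here and one from |z + k| >= k / 2. *)
Lemma CGamma_shift_bound (z : C) : nonpole z ->
  exists K k0, forall k, (k0 <= k)%nat ->
    Cmod (CGamma (z + RtoC (INR k))) / INR (fact k) <= K * Rpower (INR k) (Re z - 1).
Proof.
  intros H. destruct (gauss_clim z H) as [H1 H2].
  assert (Hg : 0 < Cmod (CGamma z)) by now apply Cmod_gt_0.
  set (g := Cmod (CGamma z)) in *.
  destruct (H1 (g / 2) ltac:(lra)) as [n1 Hn1].
  set (A := Cmod z). assert (HA : 0 <= A) by apply Cmod_ge_0.
  destruct (archimed_cor1 (/ (2 * A + 1)) ltac:(apply Rinv_0_lt_compat; lra)) as [n2 [Hn2 Hn2']].
  apply Rinv_lt_cancel in Hn2; [|apply lt_0_INR; lia].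
  exists 4, (n1 + n2)%nat. intros k Hk.
  assert (Hk2 : INR n2 <= INR k) by (apply le_INR; lia).
  assert (Hk0 : 0 < INR k) by lra.
  specialize (Hn1 k ltac:(lia)).
  assert (Hlow : g / 2 <= Cmod (gauss z k)).
  { pose proof (Cmod_sub_le (gauss z k) (gauss z k - CGamma z)) as T.
    replace (gauss z k - (gauss z k - CGamma z))%C with (CGamma z) in T by ring. fold g in T. lra. }
  assert (Hzk : INR k / 2 <= Cmod (z + RtoC (INR k))).
  { pose proof (Cmod_sub_le (z + RtoC (INR k)) z) as T.
    replace (z + RtoC (INR k) - z)%C with (RtoC (INR k)) in T by ring.
    rewrite Cmod_R, Rabs_pos_eq in T by lra. fold A in T. lra. }
  pose proof (cpoch_neq_0 z k H) as Hp. assert (Hpp : 0 < Cmod (cpoch z k)) by now apply Cmod_gt_0.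
  assert (Hf : 0 < INR (fact k)) by (apply lt_0_INR, lt_O_fact).
  assert (Hcp : Cmod (cpoch z k) * (g / 2) <= INR (fact k) * Rpower (INR k) (Re z)).
  { unfold gauss in Hlow. rewrite Cmod_div, Cmod_mult in Hlow by auto.
    rewrite Cmod_R, Rabs_pos_eq, cpow_pos_real, Cmod_cexp in Hlow by lra.
    replace (Re (z * RtoC (ln (INR k)))) with (Re z * ln (INR k)) in Hlow
      by (destruct z; simpl; ring).
    fold (Rpower (INR k) (Re z)) in Hlow.
    apply (Rmult_le_compat_r (Cmod (cpoch z k))) in Hlow; [|lra].
    unfold Rdiv at 2 in Hlow. rewrite Rmult_assoc, Rinv_l, Rmult_1_r in Hlow by lra. lra. }
  pose proof (CGamma_shift z k H) as E. apply (f_equal Cmod) in E. rewrite !Cmod_mult in E. fold g in E.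
  unfold Rminus. rewrite Rpower_plus, Rpower_Ropp, Rpower_1 by lra.
  apply Rle_div_l; [exact Hf|].
  apply (Rmult_le_reg_r (INR k / 2)); [lra|].
  eapply Rle_trans.
  - apply Rmult_le_compat_l; [apply Cmod_ge_0|exact Hzk].
  - rewrite E.
    replace (4 * (Rpower (INR k) (Re z) * / INR k) * INR (fact k) * (INR k / 2))
      with (2 * (INR (fact k) * Rpower (INR k) (Re z))) by (field; lra).
    lra.
Qed.

(** * The expansion of one component *)

(* Up to a constant factor, the k-th Taylor coefficient of (1-z)^l X(z). *)
Definition gterm (delta : C) (l k : nat) : C :=
  ((-1) ^ l * CGamma (RtoC (INR l) + delta) * CGamma (RtoC (INR k) - RtoC (INR l) + 1 - delta)
   / CGamma (RtoC (INR (k + 1))))%C.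

Definition bigO_power (a : nat -> C) (e : R) : Prop :=
  exists K k0, forall k, (k0 <= k)%nat -> Cmod (a k) <= K * Rpower (INR k) e.

Lemma bigO_power_nonneg (a : nat -> C) (e : R) : bigO_power a e ->
  exists K k0, 0 <= K /\ (1 <= k0)%nat /\ forall k, (k0 <= k)%nat -> Cmod (a k) <= K * Rpower (INR k) e.
Proof.
  intros [K [k0 H]]. exists (Rabs K), (S k0). split; [apply Rabs_pos|]. split; [lia|].
  intros k Hk. eapply Rle_trans; [apply H; lia|].
  apply Rmult_le_compat_r; [left; apply exp_pos|apply Rle_abs].
Qed.

Lemma bigO_power_weaken (a : nat -> C) (e e' : R) : e <= e' -> bigO_power a e -> bigO_power a e'.
Proof.
  intros He H. destruct (bigO_power_nonneg a e H) as [K [k0 [HK [Hk0 Hb]]]].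
  exists K, k0. intros k Hk. eapply Rle_trans; [apply Hb, Hk|].
  apply Rmult_le_compat_l; [exact HK|]. apply Rle_Rpower; [|exact He].
  replace 1 with (INR 1) by reflexivity. apply le_INR. lia.
Qed.

Lemma bigO_power_plus (a b : nat -> C) (e : R) :
  bigO_power a e -> bigO_power b e -> bigO_power (fun k => a k + b k)%C e.
Proof.
  intros [K1 [k1 H1]] [K2 [k2 H2]]. exists (K1 + K2), (k1 + k2)%nat. intros k Hk.
  specialize (H1 k ltac:(lia)). specialize (H2 k ltac:(lia)).
  eapply Rle_trans; [apply Cmod_triangle|]. lra.
Qed.

Lemma bigO_power_scal (c : C) (a : nat -> C) (e : R) :
  bigO_power a e -> bigO_power (fun k => c * a k)%C e.
Proof.
  intros [K [k0 H]]. exists (Cmod c * K), k0. intros k Hk. rewrite Cmod_mult, Rmult_assoc.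
  apply Rmult_le_compat_l; [apply Cmod_ge_0|now apply H].
Qed.

Lemma bigO_power_ext (a b : nat -> C) (e : R) (N : nat) :
  (forall k, (N <= k)%nat -> a k = b k) -> bigO_power a e -> bigO_power b e.
Proof.
  intros E [K [k0 H]]. exists K, (N + k0)%nat. intros k Hk. rewrite <- E by lia. apply H. lia.
Qed.

Lemma bigO_power_csum_tail (a : nat -> nat -> C) (e : R) (n p : nat) :
  (forall l, (n <= l)%nat -> bigO_power (a l) e) ->
  bigO_power (fun k => csum (fun l => a l k) (n + p) - csum (fun l => a l k) n)%C e.
Proof.
  intros H. induction p as [|p IH].
  - exists 0, O. intros k _. rewrite Nat.add_0_r, Cmod_sub_self. lra.
  - apply (bigO_power_ext (fun k => (csum (fun l => a l k) (n + p) - csum (fun l => a l k) n)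
                                    + a (n + p)%nat k)%C _ e 0).
    + intros k _. rewrite Nat.add_succ_r. simpl. ring.
    + apply bigO_power_plus; [exact IH|]. apply H. lia.
Qed.

Lemma eventually_forall_lt (Q : nat -> nat -> Prop) (N : nat) :
  (forall l, exists k0, forall k, (k0 <= k)%nat -> Q l k) ->
  exists k0, forall k, (k0 <= k)%nat -> forall l, (l < N)%nat -> Q l k.
Proof.
  intros H. induction N as [|N [k1 IH]].
  - exists O. intros; lia.
  - destruct (H N) as [k2 H2]. exists (k1 + k2)%nat. intros k Hk l Hl.
    destruct (Nat.eq_dec l N) as [->|Hn]; [apply H2; lia|apply IH; lia].
Qed.

Lemma dom0_slit (r : Rbar) (z : C) : dom0 r z -> slit (1 - z).
Proof.
  intros [_ H] [H1 H2]. apply H. destruct z as [x y]. simpl in *. split; lra.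
Qed.

Lemma inv_pow_Rpower (k M : nat) : (1 <= k)%nat -> / INR k ^ M = Rpower (INR k) (- INR M).
Proof.
  intros Hk. assert (0 < INR k) by (apply lt_0_INR; lia).
  now rewrite Rpower_Ropp, Rpower_pow.
Qed.

Section Expansion.

(** A common setting for both kinds of delta: X is the model singularity, [lam] its coefficient in
    f, and [kappa] the factor, independent of l and k, between the coefficients of (1-z)^l X and
    [gterm]. In [hcoef] the index k is only eventually large because the logarithmic formula starts
    beyond l + delta - 1. *)
Variables (r : Rbar) (delta c lam kappa : C) (X f P psi : C -> C) (d dt : nat -> C) (CX B eta : R).
Hypothesis hr : Rbar_lt 1 r.
Hypothesis hX : forall z, slit (1 - z) -> exists l, cder X z l.
Hypothesis hCX : 0 <= CX.
(** A crude bound that fits both models: the real part of delta - 1 exceeds -2, and a logarithm is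
    weaker than any negative power. *)
Hypothesis hXb : forall z, slit (1 - z) -> Cmod (1 - z) < 1 -> Cmod (X z) <= CX * / Cmod (1 - z) ^ 2.
Hypothesis hcoef : forall l, exists k0, forall k, (k0 <= k)%nat -> forall u th, u < 0 ->
  coef (fun z => (1 - z) ^ l * X z)%C k u th = (kappa * gterm delta l k)%C.
Hypothesis hg : forall l, bigO_power (gterm delta l) (- Re delta - INR l).
Hypothesis hf : forall z, dom0 r z -> exists l, cder f z l.
Hypothesis hd : forall z, Cmod z < 1 -> cseries (fun k => z ^ k * d k)%C (f z).
Hypothesis heta : 0 < eta <= 1.
Hypothesis hB : 0 <= B.
Hypothesis hP : forall z : C, z <> 1%C -> Cmod (z - 1) < eta ->
  (exists l, cder P z l) /\ Cmod (P z) <= B.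
Hypothesis hfP : forall z, dom0 r z -> Cmod (z - 1) < eta ->
  (f z = c / (1 - z) + P z + lam * (X z * psi z))%C.
Hypothesis hpsi : forall z, dom0 r z -> Cmod (z - 1) < eta ->
  cseries (fun k => (1 - z) ^ k * dt k)%C (psi z).

Lemma psi_remainder (N : nat) : exists rho K, 0 < rho <= eta /\ 0 <= K /\
  forall z, dom0 r z -> Cmod (z - 1) < rho ->
    Cmod (psi z - csum (fun k => (1 - z) ^ k * dt k)%C N) <= K * Cmod (z - 1) ^ N.
Proof.
  (* The series is sampled at the real point 1 - rho, which lies in the unit disc and hence off the
     cut. Bounded terms there give a geometric remainder; restricting to |z - 1| < rho / 2 makes the
     ratio at most 1/2, whence the factor 2 in 2 M. *)
  set (rho := eta / 2).
  assert (Hz1 : Cmod (1 - rho)%C < 1).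
  { rewrite <- RtoC_minus, Cmod_R, Rabs_pos_eq; unfold rho; lra. }
  assert (Hz2 : Cmod ((1 - rho)%C - 1) < eta).
  { replace ((1 - rho)%C - 1)%C with (RtoC (- rho)) by (rewrite RtoC_opp; ring).
    rewrite Cmod_R, Rabs_Ropp, Rabs_pos_eq; unfold rho; lra. }
  destruct (cseries_terms_bounded _ _ (hpsi (1 - rho)%C (dom0_disc r _ hr Hz1) Hz2)) as [M HM].
  assert (HM' : forall j, Cmod (dt j) * rho ^ j <= M).
  { intros j. specialize (HM j). cbv beta in HM.
    replace (1 - (1 - rho))%C with (RtoC rho) in HM by ring.
    rewrite Cmod_mult, Cmod_pow, Cmod_R, Rabs_pos_eq in HM by (unfold rho; lra). lra. }
  assert (HM0 : 0 <= M).
  { eapply Rle_trans; [|apply (HM' O)]. simpl. pose proof (Cmod_ge_0 (dt O)). lra. }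
  assert (Hrho : 0 < rho) by (unfold rho; lra).
  exists (rho / 2), (2 * M * / rho ^ N). split; [unfold rho; lra|]. split.
  { apply Rmult_le_pos; [lra|]. left. now apply Rinv_0_lt_compat, pow_lt. }
  intros z Hd Hz. rewrite (Cmod_sub_sym z 1) in Hz |- *.
  pose proof (power_series_remainder dt (1 - z) (psi z) rho M N Hrho ltac:(lra) HM'
                (hpsi z Hd ltac:(rewrite Cmod_sub_sym; unfold rho in *; lra))) as H.
  eapply Rle_trans; [apply H|].
  assert (Hq : Cmod (1 - z) / rho <= / 2).
  { apply Rle_div_l; lra. }
  assert (HrN : 0 < rho ^ N) by now apply pow_lt.
  assert (Hw : 0 <= Cmod (1 - z) ^ N) by apply pow_le, Cmod_ge_0.
  unfold Rdiv at 2. rewrite Rpow_mult_distr, pow_inv.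
  apply Rle_div_l; [lra|].
  replace (2 * M * / rho ^ N * Cmod (1 - z) ^ N * (1 - Cmod (1 - z) / rho))
    with (M * (Cmod (1 - z) ^ N * / rho ^ N) * (2 * (1 - Cmod (1 - z) / rho))) by ring.
  rewrite <- (Rmult_1_r (M * (Cmod (1 - z) ^ N * / rho ^ N))) at 1.
  apply Rmult_le_compat_l; [|lra].
  apply Rmult_le_pos; [lra|]. apply Rmult_le_pos; [lra|]. left. now apply Rinv_0_lt_compat.
Qed.

Lemma expansion (n : nat) :
  bigO_power (fun k => d k - (c + lam * kappa * csum (fun l => gterm delta l k * dt l) (S n)))%C
    (- Re delta - INR n - 1).
Proof.
  (* M is chosen so large that O(k^-M) is within the required error. *)
  destruct (INR_unbounded (Rabs (Re delta) + INR n + 1)) as [M HM].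
  assert (HM1 : (1 <= M)%nat).
  { destruct M; [|lia]. simpl in HM. pose proof (Rabs_pos (Re delta)). pose proof (pos_INR n). lra. }
  assert (HMe : - INR M <= - Re delta - INR n - 1) by (pose proof (Rle_abs (Re delta)); lra).
  (* Beyond the S n requested terms, two powers of |1-z| pay for the bound on X and M powers are
     left for the transfer theorem. *)
  set (N := (S n + (M + 2))%nat).
  destruct (psi_remainder N) as [rho [K [Hrho [HK Hrem]]]].
  set (T := fun l z => ((1 - z) ^ l * X z)%C).
  set (F := fun z => (f z - c * / (1 - z) - lam * csum (fun l => dt l * T l z) N)%C).
  assert (HT : forall l z, slit (1 - z) -> exists m, cder (T l) z m).
  { intros l z Hz. destruct (hX z Hz) as [m Hm]. eexists.
    apply (cder_mult (fun w => (1 - w) ^ l)%C X); [apply cder_pow_one_minus|exact Hm]. }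
  assert (HTc : forall l, disc_cont (T l)).
  { intros l z Hz. destruct (HT l z (slit_disc z Hz)) as [m Hm]. eapply cder_ccont, Hm. }
  assert (Hinv : forall z, (1 - z)%C <> 0%C -> exists m, cder (fun w => / (1 - w))%C z m).
  { intros z Hz. eexists. apply (cder_comp Cinv (fun w => 1 - w)%C); [now apply cder_inv|].
    apply cder_one_minus. }
  assert (HF : forall z, dom0 r z -> exists l, cder F z l).
  { intros z Hz. pose proof (dom0_slit r z Hz) as Hs.
    destruct (hf z Hz) as [l1 H1]. destruct (Hinv z (slit_neq_0 _ Hs)) as [l2 H2].
    destruct (cder_csum (fun l z => dt l * T l z)%C N z) as [l3 H3].
    { intros j. destruct (HT j z Hs) as [m Hm]. eexists. apply cder_scal, Hm. }
    eexists. unfold F. apply cder_minus; [apply cder_minus; [exact H1|]|].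
    - apply cder_scal, H2.
    - apply cder_scal, H3. }
  set (C0 := Cmod lam * CX * K).
  assert (HC0 : 0 <= C0).
  { unfold C0. repeat apply Rmult_le_pos; auto. apply Cmod_ge_0. }
  destruct (transfer r F P M rho C0 B hr HM1 HF) as [K1 [k1 Hk1]]; try tauto.
  { intros z Hz1 Hz. apply hP; auto. lra. }
  { intros z Hz Hzr. pose proof (dom0_slit r z Hz) as Hs. pose proof (slit_neq_0 _ Hs) as Hn.
    assert (E : (F z - P z)%C = (lam * (X z * (psi z - csum (fun k => (1 - z) ^ k * dt k)%C N)))%C).
    { unfold F. rewrite (hfP z Hz ltac:(lra)).
      assert (Es : csum (fun l => dt l * T l z)%C N = (X z * csum (fun k => (1 - z) ^ k * dt k)%C N)%C).
      { rewrite <- csum_scal. apply csum_ext. intros j _. unfold T. ring. }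
      rewrite Es. field. exact Hn. }
    rewrite E, !Cmod_mult.
    assert (Hx : 0 < Cmod (1 - z)) by now apply Cmod_gt_0.
    pose proof (hXb z Hs ltac:(rewrite Cmod_sub_sym; lra)) as H1.
    pose proof (Hrem z Hz Hzr) as H2. rewrite (Cmod_sub_sym z) in *.
    set (x := Cmod (1 - z)) in *.
    assert (H3 : Cmod (X z) * Cmod (psi z - csum (fun k => (1 - z) ^ k * dt k)%C N)
                 <= (CX * / x ^ 2) * (K * x ^ N)).
    { apply Rmult_le_compat; auto; apply Cmod_ge_0. }
    assert (H4 : (CX * / x ^ 2) * (K * x ^ N) <= CX * K * x ^ M).
    { replace N with (2 + (S n + M))%nat by (unfold N; lia). rewrite !pow_add.
      replace (CX * / x ^ 2 * (K * (x ^ 2 * (x ^ S n * x ^ M))))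
        with (CX * K * x ^ M * x ^ S n) by (field; lra).
      rewrite <- (Rmult_1_r (CX * K * x ^ M)) at 2.
      apply Rmult_le_compat_l.
      - repeat apply Rmult_le_pos; auto. apply pow_le; lra.
      - rewrite <- (pow1 (S n)). apply pow_incr. lra. }
    unfold C0. rewrite !Rmult_assoc. apply Rmult_le_compat_l; [apply Cmod_ge_0|].
    rewrite <- Rmult_assoc. lra. }
  destruct (eventually_forall_lt (fun l k => forall u th, u < 0 ->
    coef (T l) k u th = (kappa * gterm delta l k)%C) N hcoef) as [k2 Hk2].
  assert (Hfc : disc_cont f).
  { intros z Hz. destruct (hf z (dom0_disc r z hr Hz)) as [l Hl]. eapply cder_ccont, Hl. }
  assert (Hic : disc_cont (fun z => / (1 - z))%C).
  { intros z Hz. destruct (Hinv z) as [l Hl]; [now apply slit_neq_0, slit_disc|]. eapply cder_ccont, Hl. }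
  assert (Hsc : disc_cont (fun z => csum (fun l => dt l * T l z)%C N)).
  { intros z Hz. apply (ccont_csum (fun l z => dt l * T l z)%C). intros j.
    apply ccont_mult; [apply ccont_const|now apply HTc]. }
  assert (HcF : bigO_power (fun k => d k - (c + lam * kappa * csum (fun l => gterm delta l k * dt l)%C N))%C
                  (- INR M)).
  { exists K1, (k1 + k2 + 1)%nat. intros k Hk.
    destruct (Hk1 k ltac:(lia)) as [Hk01 Hb]. rewrite <- inv_pow_Rpower by exact Hk01.
    assert (Hu : - / INR k < 0).
    { assert (0 < / INR k) by (apply Rinv_0_lt_compat, lt_0_INR; lia). lra. }
    match goal with |- Cmod ?a <= _ => replace a with (coef F k (- / INR k) (- / INR k)) end; [exact Hb|].
    unfold F. rewrite coef_minus; [|exact Hu| |now apply disc_cont_scal].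
    2: { intros z Hz. apply ccont_minus; [now apply Hfc|].
         apply ccont_mult; [apply ccont_const|now apply Hic]. }
    rewrite coef_minus; [|exact Hu|exact Hfc|now apply disc_cont_scal].
    rewrite (coef_power_series f d) by auto.
    rewrite !coef_scal by auto. rewrite coef_inv_one_minus by auto.
    rewrite (coef_csum (fun l z => dt l * T l z)%C); [|exact Hu|].
    2: { intros j. now apply disc_cont_scal. }
    rewrite (csum_ext _ (fun l => kappa * (gterm delta l k * dt l))%C).
    - rewrite csum_scal. ring.
    - intros j Hj. rewrite coef_scal by auto. rewrite (Hk2 k ltac:(lia) j Hj) by auto. ring. }
  (* The surplus terms have l >= n + 1, so each is O(k^(-Re delta - n - 1)) and their finite number
     goes into the error. *)
  pose proof (bigO_power_csum_tail (fun l k => gterm delta l k * dt l)%C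
                (- Re delta - INR n - 1) (S n) (M + 2)) as Htail.
  fold N in Htail.
  apply (bigO_power_ext (fun k =>
     (d k - (c + lam * kappa * csum (fun l => gterm delta l k * dt l)%C N))
     + lam * kappa * (csum (fun l => gterm delta l k * dt l)%C N
                      - csum (fun l => gterm delta l k * dt l)%C (S n)))%C _ _ 0).
  - intros k _. ring.
  - apply bigO_power_plus; [now apply (bigO_power_weaken _ (- INR M))|].
    apply bigO_power_scal. apply Htail. intros l Hl.
    apply (bigO_power_weaken _ (- Re delta - INR l)).
    + apply le_INR in Hl. rewrite S_INR in Hl. lra.
    + apply (bigO_power_ext (fun k => dt l * gterm delta l k)%C _ _ 0); [intros; ring|].
      apply bigO_power_scal, hg.
Qed.

End Expansion.

(** * The two model singularities: growth at 1 and Taylor coefficients *)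

Lemma Cmod_pow_log_le (m : nat) (z : C) : slit (1 - z) -> Cmod (1 - z) < 1 ->
  Cmod (pow_log m z) <= 5 * / Cmod (1 - z) ^ 2.
Proof.
  intros Hs Hx. unfold pow_log. rewrite Cmod_mult, Cmod_pow.
  assert (H0 : 0 < Cmod (1 - z)) by now apply Cmod_gt_0, slit_neq_0.
  assert (Hl : Cmod (clog (1 - z)) <= - ln (Cmod (1 - z)) + PI).
  { unfold clog. eapply Rle_trans; [apply Cmod_le_abs|].
    pose proof (carg_bound _ Hs). rewrite (Rabs_left1 (ln (Cmod (1 - z)))); [lra|].
    rewrite <- ln_1. left. apply ln_increasing; lra. }
  set (x := Cmod (1 - z)) in *.
  assert (Hi : 1 < / x) by (rewrite <- Rinv_1; apply Rinv_lt_contravar; lra).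
  assert (Hln : - ln x <= / x).
  { rewrite <- ln_Rinv by auto. pose proof (exp_ineq1_le (ln (/ x))).
    rewrite exp_ln in H by lra. lra. }
  assert (Hi2 : / x ^ 2 = / x * / x) by (field; lra). rewrite Hi2.
  pose proof PI_4. pose proof (Cmod_ge_0 (clog (1 - z))).
  assert (0 <= x ^ m <= 1).
  { split; [apply pow_le; lra|]. rewrite <- (pow1 m). apply pow_incr. lra. }
  (* With x = |1-z| < 1: - ln x <= 1/x and pi <= 4, and both 1/x and 1 are at most 1/x^2. *)
  assert (Cmod (clog (1 - z)) <= 5 * (/ x * / x)) by nra.
  nra.
Qed.

Lemma Cmod_cpow_one_minus_le (a z : C) : -2 <= Re a -> slit (1 - z) -> Cmod (1 - z) < 1 ->
  Cmod (cpow (1 - z) a) <= exp (Rabs (Im a) * PI) * / Cmod (1 - z) ^ 2.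
Proof.
  intros Ha Hs Hx. assert (H0 : 0 < Cmod (1 - z)) by now apply Cmod_gt_0, slit_neq_0.
  eapply Rle_trans; [apply Cmod_cpow_le, Hs|].
  apply Rmult_le_compat_l; [left; apply exp_pos|].
  set (x := Cmod (1 - z)) in *.
  rewrite <- Rpower_pow, <- Rpower_Ropp by auto. unfold Rpower.
  assert (Hln : ln x < 0) by (rewrite <- ln_1; apply ln_increasing; lra).
  apply exp_le_exp. simpl. nra.
Qed.

Lemma nonpole_shift_nonint (delta : C) (m : Z) : ~ is_integer delta ->
  nonpole (RtoC (IZR m) + delta) /\ nonpole (RtoC (IZR m) - delta).
Proof.
  intros H. split; intros n E; apply H.
  - exists (- m - Z.of_nat n)%Z.
    rewrite minus_IZR, opp_IZR, <- INR_IZR_INZ, RtoC_minus, RtoC_opp.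
    replace delta with ((RtoC (IZR m) + delta + RtoC (INR n)) - RtoC (IZR m) - RtoC (INR n))%C by ring.
    rewrite E. ring.
  - exists (m + Z.of_nat n)%Z. rewrite plus_IZR, <- INR_IZR_INZ, RtoC_plus.
    replace delta with (RtoC (IZR m) + RtoC (INR n) - (RtoC (IZR m) - delta + RtoC (INR n)))%C by ring.
    rewrite E. ring.
Qed.

Lemma nonpole_args (delta : C) (l k : nat) : ~ is_integer delta ->
  nonpole (RtoC (INR l) + delta) /\ nonpole (RtoC (INR k) - RtoC (INR l) + 1 - delta).
Proof.
  intros H. split.
  - rewrite INR_IZR_INZ. now apply nonpole_shift_nonint.
  - replace (RtoC (INR k) - RtoC (INR l) + 1 - delta)%C
      with (RtoC (IZR (Z.of_nat k - Z.of_nat l + 1)) - delta)%C.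
    + now apply nonpole_shift_nonint.
    + rewrite plus_IZR, minus_IZR, <- !INR_IZR_INZ, RtoC_plus, RtoC_minus. reflexivity.
Qed.

(* The product is independent of l by the functional equation; for l = 0 it is pi / sin (pi delta). *)
Lemma CGamma_reflection_shift (delta : C) (l : nat) : ~ is_integer delta ->
  ((-1) ^ l * CGamma (RtoC (INR l) + delta) * CGamma (RtoC (INR 0) - RtoC (INR l) + 1 - delta)
   = CGamma delta * CGamma (1 - delta))%C.
Proof.
  intros H. induction l as [|l IH].
  - simpl. replace (0 + delta)%C with delta by ring. replace (0 - 0 + 1 - delta)%C with (1 - delta)%C by ring.
    ring.
  - rewrite <- IH. destruct (nonpole_args delta l 0 H) as [N1 _].
    destruct (nonpole_args delta (S l) 0 H) as [_ N2].
    replace (RtoC (INR (S l)) + delta)%C with (RtoC (INR l) + delta + 1)%C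
      by (rewrite S_INR, RtoC_plus; ring).
    rewrite CGamma_succ by exact N1.
    replace (RtoC (INR 0) - RtoC (INR l) + 1 - delta)%C
      with (RtoC (INR 0) - RtoC (INR (S l)) + 1 - delta + 1)%C
      by (rewrite S_INR, RtoC_plus; ring).
    rewrite CGamma_succ by exact N2. rewrite S_INR, RtoC_plus. simpl Cpow. simpl (INR 0).
    replace (RtoC (-1)) with (- (1))%C by (rewrite <- RtoC_opp; reflexivity). ring.
Qed.

(** Both sides satisfy the same first-order recurrence in k, by [coef_cpow_rec] and the functional
    equation of Gamma. They agree at k = 0 by the reflection product, whose value independent of l
    fixes the factor. *)
Lemma coef_cpow_gterm (delta : C) (l k : nat) (u th : R) : ~ is_integer delta -> u < 0 ->
  coef (fun z => (1 - z) ^ l * cpow (1 - z) (delta - 1))%C k u th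
  = (/ (CGamma delta * CGamma (1 - delta)) * gterm delta l k)%C.
Proof.
  intros H Hu.
  rewrite (coef_ext _ (fun z => cpow (1 - z) (RtoC (INR l) + (delta - 1)))%C); [|exact Hu|].
  2: { intros z Hz. pose proof (slit_disc z Hz) as Hs.
       rewrite cpow_plus by now apply slit_neq_0. now rewrite cpow_nat by auto. }
  assert (H0 : CGamma delta <> 0%C).
  { replace delta with (RtoC (INR 0) + delta)%C by (simpl; ring).
    apply gauss_clim, (nonpole_args delta 0 0 H). }
  assert (H1 : CGamma (1 - delta) <> 0%C).
  { replace (1 - delta)%C with (RtoC (INR 0) - RtoC (INR 0) + 1 - delta)%C by (simpl; ring).
    apply gauss_clim, (nonpole_args delta 0 0 H). }
  induction k as [|k IH].
  - rewrite coef_cpow_0 by exact Hu. unfold gterm. rewrite CGamma_reflection_shift by exact H.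
    rewrite (CGamma_nat 0). simpl. field. auto.
  - pose proof (coef_cpow_rec (RtoC (INR l) + (delta - 1)) k u th Hu) as E. rewrite IH in E.
    set (x := coef (fun z => cpow (1 - z) (RtoC (INR l) + (delta - 1))) (S k) u th) in *.
    assert (Hk : RtoC (INR (S k)) <> 0%C) by (apply RtoC_neq_0, not_0_INR; lia).
    replace x with (/ RtoC (INR (S k)) * (RtoC (INR (S k)) * x))%C by (field; auto).
    rewrite E. unfold gterm. rewrite !CGamma_nat.
    replace (RtoC (INR (S k)) - RtoC (INR l) + 1 - delta)%C
      with (RtoC (INR k) - RtoC (INR l) + 1 - delta + 1)%C by (rewrite S_INR, RtoC_plus; ring).
    rewrite (CGamma_succ (RtoC (INR k) - RtoC (INR l) + 1 - delta)) by apply (nonpole_args delta l k H).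
    change (fact (S k)) with (S k * fact k)%nat. rewrite mult_INR, RtoC_mult.
    assert (Hfk : RtoC (INR (fact k)) <> 0%C) by apply RtoC_neq_0, INR_fact_neq_0.
    field. auto.
Qed.

Lemma gterm_bound_nonint (delta : C) (l : nat) : ~ is_integer delta ->
  bigO_power (gterm delta l) (- Re delta - INR l).
Proof.
  intros H. destruct (nonpole_args delta l 0 H) as [_ N2].
  destruct (CGamma_shift_bound _ N2) as [K [k0 HK]].
  exists (Cmod (CGamma (RtoC (INR l) + delta)) * K), k0. intros k Hk. specialize (HK k Hk).
  unfold gterm. rewrite CGamma_nat.
  assert (Hf : 0 < INR (fact k)) by (apply lt_0_INR, lt_O_fact).
  rewrite Cmod_div, !Cmod_mult, Cmod_pow, !Cmod_R
    by (intros E'; apply RtoC_inj in E'; lra).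
  rewrite (Rabs_pos_eq (INR (fact k))) by lra.
  replace (Rabs (-1)) with 1 by (rewrite Rabs_left; lra). rewrite pow1, Rmult_1_l.
  replace (RtoC (INR 0) - RtoC (INR l) + 1 - delta + RtoC (INR k))%C
    with (RtoC (INR k) - RtoC (INR l) + 1 - delta)%C in HK by (simpl (INR 0); ring).
  replace (Re (RtoC (INR 0) - RtoC (INR l) + 1 - delta) - 1) with (- Re delta - INR l) in HK
    by (destruct delta; simpl; ring).
  unfold Rdiv in *. rewrite !Rmult_assoc. apply Rmult_le_compat_l; [apply Cmod_ge_0|exact HK].
Qed.

(** The index k = m0 + l + 1 + j is the range in which k - l + 1 - delta = j + 1 is a positive
    integer; for smaller k that Gamma factor would sit at a pole. *)
Lemma gterm_nat (m0 l j : nat) :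
  gterm (RtoC (INR (S m0))) l (S (m0 + l + j))
  = ((-1) ^ l * RtoC (INR (fact (m0 + l)) * INR (fact j) / INR (fact (S (m0 + l + j)))))%C.
Proof.
  unfold gterm. rewrite CGamma_nat.
  replace (RtoC (INR l) + RtoC (INR (S m0)))%C with (RtoC (INR (m0 + l + 1))).
  2: { rewrite <- RtoC_plus, <- plus_INR. f_equal. f_equal. lia. }
  replace (RtoC (INR (S (m0 + l + j))) - RtoC (INR l) + 1 - RtoC (INR (S m0)))%C
    with (RtoC (INR (j + 1))).
  2: { rewrite <- RtoC_minus, <- RtoC_plus, <- RtoC_minus. f_equal.
       rewrite !S_INR, !plus_INR. simpl. ring. }
  rewrite !CGamma_nat, RtoC_div, RtoC_mult by apply INR_fact_neq_0. unfold Cdiv. ring.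
Qed.

Lemma coef_pow_log_gterm (m0 l k : nat) (u th : R) : u < 0 -> (S (m0 + l) <= k)%nat ->
  coef (fun z => (1 - z) ^ l * pow_log m0 z)%C k u th
  = ((-1) ^ S m0 * gterm (RtoC (INR (S m0))) l k)%C.
Proof.
  intros Hu Hk. set (j := (k - S (m0 + l))%nat).
  replace k with (S (m0 + l + j)) by (unfold j; lia).
  rewrite (coef_ext _ (pow_log (m0 + l))); [|exact Hu|].
  2: { intros z _. unfold pow_log. rewrite Cpow_add_r. ring. }
  rewrite coef_pow_log, gterm_nat by exact Hu.
  change (S (m0 + l)) with (S m0 + l)%nat at 1. rewrite Cpow_add_r. ring.
Qed.

(** The quotient (j+p)! / j! is a product of p factors, each at least j + 1. *)
Lemma fact_pow_le (j p : nat) (x : R) : 0 <= x <= INR (S j) ->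
  INR (fact j) * x ^ p <= INR (fact (j + p)).
Proof.
  intros Hx. induction p as [|p IH]; [rewrite Nat.add_0_r; simpl; lra|].
  rewrite Nat.add_succ_r. change (fact (S (j + p))) with (S (j + p) * fact (j + p))%nat.
  rewrite mult_INR. simpl pow.
  replace (INR (fact j) * (x * x ^ p)) with (x * (INR (fact j) * x ^ p)) by ring.
  apply Rmult_le_compat; [lra| | |exact IH].
  - apply Rmult_le_pos; [apply pos_INR|apply pow_le; lra].
  - apply Rle_trans with (INR (S j)); [lra|]. apply le_INR. lia.
Qed.

Lemma gterm_bound_nat (m0 l : nat) :
  bigO_power (gterm (RtoC (INR (S m0))) l) (- Re (RtoC (INR (S m0))) - INR l).
Proof.
  set (m := (m0 + l)%nat).
  (* From k >= 2 (m + 1) on, j + 1 = k - m is at least k / 2, so k! / j! >= (k/2)^(m+1); hence the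
     power of 2. *)
  exists (INR (fact m) * 2 ^ S m), (2 * S m)%nat. intros k Hk.
  set (j := (k - S m)%nat).
  assert (Ek : k = S (m0 + l + j)) by (unfold j, m in *; lia).
  rewrite Ek at 1. rewrite gterm_nat, Cmod_mult, Cmod_pow, !Cmod_R.
  replace (Rabs (-1)) with 1 by (rewrite Rabs_left; lra). rewrite pow1, Rmult_1_l.
  fold m. replace (S (m + j)) with k by (unfold m; lia).
  assert (Hk0 : 0 < INR k) by (apply lt_0_INR; lia).
  assert (Hf : 0 < INR (fact k)) by (apply lt_0_INR, lt_O_fact).
  assert (Hfj : 0 < INR (fact j)) by (apply lt_0_INR, lt_O_fact).
  assert (Hfm : 0 < INR (fact m)) by (apply lt_0_INR, lt_O_fact).
  rewrite Rabs_pos_eq by (apply Rdiv_le_0_compat; [apply Rmult_le_pos; lra|lra]).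
  replace (- Re (RtoC (INR (S m0))) - INR l) with (- INR (S m))
    by (unfold m; change (Re (RtoC (INR (S m0)))) with (INR (S m0)); rewrite !S_INR, plus_INR; ring).
  rewrite <- inv_pow_Rpower by lia.
  assert (Hx : 0 <= INR k / 2 <= INR (S j)).
  { split; [lra|]. apply (Rmult_le_reg_r 2); [lra|].
    replace (INR k / 2 * 2) with (INR k) by field.
    replace 2 with (INR 2) by reflexivity. rewrite <- mult_INR. apply le_INR. unfold j. lia. }
  pose proof (fact_pow_le j (S m) (INR k / 2) Hx) as Hle.
  replace (j + S m)%nat with k in Hle by (unfold j; lia).
  assert (H2 : 0 < 2 ^ S m) by (apply pow_lt; lra).
  assert (H3 : 0 < INR k ^ S m) by (apply pow_lt; lra).
  unfold Rdiv in Hle at 1. rewrite Rpow_mult_distr, pow_inv in Hle.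
  apply Rle_div_l; [exact Hf|].
  apply Rle_trans with (INR (fact m) * 2 ^ S m * / INR k ^ S m
                        * (INR (fact j) * (INR k ^ S m * / 2 ^ S m))).
  - right. field. lra.
  - apply Rmult_le_compat_l; [|exact Hle].
    apply Rmult_le_pos; [apply Rmult_le_pos; lra|]. left. now apply Rinv_0_lt_compat.
Qed.

Lemma integer_delta_nat (delta : C) : is_integer delta -> Re delta > -1 -> delta <> 0%C ->
  exists m0, delta = RtoC (INR (S m0)).
Proof.
  intros [m ->] Hre H0. simpl in Hre.
  assert (0 < m)%Z.
  { destruct (Z_lt_le_dec 0 m) as [|Hle]; [assumption|exfalso].
    destruct (Z.eq_dec m 0) as [->|Hn]; [now apply H0|].
    assert (m <= -1)%Z as Hm by lia. apply IZR_le in Hm. lra. }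
  exists (pred (Z.to_nat m)). f_equal. rewrite INR_IZR_INZ. f_equal. lia.
Qed.

(** * The local form at z = 1 and the two cases for delta *)

Lemma dom1_near_1 (r : Rbar) : Rbar_lt 1 r ->
  exists eta, 0 < eta <= 1 /\ forall z, Cmod (z - 1) < eta -> dom1 r z.
Proof.
  intros Hr.
  assert (Hs : forall z, Cmod (z - 1) < 1 -> ~ (Im z = 0 /\ Re z <= 0)).
  { intros z Hz [_ H]. pose proof (re_le_Cmod (z - 1)) as A.
    rewrite <- Rabs_Ropp in A. pose proof (Rle_abs (- Re (z - 1))).
    destruct z as [x y]. simpl in *. lra. }
  assert (Ht : forall z, Cmod z <= Cmod (z - 1) + 1).
  { intros z. pose proof (Cmod_triangle (z - 1) 1) as A. rewrite Cmod_1 in A.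
    replace (z - 1 + 1)%C with z in A by ring. exact A. }
  destruct r as [r| |]; simpl in Hr; [|exists 1|contradiction].
  - exists (Rmin 1 (r - 1)). pose proof (Rmin_l 1 (r - 1)). pose proof (Rmin_r 1 (r - 1)).
    split; [split; [apply Rmin_glb_lt; lra|lra]|].
    intros z Hz. split; [|apply Hs; lra]. unfold diskD; simpl. specialize (Ht z). lra.
  - split; [lra|]. intros z Hz. split; [exact I|apply Hs; lra].
Qed.

(** Differentiability with tolerance 1 already bounds the quotient; its denominator is written z0 -
    z to match the factor 1 - z. *)
Lemma difference_quotient_bounded (phi : C -> C) (z0 l : C) : cder phi z0 l ->
  exists e, 0 < e /\ forall z, z <> z0 -> Cmod (z - z0) < e ->
    Cmod ((phi z - phi z0) / (z0 - z)) <= Cmod l + 1.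
Proof.
  intros H. destruct (H 1 Rlt_0_1) as [e [He Hw]]. exists e. split; [exact He|].
  intros z Hz Hd. specialize (Hw z Hd).
  assert (Hn : (z0 - z)%C <> 0%C) by (intros E; apply Hz; symmetry; now apply Cminus_eq_0).
  rewrite Cmod_div by exact Hn.
  assert (Hp : 0 < Cmod (z0 - z)) by now apply Cmod_gt_0.
  apply Rle_div_l; [exact Hp|].
  replace (phi z - phi z0)%C with ((phi z - phi z0 - l * (z - z0)) + l * (z - z0))%C by ring.
  eapply Rle_trans; [apply Cmod_triangle|]. rewrite Cmod_mult, (Cmod_sub_sym z0 z). lra.
Qed.

(* One row of the connection relation and of the expansion defining [dt]: [h] is a component of h0,
   and [H1], [H2] are the two entries of the same row of H. *)
Definition connected_row (r : Rbar) (alpha0 beta1 beta2 q Theta Omega : C)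
    (h H1 H2 : C -> C) (dt : nat -> C) : Prop :=
  holo_on (dom0 r) h /\ holo_on (dom1 r) H1 /\ holo_on (dom1 r) H2 /\
  (forall z, dom0 r z -> dom1 r z ->
     cpow z alpha0 * h z
     = (H1 z * cpow (1 - z) beta1 + H2 z * cpow (1 - z) beta2 * (q * clog (1 - z))) * Theta
       + H2 z * cpow (1 - z) beta2 * Omega)%C /\
  (exists eps, 0 < eps /\ forall z, dom0 r z -> dom1 r z -> Cmod (z - 1) < eps ->
     exists s, cseries (fun k => (1 - z) ^ k * dt k)%C s /\
       (cpow (1 - z) (- beta1 - 1) * (cpow z (- alpha0) * (H2 z * cpow (1 - z) beta2))
        = cpow (1 - z) (beta2 - beta1 - 1) * s)%C).

(** Multiplying the connection relation by (1-z)^(-beta1-1) z^(-alpha0) turns the first column of H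
    into phi / (1-z) with phi = z^(-alpha0) H1. Splitting off phi(1) = H1(1) gives the simple pole
    and a bounded difference quotient Q. The second column gives psi = z^(-alpha0) H2, identified
    with the sum of the series with coefficients dt by cancelling (1-z)^(delta-1). Both Q and psi
    live on a full neighbourhood of 1, Q punctured there. *)
Lemma connected_row_local (r : Rbar) (alpha0 beta1 beta2 q Theta Omega : C)
    (h H1 H2 : C -> C) (dt : nat -> C) : Rbar_lt 1 r ->
  connected_row r alpha0 beta1 beta2 q Theta Omega h H1 H2 dt ->
  let delta := (beta2 - beta1)%C in
  exists (Q psi : C -> C) (B eta : R), 0 < eta <= 1 /\ 0 <= B /\
    (forall z : C, z <> 1%C -> Cmod (z - 1) < eta -> (exists l, cder Q z l) /\ Cmod (Q z) <= B) /\
    (forall z : C, Cmod (z - 1) < eta -> (exists l, cder psi z l) /\ Cmod (psi z) <= B) /\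
    (forall z, dom0 r z -> Cmod (z - 1) < eta ->
      cpow (1 - z) (- beta1 - 1) * h z = Theta * H1 1 / (1 - z) + Q z
        + cpow (1 - z) (delta - 1) * psi z * (Theta * q * clog (1 - z) + Omega))%C /\
    (forall z, dom0 r z -> Cmod (z - 1) < eta -> cseries (fun k => (1 - z) ^ k * dt k)%C (psi z)).
Proof.
  intros hr [hh [hH1 [hH2 [hconn [eps [heps hdt]]]]]] delta. fold delta in hdt.
  destruct (dom1_near_1 r hr) as [eta0 [Heta0 Hdom1]].
  set (phi := fun z => (cpow z (- alpha0) * H1 z)%C).
  set (psi := fun z => (cpow z (- alpha0) * H2 z)%C).
  assert (Hd : forall K z, holo_on (dom1 r) K -> dom1 r z ->
            exists l, cder (fun z => cpow z (- alpha0) * K z)%C z l).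
  { intros K z HK Hz. destruct (ex_derive_cder _ _ (HK z Hz)) as [l Hl]. eexists.
    apply (cder_mult (fun z => cpow z (- alpha0)) K); [|exact Hl].
    apply cder_cpow. exact (proj2 Hz). }
  assert (H11 : dom1 r 1) by (apply Hdom1; rewrite Cmod_sub_self; lra).
  destruct (Hd H1 1%C hH1 H11) as [l1 Hl1]. fold phi in Hl1.
  destruct (Hd H2 1%C hH2 H11) as [l2 Hl2]. fold psi in Hl2.
  destruct (difference_quotient_bounded _ _ _ Hl1) as [e1 [He1 Hb1]].
  destruct (cder_ccont _ _ _ Hl2 1 Rlt_0_1) as [e2 [He2 Hb2]].
  set (eta := Rmin (Rmin eta0 eps) (Rmin e1 e2)).
  assert (Heta : 0 < eta) by (repeat apply Rmin_glb_lt; lra).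
  assert (Hle : eta <= eta0 /\ eta <= eps /\ eta <= e1 /\ eta <= e2).
  { unfold eta. pose proof (Rmin_l (Rmin eta0 eps) (Rmin e1 e2)).
    pose proof (Rmin_r (Rmin eta0 eps) (Rmin e1 e2)). pose proof (Rmin_l eta0 eps).
    pose proof (Rmin_r eta0 eps). pose proof (Rmin_l e1 e2). pose proof (Rmin_r e1 e2). lra. }
  destruct Hle as [L1 [L2 [L3 L4]]].
  (* The sum of the bounds for Q and for psi, so that one constant serves both. *)
  set (B := Cmod Theta * (Cmod l1 + 1) + (Cmod (psi 1%C) + 1)).
  assert (HB1 : 0 <= Cmod Theta * (Cmod l1 + 1)).
  { apply Rmult_le_pos; [apply Cmod_ge_0|]. pose proof (Cmod_ge_0 l1). lra. }
  pose proof (Cmod_ge_0 (psi 1%C)) as HB2.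
  exists (fun z => Theta * ((phi z - phi 1%C) / (1 - z)))%C, psi, B, eta.
  split; [lra|]. split; [unfold B; lra|]. split; [|split; [|split]].
  - intros z Hz1 Hz. split.
    + destruct (Hd H1 z hH1 (Hdom1 z ltac:(lra))) as [l Hl]. fold phi in Hl.
      eexists. apply cder_scal.
      apply (cder_mult (fun z => phi z - phi 1%C)%C (fun z => / (1 - z))%C).
      * apply cder_minus; [exact Hl|apply cder_const].
      * apply (cder_comp Cinv (fun z => 1 - z)%C); [|apply cder_one_minus].
        apply cder_inv. intros E. apply Hz1. symmetry. now apply Cminus_eq_0.
    + rewrite Cmod_mult.
      assert (Cmod Theta * Cmod ((phi z - phi 1%C) / (1 - z)) <= Cmod Theta * (Cmod l1 + 1)).
      { apply Rmult_le_compat_l; [apply Cmod_ge_0|]. apply Hb1; [exact Hz1|lra]. }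
      unfold B. lra.
  - intros z Hz. split; [apply (Hd H2 z hH2), Hdom1; lra|].
    replace (psi z) with ((psi z - psi 1%C) + psi 1%C)%C by ring.
    eapply Rle_trans; [apply Cmod_triangle|]. specialize (Hb2 z ltac:(lra)). unfold B. lra.
  - intros z Hz0 Hz. pose proof (Hdom1 z ltac:(lra)) as Hz1.
    pose proof (dom0_slit r z Hz0) as Hs. pose proof (slit_neq_0 _ Hs) as Hn.
    assert (Hzn : z <> 0%C) by (apply slit_neq_0; exact (proj2 Hz1)).
    assert (E1 : h z = (cpow z (- alpha0) * (cpow z alpha0 * h z))%C).
    { rewrite Cmult_assoc, cpow_opp_r by exact Hzn. ring. }
    rewrite E1, (hconn z Hz0 Hz1).
    assert (P1 : (cpow (1 - z) (- beta1 - 1) * cpow (1 - z) beta1 = / (1 - z))%C).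
    { rewrite <- cpow_plus by exact Hn. replace (- beta1 - 1 + beta1)%C with (- (1))%C by ring.
      now apply cpow_m1. }
    assert (P2 : (cpow (1 - z) (- beta1 - 1) * cpow (1 - z) beta2 = cpow (1 - z) (delta - 1))%C).
    { rewrite <- cpow_plus by exact Hn. f_equal. unfold delta. ring. }
    assert (Ephi : phi 1%C = H1 1%C) by (unfold phi; rewrite cpow_1_l; ring).
    rewrite Ephi. unfold phi, psi. rewrite <- P2.
    transitivity (cpow z (- alpha0) * H1 z * Theta * (cpow (1 - z) (- beta1 - 1) * cpow (1 - z) beta1)
      + cpow z (- alpha0) * H2 z * (q * clog (1 - z) * Theta + Omega)
        * (cpow (1 - z) (- beta1 - 1) * cpow (1 - z) beta2))%C; [ring|].
    rewrite P1. field. exact Hn.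
  - intros z Hz0 Hz. pose proof (Hdom1 z ltac:(lra)) as Hz1.
    pose proof (dom0_slit r z Hz0) as Hs. pose proof (slit_neq_0 _ Hs) as Hn.
    destruct (hdt z Hz0 Hz1 ltac:(lra)) as [s [Hser Es]].
    replace (psi z) with s; [exact Hser|].
    assert (P2 : (cpow (1 - z) (- beta1 - 1) * cpow (1 - z) beta2 = cpow (1 - z) (delta - 1))%C).
    { rewrite <- cpow_plus by exact Hn. f_equal. unfold delta. ring. }
    pose proof (cpow_neq_0 (1 - z) (delta - 1) Hn) as Hp.
    replace s with (/ cpow (1 - z) (delta - 1) * (cpow (1 - z) (delta - 1) * s))%C by (field; exact Hp).
    rewrite <- Es. unfold psi.
    transitivity (/ cpow (1 - z) (delta - 1) * (cpow z (- alpha0) * H2 z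
      * (cpow (1 - z) (- beta1 - 1) * cpow (1 - z) beta2)))%C; [ring|].
    rewrite P2. field. exact Hp.
Qed.

(** The constant omega is produced before the row and its coefficient sequences are introduced, so
    the two components of the vector statement share it, as do all n. *)
Lemma scalar_expansion (r : Rbar) (alpha0 beta1 beta2 q Theta Omega : C) : Rbar_lt 1 r ->
  beta1 <> beta2 -> Re (beta2 - beta1) > -1 -> (~ is_integer (beta2 - beta1) -> q = 0%C) ->
  exists omega : C, forall (h H1 H2 : C -> C) (d dt : nat -> C),
    connected_row r alpha0 beta1 beta2 q Theta Omega h H1 H2 dt ->
    (forall z, Cmod z < 1 ->
       cseries (fun k => z ^ k * d k)%C (cpow (1 - z) (- beta1 - 1) * h z)%C) ->
    forall n, bigO_power (fun k => d k - (Theta * H1 1 + omega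
        * csum (fun l => gterm (beta2 - beta1) l k * dt l) (S n)))%C
      (- Re (beta2 - beta1) - INR n - 1).
Proof.
  intros hr hb hdelta hq. set (delta := (beta2 - beta1)%C) in *.
  assert (Hdelta0 : delta <> 0%C) by (intros E; apply hb; symmetry; now apply Cminus_eq_0).
  assert (Hf : forall h, holo_on (dom0 r) h -> forall z, dom0 r z ->
            exists l, cder (fun z => cpow (1 - z) (- beta1 - 1) * h z)%C z l).
  { intros h hh z Hz. destruct (ex_derive_cder _ _ (hh z Hz)) as [l Hl]. eexists.
    apply (cder_mult (fun z => cpow (1 - z) (- beta1 - 1)) h); [|exact Hl].
    apply cder_cpow_one_minus. now apply (dom0_slit r). }
  destruct (classic (is_integer delta)) as [Hint|Hint].
  - destruct (integer_delta_nat delta Hint hdelta Hdelta0) as [m0 Hm0].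
    (* The coefficient Theta q of the logarithmic model times the sign relating its Taylor
       coefficients to [gterm]. *)
    exists (Theta * q * (-1) ^ S m0)%C.
    intros h H1 H2 d dt Hrow hd n. pose proof (proj1 Hrow) as hh.
    destruct (connected_row_local _ _ _ _ _ _ _ _ _ _ _ hr Hrow)
      as [Q [psi [B [eta [Heta [HB [HQ [Hpsi [Hloc Hser]]]]]]]]].
    fold delta in Hloc.
    (* Here (1-z)^(delta-1) is the polynomial (1-z)^m0, so the Omega term is regular at 1 and joins
       Q; only the logarithmic term is singular. *)
    apply (expansion r delta (Theta * H1 1%C)%C (Theta * q)%C ((-1) ^ S m0)%C (pow_log m0)
             (fun z => cpow (1 - z) (- beta1 - 1) * h z)%C
             (fun z => Q z + Omega * ((1 - z) ^ m0 * psi z))%C psi d dt 5 (B + Cmod Omega * B) eta);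
      auto; try lra.
    + intros z Hz. eexists. now apply cder_pow_log.
    + intros z Hz Hz1. now apply Cmod_pow_log_le.
    + intros l. exists (S (m0 + l)). intros k Hk u th Hu. rewrite Hm0. now apply coef_pow_log_gterm.
    + intros l. rewrite Hm0. apply gterm_bound_nat.
    + assert (0 <= Cmod Omega * B) by (apply Rmult_le_pos; [apply Cmod_ge_0|lra]). lra.
    + intros z Hz1 Hz. destruct (HQ z Hz1 Hz) as [[l Hl] HbQ]. destruct (Hpsi z Hz) as [[l' Hl'] Hbp].
      split.
      * eexists. apply cder_plus; [exact Hl|]. apply cder_scal.
        apply (cder_mult (fun z => (1 - z) ^ m0)%C psi); [apply cder_pow_one_minus|exact Hl'].
      * eapply Rle_trans; [apply Cmod_triangle|]. rewrite !Cmod_mult, Cmod_pow, (Cmod_sub_sym 1 z).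
        assert (0 <= Cmod (z - 1) ^ m0 <= 1).
        { split; [apply pow_le, Cmod_ge_0|]. apply Rle_trans with (1 ^ m0)%R; [|right; apply pow1].
          apply pow_incr. split; [apply Cmod_ge_0|lra]. }
        pose proof (Cmod_ge_0 (psi z)). pose proof (Cmod_ge_0 Omega).
        assert (Cmod (z - 1) ^ m0 * Cmod (psi z) <= B) by nra.
        assert (Cmod Omega * (Cmod (z - 1) ^ m0 * Cmod (psi z)) <= Cmod Omega * B)
          by (apply Rmult_le_compat_l; lra).
        lra.
    + intros z Hz0 Hz. rewrite (Hloc z Hz0 Hz). unfold pow_log.
      assert (E : cpow (1 - z) (delta - 1) = ((1 - z) ^ m0)%C).
      { rewrite <- cpow_nat by now apply (dom0_slit r). f_equal. rewrite Hm0, S_INR, RtoC_plus. ring. }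
      rewrite E. ring.
  - exists (Omega * / (CGamma delta * CGamma (1 - delta)))%C.
    intros h H1 H2 d dt Hrow hd n. pose proof (proj1 Hrow) as hh.
    destruct (connected_row_local _ _ _ _ _ _ _ _ _ _ _ hr Hrow)
      as [Q [psi [B [eta [Heta [HB [HQ [Hpsi [Hloc Hser]]]]]]]]].
    fold delta in Hloc.
    apply (expansion r delta (Theta * H1 1%C)%C Omega (/ (CGamma delta * CGamma (1 - delta)))%C
             (fun z => cpow (1 - z) (delta - 1))
             (fun z => cpow (1 - z) (- beta1 - 1) * h z)%C
             Q psi d dt (exp (Rabs (Im (delta - 1)) * PI)) B eta); auto.
    + intros z Hz. eexists. now apply cder_cpow_one_minus.
    + left. apply exp_pos.
    + intros z Hz Hz1. apply Cmod_cpow_one_minus_le; auto.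
      destruct delta as [x y]. simpl in *. lra.
    + intros l. exists O. intros k _ u th Hu. now apply coef_cpow_gterm.
    + intros l. now apply gterm_bound_nonint.
    + intros z Hz0 Hz. rewrite (Hloc z Hz0 Hz), hq by exact Hint. ring.
Qed.

(** * Assembly of the two components *)

Lemma vsum_csum (g : nat -> vec) (n : nat) :
  fold_right vadd vzero (map g (seq 0 n)) = (csum (fun l => fst (g l)) n, csum (fun l => snd (g l)) n).
Proof.
  induction n as [|n IH]; [reflexivity|].
  rewrite seq_S, map_app, fold_right_app. simpl csum.
  (* [seq_S] appends the last term at the end of the list, where [fold_right] adds it first, as the
     starting value of the fold over the others. *)
  assert (Hacc : forall s v, fold_right vadd v s = vadd (fold_right vadd vzero s) v).
  { intros s v. induction s as [|w s IHs]; simpl.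
    - destruct v. unfold vadd, vzero; simpl. f_equal; ring.
    - rewrite IHs. unfold vadd; simpl. f_equal; ring. }
  rewrite Hacc, IH. unfold vadd, vzero; simpl. f_equal; ring.
Qed.

Theorem theorem3
  (r : Rbar) (hr : Rbar_lt 1 r)
  (A B : mat) (G : C -> mat) (Gk Gtk : nat -> mat)
  (alpha0 beta1 beta2 : C) (a0 b1 b2 : vec)
  (h0 : C -> vec) (H : C -> mat) (q Theta Omega : C)
  (d dt : nat -> vec)
  (* G holomorphic on D *)
  (hG : mholo_on (diskD r) G)
  (* (a) *)
  (ha0 : a0 <> vzero) (hAa0 : mv A a0 = vscal alpha0 a0)
  (hAinv : forall k : nat, (1 <= k)%nat ->
             mdet (madd A (mscal (- (alpha0 + RtoC (INR k)))%C mid)) <> 0%C)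
  (* (b) *)
  (hb12 : beta1 <> beta2)
  (hdelta : Re (beta2 - beta1)%C > -1)
  (hb1 : b1 <> vzero) (hBb1 : mv B b1 = vscal beta1 b1)
  (hb2 : b2 <> vzero) (hBb2 : mv B b2 = vscal beta2 b2)
  (* (c) *)
  (hGk : forall z : C, Cmod z < 1 ->
           mseries (fun k => mscal (Cpow z k) (Gk k)) (G z))
  (hGtk : forall z : C, Rbar_lt (Cmod (z - 1) + 1) r -> Cmod (z - 1) < 1 ->
           mseries (fun k => mscal (Cpow (1 - z) k) (Gtk k)) (G z))
  (* y0 = z^alpha0 h0(z) is a solution, h0 holomorphic on G0, h0(0) = a0 *)
  (hh0 : vholo_on (dom0 r) h0) (hh00 : h0 0%C = a0)
  (hy0 : forall z : C, dom0 r z -> dom1 r z ->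
           vis_derive (fun w => vscal (cpow w alpha0) (h0 w)) z
             (mv (sysM A B G z) (vscal (cpow z alpha0) (h0 z))))
  (* Y is a fundamental matrix *)
  (hH : mholo_on (dom1 r) H)
  (hH1 : col1 (H 1%C) = b1) (hH2 : col2 (H 1%C) = b2)
  (hq : ~ is_integer (beta2 - beta1)%C -> q = 0%C)
  (hY1 : forall z : C, dom0 r z -> dom1 r z ->
           vis_derive (fun w => col1 (fundY H beta1 beta2 q w)) z
             (mv (sysM A B G z) (col1 (fundY H beta1 beta2 q z))))
  (hY2 : forall z : C, dom0 r z -> dom1 r z ->
           vis_derive (fun w => col2 (fundY H beta1 beta2 q w)) z
             (mv (sysM A B G z) (col2 (fundY H beta1 beta2 q z))))
  (hYdet : forall z : C, dom0 r z -> dom1 r z ->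
           mdet (fundY H beta1 beta2 q z) <> 0%C)
  (* connection coefficients *)
  (hconn : forall z : C, dom0 r z -> dom1 r z ->
           vscal (cpow z alpha0) (h0 z) = mv (fundY H beta1 beta2 q z) (Theta, Omega))
  (* d_k *)
  (hd : forall z : C, Cmod z < 1 ->
          vseries (fun k => vscal (Cpow z k) (d k))
                  (vscal (cpow (1 - z) (- beta1 - 1)%C) (h0 z)))
  (* dt_k *)
  (hdt : exists eps : R, 0 < eps /\
          forall z : C, dom0 r z -> dom1 r z -> Cmod (z - 1) < eps ->
            exists s : vec,
              vseries (fun k => vscal (Cpow (1 - z) k) (dt k)) s /\
              vscal (cpow (1 - z) (- beta1 - 1)%C)
                (vscal (cpow z (- alpha0)%C) (col2 (fundY H beta1 beta2 q z)))
              = vscal (cpow (1 - z) (beta2 - beta1 - 1)%C) s) :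
  exists omega : C,
    forall n : nat,
      exists K : R, exists k0 : nat,
        forall k : nat, (k0 <= k)%nat ->
          vnorm (vsub (d k)
                  (vadd (vscal Theta b1)
                     (vscal (omega / CGamma (RtoC (INR (k + 1))))%C
                        (fold_right vadd vzero
                           (map (fun l : nat =>
                                   vscal ((-1) ^ l * CGamma (RtoC (INR l) + (beta2 - beta1))
                                          * CGamma (RtoC (INR k) - RtoC (INR l) + 1
                                                    - (beta2 - beta1)))%C
                                         (dt l))
                                (seq 0 (S n)))))))
          <= K * Rpower (INR k) (- Re (beta2 - beta1)%C - INR n - 1).
Proof.
  destruct (scalar_expansion r alpha0 beta1 beta2 q Theta Omega hr hb12 hdelta hq) as [omega Hom].
  exists omega. intros n.
  destruct hH as [hH11 [hH12 [hH21 hH22]]].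
  destruct hh0 as [hh1 hh2].
  assert (E1 : m11 (H 1%C) = fst b1) by (rewrite <- hH1; reflexivity).
  assert (E2 : m21 (H 1%C) = snd b1) by (rewrite <- hH1; reflexivity).
  destruct hdt as [eps [heps hdt]].
  (* The first components form a row in the sense of [connected_row], with the first row of H; the
     second components follow likewise. *)
  assert (HA : bigO_power (fun k => fst (d k) - (Theta * m11 (H 1%C) + omega
      * csum (fun l => gterm (beta2 - beta1) l k * fst (dt l)) (S n)))%C
      (- Re (beta2 - beta1) - INR n - 1)).
  { apply (Hom (fun z => fst (h0 z)) (fun z => m11 (H z)) (fun z => m12 (H z)));
      [repeat (split; [assumption|]); split|].
    - intros z Hz0 Hz1. pose proof (f_equal fst (hconn z Hz0 Hz1)) as E. simpl in E.
      rewrite E. ring.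
    - exists eps. split; [exact heps|]. intros z Hz0 Hz1 Hz.
      destruct (hdt z Hz0 Hz1 Hz) as [s [[Hs _] E]]. exists (fst s). split; [exact Hs|].
      apply (f_equal fst) in E. simpl in E. rewrite <- E. ring.
    - intros z Hz. exact (proj1 (hd z Hz)). }
  assert (HB : bigO_power (fun k => snd (d k) - (Theta * m21 (H 1%C) + omega
      * csum (fun l => gterm (beta2 - beta1) l k * snd (dt l)) (S n)))%C
      (- Re (beta2 - beta1) - INR n - 1)).
  { apply (Hom (fun z => snd (h0 z)) (fun z => m21 (H z)) (fun z => m22 (H z)));
      [repeat (split; [assumption|]); split|].
    - intros z Hz0 Hz1. pose proof (f_equal snd (hconn z Hz0 Hz1)) as E. simpl in E.
      rewrite E. ring.
    - exists eps. split; [exact heps|]. intros z Hz0 Hz1 Hz.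
      destruct (hdt z Hz0 Hz1 Hz) as [s [[_ Hs] E]]. exists (snd s). split; [exact Hs|].
      apply (f_equal snd) in E. simpl in E. rewrite <- E. ring.
    - intros z Hz. exact (proj2 (hd z Hz)). }
  destruct HA as [K1 [k1 HA]]. destruct HB as [K2 [k2 HB]].
  exists (K1 + K2), (k1 + k2)%nat. intros k Hk.
  specialize (HA k ltac:(lia)). specialize (HB k ltac:(lia)).
  rewrite Rmult_plus_distr_r. rewrite E1 in HA. rewrite E2 in HB.
  rewrite vsum_csum. unfold vnorm, vsub, vadd, vscal. cbn [fst snd].
  apply Rplus_le_compat.
  - match goal with |- Cmod ?a <= _ => match type of HA with Cmod ?b <= _ => replace a with b end end;
      [exact HA|].
    (* [gterm] carries 1 / Gamma(k+1) in every summand, while the statement has it in front of the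
       sum. *)
    f_equal. f_equal. unfold Cdiv. rewrite <- Cmult_assoc, <- (csum_scal (/ _)).
    f_equal. apply csum_ext. intros l _. unfold gterm, vscal, Cdiv. cbn [fst]. ring.
  - match goal with |- Cmod ?a <= _ => match type of HB with Cmod ?b <= _ => replace a with b end end;
      [exact HB|].
    f_equal. f_equal. unfold Cdiv. rewrite <- Cmult_assoc, <- (csum_scal (/ _)).
    f_equal. apply csum_ext. intros l _. unfold gterm, vscal, Cdiv. cbn [snd]. ring.
Qed.
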